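(* Let $Z$ be a complex separable infinite-dimensional Banach space and let $A$ be a bounded linear operator on $Z$. Suppose that $A$ admits an eigenvectorfield $E$ which is analytic in a neighborhood of $\mathbb{T}$, i.e. there are an open neighborhood $\Omega$ of $\mathbb{T}$ in $\mathbb{C}$ and an analytic map $E:\Omega\to Z$ such that $AE(\lambda)=\lambda E(\lambda)$ for every $\lambda\in\mathbb{T}$, and suppose that $\overline{\mathrm{span}}\,[E(\lambda);\ \lambda\in\mathbb{T}]=Z$. Then $A$ is universal for invertible ergodic systems. If $E$ is analytic in a neighborhood of the closed unit disk $\overline{\mathbb{D}}$ (with $AE(\lambda)=\lambda E(\lambda)$ for every $\lambda\in\mathbb{T}$) and $\overline{\mathrm{span}}\,[E(\lambda);\ \lambda\in\mathbb{T}]=Z$, then $A$ is universal for ergodic systems.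
   Context: $\mathbb{T}=\{\lambda\in\mathbb{C}:|\lambda|=1\}$ and $\mathbb{D}=\{\lambda\in\mathbb{C}:|\lambda|<1\}$. A dynamical system $(X,\mathcal{B},\mu;T)$ consists of a probability space $(X,\mathcal{B},\mu)$ and a $\mu$-preserving measurable transformation $T$ of $X$; it is invertible if $T$ is invertible (with measurable inverse, mod $\mu$). A standard Lebesgue probability space is a probability space isomorphic (mod null sets) to $[0,1]$ with Lebesgue measure. Isomorphism of dynamical systems means measure-theoretic isomorphism (mod null sets). $\mathcal{B}_Z$ denotes the Borel $\sigma$-field of $Z$; a Borel probability measure $\nu$ on $Z$ has full support if $\nu(U)>0$ for every non-empty open $U\subseteq Z$. A bounded operator $A$ on $Z$ is universal for ergodic systems (resp. universal for invertible ergodic systems) if for every ergodic (resp. invertible ergodic) dynamical system $(X,\mathcal{B},\mu;T)$ on a standard Lebesgue probability space there exists an $A$-invariant Borel probability measure $\nu$ on $Z$ with full support such that the dynamical systems $(X,\mathcal{B},\mu;T)$ and $(Z,\mathcal{B}_Z,\nu;A)$ are isomorphic. *)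

(* Defs.v *)
From HB Require Import structures.
From mathcomp Require Import all_boot all_order all_algebra complex.
From mathcomp Require Import all_classical all_reals all_analysis.
Import Order.TTheory GRing.Theory Num.Theory numFieldNormedType.Exports.

Set Implicit Arguments.
Unset Strict Implicit.
Unset Printing Implicit Defensive.

Local Open Scope classical_set_scope.
Local Open Scope ring_scope.

(** ** Functional analysis *)

Section functional_analysis.
Context {K : numFieldType}.

Definition unit_circle : set K := [set z | `|z| = 1].

Definition closed_unit_disk : set K := [set z | `|z| <= 1].

Definition lin_span {V : lmodType K} (S : set V) : set V :=
  [set v | exists n (a : 'I_n -> K) (x : 'I_n -> V),
     (forall i, S (x i)) /\ v = \sum_(i < n) a i *: x i].

Definition infinite_dimensional (V : lmodType K) : Prop :=
  forall n (x : 'I_n -> V), lin_span (range x) <> setT.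

Definition separable (T : topologicalType) : Prop :=
  exists2 D : set T, countable D & dense D.

Definition bounded_operator {V : normedModType K} (A : V -> V) : Prop :=
  exists M : K, forall x, `|A x| <= M * `|x|.

(* Over a general [numFieldType], [0 < r] entails that [r] is real. *)
Definition analytic_at {V : normedModType K} (E : K -> V) (z : K) : Prop :=
  exists (a : nat -> V) (r : K), 0 < r /\
    forall w, `|w - z| < r ->
      series (fun n => (w - z) ^+ n *: a n) @ \oo --> E w.

(* Functions on [Omega] are total functions whose values off [Omega] are
   ignored. *)
Definition analytic_on {V : normedModType K} (Omega : set K) (E : K -> V) :
    Prop :=
  forall z, Omega z -> analytic_at E z.

Definition eigenvectorfield {V : lmodType K} (A : V -> V) (E : K -> V) :
    Prop :=
  forall z, unit_circle z -> A (E z) = z *: E z.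

(* [E] is an eigenvectorfield for [A] (on the unit circle) which is analytic
   in some open neighbourhood of [D], and whose values on the unit circle have
   dense linear span. *)
Definition spanning_analytic_eigenvectorfield {V : normedModType K}
    (D : set K) (A : V -> V) (E : K -> V) : Prop :=
  [/\ exists Omega : set K,
        [/\ open Omega, D `<=` Omega & analytic_on Omega E],
      eigenvectorfield A E
    & closure (lin_span (E @` unit_circle)) = setT].

End functional_analysis.

(** ** Ergodic theory *)

Section ergodic_theory.
Context {R : realType}.

Definition measure_preserving d (X : measurableType d)
    (mu : probability X R) (T : X -> X) : Prop :=
  measurable_fun setT T /\
  forall B, measurable B -> mu (T @^-1` B) = mu B.

Definition ergodic d (X : measurableType d)
    (mu : probability X R) (T : X -> X) : Prop :=
  forall B, measurable B -> T @^-1` B = B -> mu B = 0%E \/ mu B = 1%E.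

(* [phi] is measurable from the [mu]-completion of [X] to [Y], and its image
   measure is [nu].  Measurability is only required up to null sets so that
   the notion does not depend on whether the sigma-algebras at hand are
   complete (Lebesgue sets) or not (Borel sets). *)
Definition preserving_mod_null d1 d2 (X : measurableType d1)
    (Y : measurableType d2) (mu : {measure set X -> \bar R})
    (nu : {measure set Y -> \bar R}) (phi : X -> Y) : Prop :=
  forall B, measurable B -> exists A,
    [/\ measurable A, mu.-negligible (A `+` phi @^-1` B) & mu A = nu B].

Definition isomorphism_mod_null d1 d2 (X : measurableType d1)
    (Y : measurableType d2) (mu : {measure set X -> \bar R})
    (nu : {measure set Y -> \bar R}) (phi : X -> Y) : Prop :=
  preserving_mod_null mu nu phi /\
  exists psi : Y -> X,
    [/\ preserving_mod_null nu mu psi,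
        {ae mu, forall x, psi (phi x) = x}
      & {ae nu, forall y, phi (psi y) = y}].

Definition isomorphic_systems d1 d2 (X : measurableType d1)
    (Y : measurableType d2) (mu : probability X R) (T : X -> X)
    (nu : probability Y R) (S : Y -> Y) : Prop :=
  exists2 phi : X -> Y, isomorphism_mod_null mu nu phi
    & {ae mu, forall x, phi (T x) = S (phi x)}.

Definition invertible_mod_null d (X : measurableType d)
    (mu : probability X R) (T : X -> X) : Prop :=
  isomorphism_mod_null mu mu T.

(* Up to a null set, [0, 1] with the Lebesgue measure is the real line with
   the Lebesgue measure restricted to [0, 1]. *)
Definition standard_lebesgue d (X : measurableType d)
    (mu : probability X R) : Prop :=
  exists phi : X -> measurableTypeR R,
    isomorphism_mod_null mu
      (mrestr (@lebesgue_measure R) (measurable_itv `[0, 1])) phi.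

End ergodic_theory.

(** ** Universality *)

Definition borel (T : ptopologicalType) := g_sigma_algebraType (@open T).

Section universality.
Context {R : realType} {Z : normedModType R[i]}.

Definition full_support (nu : probability (borel Z) R) : Prop :=
  forall U : set Z, open U -> U !=set0 -> (0 < nu U)%E.

Definition modeled_by (A : Z -> Z) d (X : measurableType d)
    (mu : probability X R) (T : X -> X) : Prop :=
  exists nu : probability (borel Z) R,
    [/\ measure_preserving nu (A : borel Z -> borel Z), full_support nu
      & isomorphic_systems mu T nu (A : borel Z -> borel Z)].

Definition universal_for_ergodic (A : Z -> Z) : Prop :=
  forall d (X : measurableType d) (mu : probability X R) (T : X -> X),
    standard_lebesgue mu -> measure_preserving mu T -> ergodic mu T ->
    modeled_by A mu T.

Definition universal_for_invertible_ergodic (A : Z -> Z) : Prop :=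
  forall d (X : measurableType d) (mu : probability X R) (T : X -> X),
    standard_lebesgue mu -> measure_preserving mu T ->
    invertible_mod_null mu T -> ergodic mu T ->
    modeled_by A mu T.

End universality.

(* Main.v *)
Require Import Defs.
From HB Require Import structures.
From mathcomp Require Import all_boot all_order all_algebra complex.
From mathcomp Require Import all_classical all_reals all_analysis.
From mathcomp Require Import measurable_realfun.
From mathcomp Require Import ring lra zify.
Import Order.TTheory GRing.Theory Num.Theory numFieldNormedType.Exports.
Set Implicit Arguments.
Unset Strict Implicit.
Unset Printing Implicit Defensive.
Local Open Scope classical_set_scope.
Local Open Scope ring_scope.

(** Multiplying [E] by a polynomial and dividing it by [xi o E], for a suitable
   functional [xi], one may assume that [xi o E] is a polynomial [p] with
   [p(0) <> 0].  The Fourier coefficients [z_n] of [E] on the circle are then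
   absolutely summable and span a dense subspace, [A z_n = z_(n-1)], and [xi z_n]
   is the [n]-th coefficient of [p]; moreover [z_n = 0] for [n < 0] if [E] is
   analytic on the disk.  Hence, for a bounded function [f] on a system [(X, S)],
   the map [phi_f x = sum_n f (S^n x) z_n] satisfies [phi_f o S = A o phi_f].

   One looks for [f] such that [phi_f] is injective almost everywhere and
   its image measure has full support.  Since
   [xi (A^m (phi_f x)) = sum_j p_j f (S^(m+j) x)], a small generic perturbation
   of a finite-valued [f] makes [x] readable from [phi_f x] up to a small error,
   off a set of small measure; this uses that [S] has almost no periodic point.
   By density of the span of the [z_n], changing [f] on a thin tower makes [phi_f]
   visit a given ball with positive probability.  Alternating the two steps with
   rapidly decreasing tolerances, the maps [phi_f] converge almost everywhere by
   the Borel-Cantelli lemma, and all the properties pass to the limit. *)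

(** * Real-valued norm and limits *)

Section real_norm.
Context {R : realType}.
Local Notation C := R[i].

(** Two constraints shape the construction. A point has to be recovered from [phi_f x] alone and,
    when [S] is not invertible, from its forward orbit only. A functional [xi] with [xi o E]
    polynomial meets both: [xi (A^m y)] reads a finite window of values of [f] starting at time [m],
    and [p(0) <> 0] makes the value at time [m] itself contribute. In the disk case, this is why
    [xi] is chosen on the leading Taylor coefficient of [E] at [0]: the division then creates no
    pole there.

    After the division, the field is used only through first order expansions with a quadratic
    remainder. They give the [O(1/n^2)] decay of the Fourier coefficients by second differences, and
    the mean value property on the disk by a discrete argument; Riemann sums over roots of unity
    replace integrals throughout.

    A perturbation made for injectivity could undo earlier visits to balls, and conversely. Each
    stage therefore records explicit radii within which its gains survive, and the sum of all later
    perturbations stays within them. *)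

Definition nrm {V : normedZmodType C} (x : V) : R := complex.Re `|x|.

Section zmod.
Context {V : normedZmodType C}.
Implicit Types x y : V.

Lemma nrmE x : (nrm x)%:C%C = `|x|.
Proof. by rewrite /nrm RRe_real// normr_real. Qed.

Lemma nrm_ge0 x : 0 <= nrm x.
Proof. by have := normr_ge0 x; rewrite -nrmE ler0c. Qed.

Lemma nrm0 : nrm (0 : V) = 0.
Proof. by rewrite /nrm normr0. Qed.

Lemma nrm_eq0 x : nrm x = 0 -> x = 0.
Proof. by move=> h; apply/normr0_eq0; rewrite -nrmE h. Qed.

Lemma nrmN x : nrm (- x) = nrm x.
Proof. by rewrite /nrm normrN. Qed.

Lemma nrmD x y : nrm (x + y) <= nrm x + nrm y.
Proof. by rewrite -lecR rmorphD /= !nrmE ler_normD. Qed.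

Lemma nrmB x y : nrm (x - y) <= nrm x + nrm y.
Proof. by rewrite -(nrmN y) nrmD. Qed.

Lemma nrm_sub x y : nrm (x - y) = nrm (y - x).
Proof. by rewrite -nrmN opprB. Qed.

Lemma nrm_tri y x z : nrm (x - z) <= nrm (x - y) + nrm (y - z).
Proof. by rewrite -[x - z](subrKA y) nrmD. Qed.

Lemma nrm_le_sub x y : nrm x - nrm y <= nrm (x - y).
Proof. by rewrite lerBlDr -{1}[x](subrK y) nrmD. Qed.

Lemma nrm_sum (I : Type) (r : seq I) (P : pred I) (F : I -> V) :
  nrm (\sum_(i <- r | P i) F i) <= \sum_(i <- r | P i) nrm (F i).
Proof.
elim/big_ind2 : _ => //; first by rewrite nrm0.
by move=> x1 x2 y1 y2 h1 h2; apply: le_trans (nrmD _ _) _; exact: lerD.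
Qed.

Lemma normr_le x (r : R) : (`|x| <= r%:C%C) = (nrm x <= r).
Proof. by rewrite -nrmE lecR. Qed.

Lemma normr_lt x (r : R) : (`|x| < r%:C%C) = (nrm x < r).
Proof. by rewrite -nrmE ltcR. Qed.

Lemma gt0_complex (r : C) : 0 < r -> 0 < complex.Re r /\ r = (complex.Re r)%:C%C.
Proof.
move=> r0; have rr : (complex.Re r)%:C%C = r by rewrite RRe_real// gtr0_real.
by split=> //; rewrite -ltcR rr.
Qed.

End zmod.

Lemma nrmM (x y : C) : nrm (x * y) = nrm x * nrm y.
Proof. by apply: complexI; rewrite rmorphM /= !nrmE normrM. Qed.

Lemma nrm1 : nrm (1 : C) = 1.
Proof. by rewrite /nrm normr1. Qed.

Lemma nrmX (x : C) n : nrm (x ^+ n) = nrm x ^+ n.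
Proof. by elim: n => [|n ih]; rewrite ?expr0 ?nrm1// !exprS nrmM ih. Qed.

Lemma nrmV (x : C) : nrm (x^-1) = (nrm x)^-1.
Proof. by apply: complexI; rewrite fmorphV /= !nrmE normfV. Qed.

Lemma nrmR (r : R) : nrm (r%:C%C) = `|r|.
Proof. by rewrite /nrm normc_def/= expr0n addr0 sqrtr_sqr. Qed.

Lemma nrm_nat n : nrm (n%:R : C) = n%:R.
Proof. by rewrite -(rmorph_nat (real_complex R)) nrmR ger0_norm. Qed.

Lemma nrm_gt0 (V : normedZmodType C) (x : V) : x != 0 -> 0 < nrm x.
Proof.
by move=> x0; rewrite lt_neqAle nrm_ge0 andbT; apply/eqP => /esym/nrm_eq0/eqP; exact/negP.
Qed.

Section normedmod.
Context {V : normedModType C}.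
Implicit Types x y : V.

Lemma nrmZ (a : C) x : nrm (a *: x) = nrm a * nrm x.
Proof. by apply: complexI; rewrite rmorphM /= !nrmE normrZ. Qed.

End normedmod.

(* Convergence is expressed with the real-valued norm, so that [lra] and [nra]
   apply to the estimates. *)
Definition to_lim {V : normedZmodType C} (u : nat -> V) (l : V) :=
  forall e : R, 0 < e -> exists N, forall n, (N <= n)%N -> nrm (u n - l) <= e.

Section lim.
Context {V : normedZmodType C}.
Implicit Types (u v : nat -> V) (x y l : V).

Lemma to_lim_cst l : to_lim (fun=> l) l.
Proof. by move=> e e0; exists 0 => n _; rewrite subrr nrm0 ltW. Qed.

Lemma to_limD u v l m : to_lim u l -> to_lim v m ->
  to_lim (fun n => u n + v n) (l + m).
Proof.
move=> ul vm e e0; have e2 : 0 < e / 2 by rewrite divr_gt0.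
have [N hN] := ul _ e2; have [M hM] := vm _ e2.
exists (maxn N M) => n; rewrite geq_max => /andP[Nn Mn].
rewrite opprD addrACA (le_trans (nrmD _ _))// (splitr e).
by rewrite lerD ?hN ?hM.
Qed.

Lemma to_limN u l : to_lim u l -> to_lim (fun n => - u n) (- l).
Proof.
by move=> h e /h [N hN]; exists N => n /hN; rewrite -opprD nrmN.
Qed.

Lemma to_limB u v l m : to_lim u l -> to_lim v m ->
  to_lim (fun n => u n - v n) (l - m).
Proof. by move=> ul /to_limN; exact: to_limD. Qed.

Lemma eq_to_lim u v l : u =1 v -> to_lim u l -> to_lim v l.
Proof. by move=> uv h e /h [N hN]; exists N => n /hN; rewrite uv. Qed.

Lemma to_lim_near u v l N : (forall n, (N <= n)%N -> u n = v n) ->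
  to_lim u l -> to_lim v l.
Proof.
move=> uv h e /h [M hM]; exists (maxn N M) => n; rewrite geq_max => /andP[Nn Mn].
by rewrite -uv// hM.
Qed.

Lemma to_lim_uniq u l m : to_lim u l -> to_lim u m -> l = m.
Proof.
move=> ul um; apply/eqP; rewrite -subr_eq0; apply/eqP/nrm_eq0/eqP.
rewrite eq_le nrm_ge0 andbT; apply/ler_addgt0Pr => e e0; rewrite add0r.
have e2 : 0 < e / 2 by rewrite divr_gt0.
have [N hN] := ul _ e2; have [M hM] := um _ e2.
rewrite (le_trans (nrm_tri (u (maxn N M)) _ _))// (splitr e) lerD//.
  by rewrite nrm_sub hN// leq_maxl.
by rewrite hM// leq_maxr.
Qed.

Lemma to_lim_subseq u l (s : nat -> nat) : (forall n, (n <= s n)%N) ->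
  to_lim u l -> to_lim (fun n => u (s n)) l.
Proof.
by move=> ns h e /h [N hN]; exists N => n Nn; apply: hN; apply: leq_trans (ns n).
Qed.

Lemma to_lim_nrm_le u l (c : R) : to_lim u l ->
  (forall M, exists2 n, (M <= n)%N & nrm (u n) <= c) -> nrm l <= c.
Proof.
move=> ul uc; apply/ler_addgt0Pr => e e0; have [N hN] := ul _ e0.
have [n Nn un] := uc N; have := nrm_le_sub l (u n).
by rewrite nrm_sub; have := hN _ Nn; lra.
Qed.

Lemma to_lim_nrm_sub_le u l x (c : R) : to_lim u l ->
  (forall M, exists2 n, (M <= n)%N & nrm (u n - x) <= c) -> nrm (l - x) <= c.
Proof.
by move=> ul h; apply: (to_lim_nrm_le (u := fun n => u n - x)) => //; apply: to_limB => //; exact: to_lim_cst.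
Qed.

Lemma to_lim_bounded u l : to_lim u l -> exists2 M : R, 0 < M & forall n, nrm (u n) <= M.
Proof.
move=> /(_ 1 ltr01)[N hN].
exists (1 + nrm l + \sum_(i < N) nrm (u i)).
  have : 0 <= \sum_(i < N) nrm (u i) by apply: sumr_ge0 => *; exact: nrm_ge0.
  by have := nrm_ge0 l; lra.
move=> n; have [Nn|nN] := leqP N n.
  have := hN _ Nn; have := nrm_le_sub (u n) l.
  have : 0 <= \sum_(i < N) nrm (u i) by apply: sumr_ge0 => *; exact: nrm_ge0.
  lra.
rewrite (bigD1 (Ordinal nN)) //=; have := nrm_ge0 l.
have : 0 <= \sum_(i < N | i != Ordinal nN) nrm (u i) by apply: sumr_ge0 => *; exact: nrm_ge0.
lra.
Qed.

End lim.

Lemma to_limZ {V : normedModType C} (a : C) (u : nat -> V) l :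
  to_lim u l -> to_lim (fun n => a *: u n) (a *: l).
Proof.
move=> h e e0; have a0 : 0 < nrm a + 1 by have := nrm_ge0 a; lra.
have [|N hN] := h (e / (nrm a + 1)); first exact: divr_gt0.
exists N => n /hN; rewrite -scalerBr nrmZ ler_pdivlMr// => hn.
by have := nrm_ge0 (u n - l); nra.
Qed.

Lemma to_lim_sum {V : normedZmodType C} n (u : 'I_n -> nat -> V) (l : 'I_n -> V) :
  (forall i, to_lim (u i) (l i)) -> to_lim (fun k => \sum_(i < n) u i k) (\sum_(i < n) l i).
Proof.
elim: n u l => [|n ih] u l h.
  by rewrite big_ord0; apply: eq_to_lim (to_lim_cst _) => k; rewrite big_ord0.
rewrite big_ord_recr; apply: (@eq_to_lim _ (fun k => \sum_(i < n) u (widen_ord (leqnSn n) i) k + u ord_max k)).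
  by move=> k; rewrite big_ord_recr.
by apply: to_limD => //; apply: ih => i.
Qed.

Lemma inv_nat_small (e : R) : 0 < e -> exists N, forall n, (N <= n)%N -> n.+1%:R^-1 <= e.
Proof.
move=> e0; exists (Num.bound e^-1) => n hn; rewrite invf_ple ?posrE ?ltr0Sn//.
have := archi_boundP (ltW (divr_gt0 ltr01 e0)); rewrite div1r => h.
by rewrite (le_trans (ltW h))// ler_nat leqW.
Qed.

Lemma cst_div_nat_small (c e : R) : 0 < e -> exists N, forall n, (N <= n)%N -> c / n.+1%:R <= e.
Proof.
move=> e0; have c0 : 0 < `|c| + 1 by rewrite ltr_wpDl.
have [N hN] := inv_nat_small (divr_gt0 e0 c0); exists N => n /hN.
rewrite ler_pdivlMr// mulrC => h; apply: le_trans h.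
by rewrite ler_wpM2r ?invr_ge0// (le_trans (ler_norm c))// lerDl.
Qed.

Lemma to_lim_cvg {V : normedModType C} (u : nat -> V) l : (u @ \oo --> l) <-> to_lim u l.
Proof.
split=> [/cvgrPdist_le h e e0|h].
  have [N _ hN] : \forall n \near \oo, `|l - u n| <= e%:C%C by apply: h; rewrite ltcR.
  by exists N => n Nn; have := hN n Nn; rewrite /= normr_le nrm_sub.
apply/cvgrPdist_le => e /gt0_complex[e0 ->].
have [N hN] := h _ e0.
by exists N => // n Nn; rewrite /= normr_le nrm_sub hN.
Qed.

Lemma to_lim_complete {V : completeNormedModType C} (u : nat -> V) :
  (forall e : R, 0 < e -> exists N, forall n m, (N <= n)%N -> (N <= m)%N -> nrm (u n - u m) <= e) ->
  exists l, to_lim u l.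
Proof.
move=> h; suff : cvg (u @ \oo) by move=> /cvg_ex[l /to_lim_cvg ul]; exists l.
apply/cauchy_cvgP/cauchyP => e /gt0_complex[e0 ->].
have [|N hN] := h (complex.Re e / 2); first by rewrite divr_gt0.
exists (u N); exists N => // n Nn /=.
rewrite -ball_normE /= normr_lt (le_lt_trans (hN _ _ _ _))//.
by rewrite ltr_pdivrMr// ltr_pMr// ltr1n.
Qed.

Lemma nbhs_nrm {V : normedModType C} (x : V) (U : set V) :
  nbhs x U <-> exists2 r : R, 0 < r & forall y, nrm (y - x) < r -> U y.
Proof.
split=> [/nbhs_ballP[e/= /gt0_complex[e0 ee]] h|[r r0 h]].
  exists (complex.Re e) => // y yx; apply: h; rewrite -ball_normE /= ee.
  by rewrite normr_lt nrm_sub.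
apply/nbhs_ballP; exists r%:C%C; first by rewrite /= ltcR.
by move=> y; rewrite -ball_normE /= normr_lt nrm_sub => /h.
Qed.

Lemma closure_nrm {V : normedModType C} (S : set V) (x : V) :
  closure S x <-> forall e : R, 0 < e -> exists2 y, S y & nrm (y - x) < e.
Proof.
split=> [cS e e0|h U /nbhs_nrm[r r0 hU]].
  have [|y [Sy]] := cS [set y | nrm (y - x) < e]; first by apply/nbhs_nrm; exists e.
  by exists y.
by have [y Sy /hU] := h _ r0; exists y.
Qed.

End real_norm.

(** * Functionals *)

Section hahn_banach.
Context {R : realType} {V : normedModType R[i]}.
Local Notation C := R[i].

(* A partial real-linear functional is encoded by its graph; being dominated by
   the norm, a graph stable under real combinations is automatically that of a
   function. *)
Let dominated_graph (G : set (V * R)) :=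
  (forall (t : R) p q, G p -> G q -> G (t%:C%C *: p.1 + q.1, t * p.2 + q.2)) /\
  (forall p, G p -> p.2 <= nrm p.1).

(** One-dimensional Hahn-Banach step. The value [c] at [y] must be at least every
    [p.2 - nrm (p.1 - y)] and at most every [nrm (p.1 + y) - p.2]; the triangle inequality makes
    these demands compatible, and the supremum of the lower bounds is taken. *)
Lemma dominated_graph_extend (G : set (V * R)) (y : V) :
  dominated_graph G -> G !=set0 ->
  exists2 H, dominated_graph H & G `<=` H /\ exists c, H (y, c).
Proof.
move=> [Glin Gdom] [g0 Gg0].
have Gzero : G (0, 0).
  have := Glin (-1) _ _ Gg0 Gg0; rewrite rmorphN1 scaleN1r addNr mulN1r.
  by rewrite addNr.
pose S := [set p.2 - nrm (p.1 - y) | p in G].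
have Sub p : G p -> ubound S (nrm (p.1 + y) - p.2).
  move=> Gp _ [q Gq <-]; have := Gdom _ (Glin 1 _ _ Gp Gq).
  rewrite /= rmorph1 scale1r mul1r => h.
  have := nrmD (p.1 + y) (q.1 - y); rewrite addrACA subrr addr0; lra.
have S0 : S !=set0 by exists (g0.2 - nrm (g0.1 - y)); exists g0.
have Ssup : has_sup S by split=> //; exists (nrm (g0.1 + y) - g0.2); exact: Sub.
pose c := sup S.
have c_le p : G p -> c <= nrm (p.1 + y) - p.2 by move=> Gp; apply: ge_sup => //; exact: Sub.
have c_ge p : G p -> p.2 - nrm (p.1 - y) <= c.
  by move=> Gp; apply: ub_le_sup; [exact: Ssup.2|exists p].
exists [set q | exists p t, G p /\ q = (p.1 + t%:C%C *: y, p.2 + t * c)]; last first.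
  split; first by move=> p Gp; exists p, 0; rewrite rmorph0 scale0r mul0r !addr0; case: p Gp.
  by exists c, (0, 0), 1; rewrite rmorph1 scale1r mul1r !add0r.
split.
  move=> t _ _ [p [a [Gp ->]]] [q [b [Gq ->]]].
  exists (t%:C%C *: p.1 + q.1, t * p.2 + q.2), (t * a + b); split; first exact: Glin.
  rewrite /= rmorphD rmorphM /= scalerDr scalerDl scalerA addrACA; congr pair; ring.
move=> _ [p [t [Gp ->]]] /=.
have Gs (s : R) : G (s%:C%C *: p.1, s * p.2).
  by have := Glin s _ _ Gp Gzero; rewrite /= !addr0.
(* Dividing by [|t|] reduces to the coefficients [-1] and [1] of [y], which are exactly the two
   families of bounds on [c]. *)
have [t0|t0|->] := ltgtP t 0; last by rewrite rmorph0 scale0r mul0r !addr0 Gdom.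
- have := c_ge _ (Gs (- t^-1)) => /=.
  have -> : (- t^-1)%:C%C *: p.1 - y = (- t^-1)%:C%C *: (p.1 + t%:C%C *: y).
    rewrite scalerDr scalerA -rmorphM mulNr mulVf ?lt_eqF// (rmorphN1 (real_complex R)).
    by rewrite scaleN1r.
  rewrite nrmZ nrmR ger0_norm; last by rewrite oppr_ge0 invr_le0 ltW.
  rewrite -mulrBr mulNr lerNl mulrC ler_ndivlMr// => h; lra.
- have := c_le _ (Gs t^-1) => /=.
  have -> : (t^-1)%:C%C *: p.1 + y = (t^-1)%:C%C *: (p.1 + t%:C%C *: y).
    by rewrite scalerDr scalerA -rmorphM mulVf ?gt_eqF// rmorph1 scale1r.
  rewrite nrmZ nrmR ger0_norm; last by rewrite invr_ge0 ltW.
  by rewrite -mulrBr mulrC ler_pdivlMr// => h; lra.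
Qed.

Lemma real_hahn_banach (v0 : V) : exists u : V -> R,
  [/\ forall (t : R) x y, u (t%:C%C *: x + y) = t * u x + u y,
      forall x, u x <= nrm x & u v0 = nrm v0].
Proof.
pose G0 := [set p : V * R | exists t : R, p = (t%:C%C *: v0, t * nrm v0)].
have G00 : G0 (v0, nrm v0) by exists 1; rewrite rmorph1 scale1r mul1r.
have G0dom : dominated_graph G0.
  split.
    move=> t _ _ [a ->] [b ->]; exists (t * a + b).
    by rewrite /= rmorphD rmorphM scalerDl scalerA mulrDl mulrA.
  move=> _ [a ->] /=; rewrite nrmZ nrmR.
  by rewrite ler_wpM2r ?nrm_ge0 ?ler_norm.
have [F Fchain|G [[Gdom G0G] Gmax]] := @Zorn_bigcup (V * R)%type
    [set G | dominated_graph G /\ (G !=set0 -> G0 `<=` G)].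
  move=> Ftot; split; first split.
  - move=> t p q [X FX Xp] [Y FY Yq].
    have [XY|YX] := Ftot _ _ FX FY.
      by exists Y => //; apply: (Fchain _ FY).1.1 => //; exact: XY.
    by exists X => //; apply: (Fchain _ FX).1.1 => //; exact: YX.
  - by move=> p [X FX Xp]; exact: (Fchain _ FX).1.2.
  - move=> [p [X FX Xp]] q G0q; exists X => //; apply: (Fchain _ FX).2 => //.
    by exists p.
have Gne : G !=set0.
  apply: contrapT => Gn.
  have G_0 : G = set0 by rewrite -subset0 => x Gx; apply: Gn; exists x.
  apply: (Gmax G0); last by split=> // _; exact: subset_refl.
  rewrite G_0; split; first exact: sub0set.
  by move=> /(_ _ G00).
have Gtot x : exists a, G (x, a).
  have [H Hdom [GH [c Hc]]] := dominated_graph_extend x Gdom Gne.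
  exists c; suff -> : G = H by [].
  apply: contrapT => GnH; apply: (Gmax H).
    split=> // HG; apply: GnH; exact/seteqP.
  split=> // _; exact: subset_trans (G0G Gne) GH.
have Gfun x a b : G (x, a) -> G (x, b) -> a = b.
  have aux a' b' : G (x, a') -> G (x, b') -> a' <= b'.
    move=> Ga Gb; have := Gdom.2 _ (Gdom.1 (-1) _ _ Gb Ga).
    by rewrite /= rmorphN1 scaleN1r addNr nrm0 mulN1r; lra.
  by move=> Ga Gb; apply/eqP; rewrite eq_le !aux.
have [u hu] := choice Gtot.
exists u; split.
- move=> t x y; apply: (Gfun (t%:C%C *: x + y)); first exact: hu.
  exact: (Gdom.1 t (x, u x) (y, u y)).
- by move=> x; exact: (Gdom.2 (x, u x)).
- by apply: (Gfun v0) (hu _) (G0G Gne _ G00).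
Qed.

(** Complexification [x |-> u x - i u (i x)] of a real functional [u] of norm at most 1 with
    [u v0 = nrm v0]. The bound 2 is the crude one given by the two terms; it is the constant carried
    by every later functional. The real part of [xi v0] is [nrm v0], hence [xi v0] is not zero. *)
Lemma exists_functional (v0 : V) : v0 != 0 -> exists xi : V -> C,
  [/\ forall a x y, xi (a *: x + y) = a * xi x + xi y,
      forall x, nrm (xi x) <= 2 * nrm x & xi v0 != 0].
Proof.
move=> v00; have [u [ulin udom uv0]] := real_hahn_banach v0.
have u0 : u 0 = 0 by have := ulin (-1) 0 0; rewrite scaler0 addr0; lra.
have uD x y : u (x + y) = u x + u y by have := ulin 1 x y; rewrite rmorph1 scale1r mul1r.
have uZ (t : R) x : u (t%:C%C *: x) = t * u x by have := ulin t x 0; rewrite !addr0 u0 addr0.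
have uN x : u (- x) = - u x by have := uZ (-1) x; rewrite rmorphN1 scaleN1r mulN1r.
have uabs x : `|u x| <= nrm x.
  by rewrite ler_norml udom andbT lerNl -uN -[leRHS]nrmN udom.
pose I : C := 'i%C.
pose xi x : C := (u x)%:C%C - I * (u (I *: x))%:C%C.
exists xi; split.
- move=> a x y; rewrite /xi.
  have key z : u (a *: z) = complex.Re a * u z + complex.Im a * u (I *: z).
    rewrite {1}[a]complexE scalerDl uD uZ; congr (_ + _).
    by rewrite mulrC -scalerA uZ.
  rewrite !uD !scalerDr !uD scalerA [I * a]mulrC -scalerA !key scalerA -expr2 sqr_i scaleN1r uN.
  have I2 : I * I = -1 by rewrite -expr2 sqr_i.
  have aE : a = (complex.Re a)%:C%C + I * (complex.Im a)%:C%C by exact: complexE.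
  move: aE; move: (complex.Re a) (complex.Im a) (u x) (u y) (u (I *: x)) (u (I *: y)).
  move=> ra ia ux uy uix uiy ->.
  rewrite !(rmorphD (real_complex R)) !(rmorphM (real_complex R)) (rmorphN (real_complex R)) /=.
  move: ra%:C%C ia%:C%C ux%:C%C uy%:C%C uix%:C%C uiy%:C%C => {}ra {}ia {}ux {}uy {}uix {}uiy.
  apply/eqP; rewrite -subr_eq0; apply/eqP.
  transitivity (ia * uix * (1 + I * I)); first by ring.
  by rewrite I2; ring.
- move=> x; rewrite /xi (le_trans (nrmB _ _))// nrmM !nrmR.
  have -> : nrm I = 1 by rewrite /nrm normc_def /= expr0n expr1n add0r sqrtr1.
  have := uabs x; have := uabs (I *: x).
  rewrite nrmZ.
  have -> : nrm I = 1 by rewrite /nrm normc_def /= expr0n expr1n add0r sqrtr1.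
  by lra.
- apply/eqP => /(congr1 (@complex.Re R)); rewrite /xi /= uv0.
  by have := nrm_gt0 v00; lra.
Qed.

End hahn_banach.

(** * The circle and the disk *)

Section circle.
Context {R : realType}.
Local Notation C := R[i].

Definition cis (t : R) : C := (cos t +i* sin t)%C.

Lemma cisD s t : cis (s + t) = cis s * cis t.
Proof. by rewrite /cis cosD sinD; congr Complex; rewrite addrC. Qed.

Lemma cis0 : cis 0 = 1.
Proof. by rewrite /cis cos0 sin0. Qed.

Lemma nrm_cis t : nrm (cis t) = 1.
Proof. by rewrite /nrm normc_def /= cos2Dsin2 sqrtr1. Qed.

Lemma cis_neq0 t : cis t != 0.
Proof. by apply/eqP => h; have := nrm_cis t; rewrite h nrm0 => /eqP; rewrite eq_sym oner_eq0. Qed.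

Lemma cisMn n t : cis (n%:R * t) = cis t ^+ n.
Proof.
elim: n => [|n ih]; first by rewrite mul0r cis0 expr0.
by rewrite -natr1 mulrDl mul1r cisD ih exprSr.
Qed.

Lemma cis_2pi : cis (2 * pi) = 1.
Proof. by rewrite /cis mulr_natl cos2pi sin2pi. Qed.

Lemma nrm_cisB1_sqr t : nrm (cis t - 1) ^+ 2 = 2 - 2 * cos t.
Proof.
rewrite /nrm normc_def /= sqr_sqrtr ?addr_ge0 ?sqr_ge0// subr0.
by have := cos2Dsin2 t; nra.
Qed.

Lemma nrm_cisB1 t : nrm (cis t - 1) = 2 * `|sin (t / 2)|.
Proof.
apply/eqP; rewrite -(@eqrXn2 _ 2) ?nrm_ge0 ?mulr_ge0// nrm_cisB1_sqr.
rewrite exprMn real_normK ?num_real// {1}(splitr t) cosD.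
by apply/eqP; have := cos2Dsin2 (t / 2); nra.
Qed.

Lemma sin_le_id (t : R) : 0 <= t -> sin t <= t.
Proof.
move=> t0; have [|c _] := @MVT_segment R sin cos 0 t t0.
  by apply: continuous_subspaceT => x; exact: continuous_sin.
by rewrite sin0 !subr0 => ->; rewrite ler_piMl// cos_le1.
Qed.

Lemma normr_sin_le (t : R) : `|sin t| <= `|t|.
Proof.
have aux (s : R) : 0 <= s -> `|sin s| <= s.
  move=> s0; have [s1|s1] := leP s 1.
    have sin0 : 0 <= sin s.
      by apply: sin_ge0_pi; have := pi_ge2 R => p2; apply/andP; split; lra.
    by rewrite ger0_norm// sin_le_id.
  by apply: le_trans (ltW s1); rewrite ler_norml sin_geN1 sin_le1.
have [t0|t0] := leP 0 t; first by rewrite [leRHS]ger0_norm ?aux.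
by rewrite -normrN -sinN [leRHS]ltr0_norm// aux// oppr_ge0 ltW.
Qed.

Lemma nrm_cisB1_le t : nrm (cis t - 1) <= `|t|.
Proof. by rewrite nrm_cisB1; have := normr_sin_le (t / 2); rewrite normrM [`|2^-1|]ger0_norm//; lra. Qed.

Lemma nrm_cisB s t : nrm (cis s - cis t) <= `|s - t|.
Proof.
have -> : cis s - cis t = cis t * (cis (s - t) - 1).
  by rewrite mulrBr mulr1 -cisD [t + _]addrC subrK.
by rewrite nrmM nrm_cis mul1r nrm_cisB1_le.
Qed.

(** A chord is at least a fixed multiple of its arc, up to half a turn. For the half-angle, [sin] is
    bounded below by the mean value theorem on [[0, pi/4]] and by monotonicity on [[pi/4, pi/2]]. *)
Lemma nrm_cisB1_ge : exists2 c : R, 0 < c & forall t, `|t| <= pi -> c * `|t| <= nrm (cis t - 1).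
Proof.
have p0 := pi_gt0 R.
pose c1 : R := cos (pi / 4); pose s1 : R := sin (pi / 4).
have c1_gt0 : 0 < c1 by apply: cos_gt0_pihalf; apply/andP; split; lra.
have s1_gt0 : 0 < s1 by apply: sin_gt0_pi; apply/andP; split; lra.
have small (t : R) : 0 <= t -> t <= pi / 4 -> c1 * t <= sin t.
  move=> t0 t4; have [|c ct] := @MVT_segment R sin cos 0 t t0.
    by apply: continuous_subspaceT => x; exact: continuous_sin.
  rewrite sin0 !subr0 => ->; rewrite ler_wpM2r//.
  move: ct; rewrite in_itv /= => /andP[c0 ct].
  rewrite leNgt; apply/negP; rewrite ltr_cos ?in_itv /=; first lra.
    by apply/andP; split; lra.
  by apply/andP; split; lra.
have large (t : R) : pi / 4 <= t -> t <= pi / 2 -> s1 <= sin t.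
  move=> t4 t2; rewrite leNgt; apply/negP; rewrite ltr_sin ?in_itv /=; first lra.
    by apply/andP; split; lra.
  by apply/andP; split; lra.
exists (Num.min c1 (s1 * 2 / pi)).
  by rewrite lt_min c1_gt0/= divr_gt0// mulr_gt0.
move=> t tpi; rewrite nrm_cisB1.
have -> : `|sin (t / 2)| = `|sin (`|t| / 2)|.
  have [t0|t0] := leP 0 t; first by rewrite (ger0_norm t0).
  by rewrite (ltr0_norm t0) mulNr sinN normrN.
set u := `|t| in tpi *; have u0 : 0 <= u by exact: normr_ge0.
apply: le_trans (_ : 2 * sin (u / 2) <= _); last by rewrite ler_wpM2l ?ler_norm.
have [u4|u4] := leP (u / 2) (pi / 4).
  have := small (u / 2) _ u4; have : Num.min c1 (s1 * 2 / pi) <= c1 by rewrite ge_min lexx.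
  by move=> h1 h2; have := h2 ltac:(lra); nra.
have := large (u / 2) (ltW u4) ltac:(lra).
have : Num.min c1 (s1 * 2 / pi) <= s1 * 2 / pi by rewrite ge_min lexx orbT.
rewrite ler_pdivlMr//.
move: (Num.min _ _) => m hm hs.
have m0 : 0 < m * u \/ m * u <= 0 by case: (leP (m * u) 0); [right|left].
nra.
Qed.

Lemma cis_surj (z : C) : nrm z = 1 -> exists2 t, - pi <= t <= pi & z = cis t.
Proof.
case: z => x y z1; have xy : x ^+ 2 + y ^+ 2 = 1.
  have : nrm (x +i* y)%C ^+ 2 = 1 by rewrite z1 expr1n.
  by rewrite /nrm normc_def /= sqr_sqrtr// addr_ge0 ?sqr_ge0.
have x1 : -1 <= x <= 1 by apply/andP; split; nra.
have xin : x \in `[-1, 1] by rewrite in_itv.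
have sa : sin (acos x) = `|y|.
  by rewrite sin_acos// -xy addrC addKr sqrtr_sqr.
have p0 := pi_gt0 R; have a0 := acos_ge0 x1; have a1 := acos_lepi x1.
have [y0|y0] := leP 0 y.
  exists (acos x); first by apply/andP; split; lra.
  by rewrite /cis acosK// sa ger0_norm.
exists (- acos x); first by apply/andP; split; lra.
by rewrite /cis cosN sinN acosK// sa ltr0_norm// opprK.
Qed.

Lemma polar (z : C) : exists2 t, - pi <= t <= pi & z = (nrm z)%:C%C * cis t.
Proof.
have [->|z0] := eqVneq z 0.
  exists 0; first by have := pi_gt0 R => h; apply/andP; split; lra.
  by rewrite nrm0 rmorph0 mul0r.
have nz : nrm z != 0 by rewrite gt_eqF// nrm_gt0.
have [|t ht zt] := @cis_surj (z / (nrm z)%:C%C).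
  by rewrite nrmM nrmV nrmR ger0_norm ?nrm_ge0// divff.
exists t => //; rewrite -zt mulrC divfK//.
by apply/eqP => /(congr1 (@complex.Re R)) /= /eqP; exact/negP.
Qed.

Lemma sum_cis N (t : R) : 0 < t -> t < 2 * pi -> cis (N%:R * t) = 1 ->
  \sum_(k < N) cis (k%:R * t) = 0.
Proof.
move=> t0 t2 h; have c1 : cis t - 1 != 0.
  apply/eqP => /(congr1 nrm); rewrite nrm0 nrm_cisB1 => /eqP.
  rewrite mulf_eq0 pnatr_eq0 /= normr_eq0 gt_eqF//.
  by apply: sin_gt0_pi; apply/andP; split; lra.
apply: (mulfI c1); rewrite mulr0.
under eq_bigr do rewrite cisMn.
by rewrite -subrX1 -cisMn h subrr.
Qed.

(** Compactness in gauge form: local data come with a radius chosen at each point of [K], and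
    uniform constants are obtained as minima or maxima over the finite list [s]. *)
Definition finitely_coverable (K : set C) := forall r : C -> R,
  (forall z, K z -> 0 < r z) -> exists s : seq C,
    (forall c, c \in s -> K c) /\ forall z, K z -> exists2 c, c \in s & nrm (z - c) < r c.

(** The annulus is the image under polar coordinates of the compact rectangle [[a, 1] x [-pi, pi]].
    The values [a = 1] and [a = 0] give the circle and the closed disk. *)
Lemma annulus_coverable (a : R) : 0 <= a <= 1 ->
  finitely_coverable [set z | a <= nrm z <= 1].
Proof.
move=> /andP[a0 a1] r r0.
pose g (q : R * R) : C := q.1%:C%C * cis q.2.
have gdist p q : nrm (g p - g q) <= `|p.1 - q.1| + `|q.1| * `|p.2 - q.2|.
  have -> : g p - g q = (p.1 - q.1)%:C%C * cis p.2 + q.1%:C%C * (cis p.2 - cis q.2).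
    by rewrite /g rmorphB /=; ring.
  rewrite (le_trans (nrmD _ _))// !nrmM nrm_cis mulr1 !nrmR lerD2l.
  by rewrite ler_wpM2l// nrm_cisB.
pose P : set (R * R) := `[a, 1] `*` `[- pi, pi].
have cP : compact P by apply: compact_setX; exact: segment_compact.
pose good (s : seq C) := forall c, c \in s -> a <= nrm c <= 1.
(* The filter of all sufficiently large finite lists of centres: near-covering compactness along it
   turns pointwise covering into one list covering the whole rectangle. *)
pose F : set_system (seq C) := [set S | exists2 s0, good s0 &
  forall s, good s -> {subset s0 <= s} -> S s].
have FF : Filter F.
  split; first by exists [::].
    move=> S1 S2 [s1 g1 h1] [s2 g2 h2]; exists (s1 ++ s2).
      by move=> c; rewrite mem_cat => /orP[/g1|/g2].
    by move=> s gs sub; split; [apply: h1|apply: h2] => // c cs; apply: sub; rewrite mem_cat cs ?orbT.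
  by move=> S1 S2 sub [s1 g1 h1]; exists s1 => // s gs ss; apply/sub/h1.
have gP q : P q -> a <= nrm (g q) <= 1.
  move=> [q1 q2]; move: q1; rewrite /= in_itv /= => /andP[aq q1].
  by rewrite /g nrmM nrm_cis mulr1 nrmR ger0_norm ?aq// (le_trans a0).
have cov := (compact_near_coveringP P).1 cP.
have [|s0 g0 /(_ s0 g0) hs] := cov _ F
  (fun s q => good s /\ exists2 c, c \in s & nrm (g q - c) < r c) FF.
  move=> q Pq.
  (* By [gdist], moving both coordinates by less than [e] moves the point by at most
     [e (1 + |q.1|)], which is less than the radius. *)
  pose e := r (g q) / (2 + `|q.1|).
  have q1 : 0 < 2 + `|q.1| by have := normr_ge0 q.1; lra.
  have rq : 0 < r (g q) by apply: r0; exact: gP.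
  have e0 : 0 < e by rewrite divr_gt0.
  exists (ball q e, [set s | good s /\ g q \in s]).
    split; first exact: nbhsx_ballx.
    exists [:: g q]; first by move=> c; rewrite inE => /eqP ->; exact: gP.
    by move=> s gs ss; split=> //; apply: ss; rewrite mem_head.
  move=> [p s] [/= [b1 b2] [gs qs]]; split=> //; exists (g q) => //.
  have := gdist p q; move: b1 b2; rewrite -!ball_normE /= => b1 b2.
  have : e * (2 + `|q.1|) = r (g q) by rewrite divfK// gt_eqF.
  rewrite distrC in b1; rewrite distrC in b2.
  have : `|q.1| * `|p.2 - q.2| <= `|q.1| * e by rewrite ler_wpM2l// ltW.
  by move=> h1 h2 h3; nra.
exists s0; split=> // z /= /andP[az z1]; have [t ht zt] := polar z.
  have [//||_ [c cs fc]] := hs _ (nrm z, t); first by split; rewrite /= in_itv /= ?az.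
  by exists c => //; rewrite zt.
Qed.

Lemma finitely_coverable_circle : finitely_coverable [set z : C | nrm z = 1].
Proof.
have -> : [set z : C | nrm z = 1] = [set z | 1 <= nrm z <= 1].
  apply/seteqP; split=> z /=; first by move=> ->; rewrite lexx.
  by move=> h; apply/eqP; rewrite eq_le andbC.
by apply: annulus_coverable; rewrite ler01 lexx.
Qed.

Lemma finitely_coverable_disk : finitely_coverable [set z : C | nrm z <= 1].
Proof.
have -> : [set z : C | nrm z <= 1] = [set z | 0 <= nrm z <= 1].
  by apply/seteqP; split=> z /=; rewrite nrm_ge0.
by apply: annulus_coverable; rewrite ler01 lexx.
Qed.

End circle.

(** * Functions with a second order expansion *)

Section c11.
Context {R : realType}.
Local Notation C := R[i].

(* Complex differentiability with a locally uniform second order remainder: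
   the only consequence of analyticity which is needed, stable under the
   operations below. *)
Definition c11_at {V : normedModType C} (E : C -> V) (z0 : C) :=
  exists r M : R, [/\ 0 < r, 0 <= M & forall z, nrm (z - z0) < r -> exists2 v, nrm v <= M &
    forall w, nrm (w - z0) < r -> nrm (E w - E z - (w - z) *: v) <= M * nrm (w - z) ^+ 2].

Section vector.
Context {V : normedModType C}.
Implicit Types E G : C -> V.

Lemma c11_at_open E z0 : c11_at E z0 ->
  exists2 r : R, 0 < r & forall z, nrm (z - z0) < r -> c11_at E z.
Proof.
move=> [r [M [r0 M0 h]]]; exists r => // z zr.
exists (r - nrm (z - z0)), M; split=> //; first by rewrite subr_gt0.
have sub y : nrm (y - z) < r - nrm (z - z0) -> nrm (y - z0) < r.
  by have := nrm_tri z y z0; lra.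
by move=> y /sub /h[v vM hv]; exists v => // w /sub; exact: hv.
Qed.

Lemma eq_c11_at E G z0 : (exists2 r : R, 0 < r & forall z, nrm (z - z0) < r -> E z = G z) ->
  c11_at E z0 -> c11_at G z0.
Proof.
move=> [s s0 EG] [r [M [r0 M0 h]]]; exists (Num.min r s), M; split=> //.
  by rewrite lt_min r0.
move=> z; rewrite lt_min => /andP[zr zs]; have [v vM hv] := h _ zr; exists v => // w.
by rewrite lt_min => /andP[wr ws]; rewrite -!EG// hv.
Qed.

(** Once the radius is at most 1, two points of the disc are at distance at most 2; the quadratic
    remainder then costs [2 M] and the derivative [M], whence the Lipschitz constant [3 M]. *)
Lemma c11_lipschitz E z0 : c11_at E z0 -> exists r B : R, [/\ 0 < r, 0 <= B,
  (forall w, nrm (w - z0) < r -> nrm (E w) <= B) &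
  (forall z w, nrm (z - z0) < r -> nrm (w - z0) < r -> nrm (E w - E z) <= B * nrm (w - z))].
Proof.
move=> [r0 [M [r00 M0 h0]]].
pose r := Num.min r0 1; have r_gt0 : 0 < r by rewrite lt_min r00/=.
have rr0 : r <= r0 by rewrite ge_min lexx.
have r1 : r <= 1 by rewrite ge_min lexx orbT.
have lip z w : nrm (z - z0) < r -> nrm (w - z0) < r -> nrm (E w - E z) <= 3 * M * nrm (w - z).
  move=> zr wr; have [v vM /(_ w (lt_le_trans wr rr0)) hv] := h0 _ (lt_le_trans zr rr0).
  have := nrmD (E w - E z - (w - z) *: v) ((w - z) *: v); rewrite subrK nrmZ => h1.
  have : nrm (w - z) <= 2 by have := nrm_tri z0 w z; rewrite (nrm_sub z0 z); lra.
  have := nrm_ge0 (w - z); have := nrm_ge0 v; move: (nrm (w - z)) (nrm v) hv h1 vM => x y hv h1 yM y0 x0 x2.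
  have : M * x ^+ 2 <= M * (2 * x) by rewrite ler_wpM2l// expr2 ler_wpM2r.
  have : x * y <= x * M by rewrite ler_wpM2l.
  lra.
have e0 := nrm_ge0 (E z0).
exists r, (3 * M + nrm (E z0)); split=> //; first by lra.
- move=> w wr; have := lip z0 w; rewrite subrr nrm0 => /(_ r_gt0 wr).
  have := nrm_le_sub (E w) (E z0); have := nrm_ge0 (w - z0); nra.
- move=> z w zr wr; apply: le_trans (lip _ _ zr wr) _.
  by rewrite ler_wpM2r ?nrm_ge0// lerDl.
Qed.

Lemma c11_continuous E z0 : c11_at E z0 -> forall e : R, 0 < e ->
  exists2 r : R, 0 < r & forall w, nrm (w - z0) < r -> nrm (E w - E z0) <= e.
Proof.
move=> /c11_lipschitz[r [B [r0 B0 _ lip]]] e e0.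
have B1 : 0 < B + 1 by lra.
exists (Num.min r (e / (B + 1))); first by rewrite lt_min r0 divr_gt0.
move=> w; rewrite lt_min ltr_pdivlMr// => /andP[wr we].
apply: le_trans (lip _ _ _ wr) _; first by rewrite subrr nrm0.
by have := nrm_ge0 (w - z0); nra.
Qed.

Lemma c11_cst (v : V) z0 : c11_at (fun=> v) z0.
Proof.
exists 1, 0; split=> // z _; exists 0; first by rewrite nrm0.
by move=> w _; rewrite subrr scaler0 subr0 nrm0 mul0r.
Qed.

End vector.

Lemma c11_linear (c : C) z0 : c11_at (fun z : C => z - c : C^o) z0.
Proof.
exists 1, 1; split=> // z _; exists (1 : C^o); first by rewrite [nrm _]nrm1.
move=> w _; rewrite [_ *: _]mulr1 opprB addrA subrK subrr.
by rewrite nrm0 mul1r exprn_ge0 ?nrm_ge0.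
Qed.

Lemma c11_scale {V : normedModType C} (g : C -> C) (E : C -> V) z0 :
  c11_at (g : C -> C^o) z0 -> c11_at E z0 -> c11_at (fun z => g z *: E z) z0.
Proof.
move=> cg cE; have [r1 [B [r10 B0 gB glip]]] := c11_lipschitz cg.
have [r2 [D [r20 D0 ED Elip]]] := c11_lipschitz cE.
move: cg cE => [r3 [M [r30 M0 hg]]] [r4 [N [r40 N0 hE]]].
exists (Num.min (Num.min r1 r2) (Num.min r3 r4)), (M * D + B * N + M * D + B * N).
split; first by rewrite !lt_min r10 r20 r30 r40.
  by rewrite !addr_ge0// mulr_ge0.
move=> z; rewrite !lt_min => /andP[/andP[z1 z2] /andP[z3 z4]].
have [g' g'M hg'] := hg _ z3; have [v vN hv] := hE _ z4.
have MD := mulr_ge0 M0 D0; have BN := mulr_ge0 B0 N0.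
exists ((g' : C) *: E z + g z *: v).
  rewrite (le_trans (nrmD _ _))// !nrmZ.
  have : nrm g' * nrm (E z) <= M * D by rewrite ler_pM ?nrm_ge0// ED.
  have : nrm (g z) * nrm v <= B * N by rewrite ler_pM ?nrm_ge0// gB.
  by rewrite -[nrm (g' : C)]/(nrm g'); lra.
move=> w; rewrite !lt_min => /andP[/andP[w1 w2] /andP[w3 w4]].
(* Leibniz rule with remainders: the remainder of [g], the derivative of [g] against an increment of
   [E], and the remainder of [E]. Each is quadratic in [w - z]. *)
have -> : g w *: E w - g z *: E z - (w - z) *: ((g' : C) *: E z + g z *: v) =
  (g w - g z - (w - z) * g') *: E w + ((w - z) * g') *: (E w - E z)
  + g z *: (E w - E z - (w - z) *: v).
  have alg (p q s c d e : V) : p - c - (d + e) = (p - q - s) + (s - d) + (q - c - e).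
    by rewrite [_ + (s - d)]addrA subrK (addrAC p (- q)) !addrA subrK opprD addrA (addrAC p (- d)).
  move: (w - z) => x; rewrite !scalerBl !scalerBr !scalerDr !scalerA.
  by rewrite [g z * x]mulrC; exact: alg.
have x0 := nrm_ge0 (w - z).
have h1 := hg' _ w3; have h2 := hv _ w4; have h3 := Elip _ _ z2 w2.
rewrite (le_trans (nrmD _ _))// (le_trans (lerD (nrmD _ _) (lexx _)))// !nrmZ nrmM.
have t1 : nrm (g w - g z - (w - z) * g') * nrm (E w) <= (M * nrm (w - z) ^+ 2) * D.
  by rewrite ler_pM ?nrm_ge0// ED.
have t2 : nrm (w - z) * nrm (g' : C) * nrm (E w - E z) <= nrm (w - z) * M * (D * nrm (w - z)).
  by rewrite ler_pM ?mulr_ge0 ?nrm_ge0// ler_wpM2l.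
have t3 : nrm (g z) * nrm (E w - E z - (w - z) *: v) <= B * (N * nrm (w - z) ^+ 2).
  by rewrite ler_pM ?nrm_ge0// gB.
have := mulr_ge0 BN (sqr_ge0 (nrm (w - z))).
by rewrite !expr2 in t1 t3 *; lra.
Qed.

End c11.

Section c11_more.
Context {R : realType}.
Local Notation C := R[i].

Lemma c11_inv (g : C -> C) z0 : c11_at (g : C -> C^o) z0 -> g z0 != 0 ->
  c11_at ((fun z => (g z)^-1) : C -> C^o) z0.
Proof.
move=> cg g0; have n0 := nrm_gt0 g0.
have [r1 [B [r10 B0 gB glip]]] := c11_lipschitz cg.
have [r2 r20 gc] := c11_continuous cg (divr_gt0 n0 (ltr0n _ 2)).
move: cg => [r3 [M [r30 M0 hg]]].
set n := nrm (g z0) in n0 gc.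
have lb z : nrm (z - z0) < r2 -> n / 2 <= nrm (g z).
  move=> /gc; have := nrm_le_sub (g z0) (g z); rewrite -[nrm (g z0)]/n nrm_sub.
  by rewrite -[nrm (g z - g z0)]/(nrm ((g z : C^o) - g z0)); lra.
have nz z : nrm (z - z0) < r2 -> g z != 0.
  by move=> /lb h; apply/eqP => gz; move: h; rewrite gz nrm0; lra.
pose D := 2 / n; have D0 : 0 <= D by rewrite divr_ge0// ltW.
have inv_le z : nrm (z - z0) < r2 -> nrm ((g z)^-1) <= D.
  move=> zr; rewrite nrmV /D -[2 / n]invf_div lef_pV2 ?posrE ?lb ?divr_gt0//.
  by rewrite nrm_gt0// nz.
have DD0 := mulr_ge0 D0 D0; have DDD0 := mulr_ge0 D0 DD0.
have MB0 := mulr_ge0 M0 B0; have BM0 := mulr_ge0 B0 M0.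
pose L := M * (D * D) + (D * (D * D)) * (B * M + M * B).
have L0 : 0 <= L by apply: addr_ge0; apply: mulr_ge0 => //; exact: addr_ge0.
exists (Num.min (Num.min r1 r2) r3), L.
split=> //; first by rewrite !lt_min r10 r20 r30.
move=> z; rewrite !lt_min => /andP[/andP[z1 z2] z3].
have [v vM hv] := hg _ z3; have iz := inv_le _ z2.
have izz : nrm (g z)^-1 * nrm (g z)^-1 <= D * D by rewrite ler_pM ?nrm_ge0.
have iz0 : 0 <= nrm (g z)^-1 * nrm (g z)^-1 by rewrite mulr_ge0 ?nrm_ge0.
exists (- ((v : C) * ((g z)^-1 * (g z)^-1)) : C^o).
  rewrite nrmN [nrm _]nrmM nrmM.
  have : nrm (v : C) * (nrm (g z)^-1 * nrm (g z)^-1) <= M * (D * D).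
    by rewrite ler_pM ?nrm_ge0.
  have : 0 <= D * (D * D) * (B * M + M * B) by apply: mulr_ge0 => //; exact: addr_ge0.
  by rewrite /L; lra.
move=> w; rewrite !lt_min => /andP[/andP[w1 w2] w3].
have iw := inv_le _ w2.
have h1 := hv _ w3; have h2 := glip _ _ z1 w1; have h3 := gB _ z1.
pose e : C := g w - g z - (w - z) * v.
(* With [e] the remainder of [g], the remainder of [1 / g] is a bounded factor times a sum of two
   terms: one contains [e], the other is a product of two increments. *)
have -> : (g w)^-1 - (g z)^-1 - (w - z) *: (- ((v : C) * ((g z)^-1 * (g z)^-1)) : C^o) =
  ((g w)^-1 * ((g z)^-1 * (g z)^-1)) * (- (g z * e) + (w - z) * v * (g w - g z)).
  rewrite /e -[_ *: _]/((w - z) * (- ((v : C) * ((g z)^-1 * (g z)^-1)))).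
  have := nz _ w2; have := nz _ z2; move: (g w) (g z) (v : C) (w - z) => a b v' x b0 a0.
  by field; rewrite a0 b0.
rewrite [nrm _]nrmM !nrmM.
have x0 := nrm_ge0 (w - z).
have t1 : nrm (g w)^-1 * (nrm (g z)^-1 * nrm (g z)^-1) <= D * (D * D).
  by rewrite ler_pM ?nrm_ge0.
have t2 : nrm (- (g z * e) + (w - z) * v * (g w - g z)) <=
    (B * M + M * B) * nrm (w - z) ^+ 2.
  rewrite (le_trans (nrmD _ _))// nrmN !nrmM.
  have s1 : nrm (g z) * nrm e <= B * (M * nrm (w - z) ^+ 2).
    by rewrite ler_pM ?nrm_ge0.
  have s2 : nrm (w - z) * nrm (v : C) * nrm (g w - g z) <= nrm (w - z) * M * (B * nrm (w - z)).
    by rewrite ler_pM ?mulr_ge0 ?nrm_ge0// ler_wpM2l.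
  by rewrite expr2 in s1 *; lra.
have : nrm (g w)^-1 * (nrm (g z)^-1 * nrm (g z)^-1) * nrm (- (g z * e) + (w - z) * v * (g w - g z)) <=
    (D * (D * D)) * ((B * M + M * B) * nrm (w - z) ^+ 2).
  by rewrite ler_pM ?mulr_ge0 ?nrm_ge0.
have : 0 <= M * (D * D) * nrm (w - z) ^+ 2 by apply: mulr_ge0; [apply: mulr_ge0|apply: sqr_ge0].
by move=> h4 h5; rewrite /L [leRHS]mulrDl -[X in _ <= _ + X]mulrA; lra.
Qed.

Lemma c11_horner (p : {poly C}) z0 : c11_at ((fun z => p.[z]) : C -> C^o) z0.
Proof.
elim/poly_ind: p => [|p c ih].
  by apply: eq_c11_at (c11_cst (0 : C^o) z0); exists 1 => // z _; rewrite horner0.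
have [r [M [r0 M0 h]]] := c11_scale ih (c11_linear 0 z0).
exists r, M; split=> // z /h[v vM hv]; exists v => // w /hv.
by rewrite !hornerMXaddC /= !subr0 opprD addrACA subrr addr0.
Qed.

Lemma c11_functional {V : normedModType C} (xi : V -> C) (E : C -> V) z0 :
  (forall a x y, xi (a *: x + y) = a * xi x + xi y) ->
  (forall x, nrm (xi x) <= 2 * nrm x) -> c11_at E z0 ->
  c11_at ((fun z => xi (E z)) : C -> C^o) z0.
Proof.
move=> xlin xb [r [M [r0 M0 h]]]; exists r, (2 * M); split=> //; first by lra.
move=> z /h[v vM hv]; exists (xi v : C^o); first by rewrite (le_trans (xb v))// ler_wpM2l.
move=> w /hv hw.
have -> : (xi (E w) : C^o) - xi (E z) - (w - z) *: (xi v : C^o) = xi (E w - E z - (w - z) *: v).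
  rewrite -[_ *: (_ : C^o)]/((w - z) * xi v).
  have -> : E w - E z - (w - z) *: v = (- (w - z)) *: v + ((-1) *: E z + E w).
    by rewrite scaleNr scaleN1r addrC [- _ + E w]addrC.
  by rewrite !xlin; ring.
by rewrite (le_trans (xb _))// -mulrA ler_wpM2l.
Qed.

Lemma c11_uniform {V : normedModType C} (E : C -> V) (K : set C) :
  finitely_coverable K -> (forall z, K z -> c11_at E z) ->
  exists r M : R, [/\ 0 < r, 0 <= M & forall z, K z -> exists2 v, nrm v <= M &
    forall w, nrm (w - z) < r -> nrm (E w - E z - (w - z) *: v) <= M * nrm (w - z) ^+ 2].
Proof.
move=> Kc KE.
have /choice[f hf] : forall z, exists q : R * R, K z -> [/\ 0 < q.1, 0 <= q.2 &
    forall y, nrm (y - z) < q.1 -> exists2 v, nrm v <= q.2 &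
    forall w, nrm (w - z) < q.1 -> nrm (E w - E y - (w - y) *: v) <= q.2 * nrm (w - y) ^+ 2].
  move=> z; have [Kz|nK] := pselect (K z); last by exists (0, 0).
  by have [r [M h]] := KE _ Kz; exists (r, M).
(* Radii are halved so that a point of [K] close to a centre [c] has a whole disc of uniform radius
   inside the disc where the expansion attached to [c] is valid. *)
have [z Kz|s [sK scov]] := Kc (fun z => (f z).1 / 2).
  by have [f0 _ _] := hf _ Kz; rewrite divr_gt0.
have [r [M [r0 M0 hr]]] : exists r M : R, [/\ 0 < r, 0 <= M &
    forall c, c \in s -> r <= (f c).1 / 2 /\ (f c).2 <= M].
  elim: s sK {scov} => [|c s ih] sK; first by exists 1, 0.
  have [|r [M [r0 M0 h]]] := ih; first by move=> x xs; apply: sK; rewrite inE xs orbT.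
  have [f1 f2 _] := hf c (sK c (mem_head _ _)).
  exists (Num.min r ((f c).1 / 2)), (M + (f c).2); split.
  - by rewrite lt_min r0 divr_gt0.
  - exact: addr_ge0.
  - move=> x; rewrite inE => /orP[/eqP ->|/h[h1 h2]].
      by rewrite ge_min lexx orbT; split=> //; rewrite lerDr.
    by rewrite ge_min h1; split=> //; apply: le_trans h2 _; rewrite lerDl.
exists r, M; split=> // z Kz; have [c cs zc] := scov _ Kz.
have [h1 h2] := hr _ cs; have [f1 f2 h] := hf c (sK _ cs).
have [|v vM hv] := h z; first by lra.
exists v; first exact: le_trans vM h2.
move=> w wz; have wc := nrm_tri z w c.
apply: le_trans (hv w _) _; first by lra.
by rewrite ler_wpM2r ?sqr_ge0.
Qed.

End c11_more.

(** * Power series and their second order expansions *)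

Section power_series.
Context {R : realType} {V : completeNormedModType R[i]}.
Local Notation C := R[i].

Definition psum (a : nat -> V) (x : C) (n : nat) : V := \sum_(i < n) x ^+ i *: a i.

Lemma psumS a x n : psum a x n.+1 = psum a x n + x ^+ n *: a n.
Proof. by rewrite /psum big_ord_recr. Qed.

Lemma analytic_psum (E : C -> V) z : analytic_at E z ->
  exists (a : nat -> V) (r : R), 0 < r /\
    forall w, nrm (w - z) < r -> to_lim (psum a (w - z)) (E w).
Proof.
move=> [a [r [/gt0_complex[r0 rE] h]]]; exists a, (complex.Re r); split=> // w wr.
have /h/to_lim_cvg : `|w - z| < r by rewrite rE normr_lt.
by apply: eq_to_lim => n; rewrite /psum /series /= big_mkord.
Qed.

Lemma geometric_series (t : nat -> V) (K : R) :
  (forall n, nrm (t n) <= K / 2 ^+ n) ->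
  exists2 l, to_lim (fun n => \sum_(i < n) t i) l & nrm l <= 2 * K.
Proof.
move=> ht; have K0 : 0 <= K by have := ht 0; rewrite expr0 divr1; have := nrm_ge0 (t 0); lra.
have p2 n : (0 : R) < 2 ^+ n by rewrite exprn_gt0.
(* Subtracting [2 K / 2^(n+m)] makes the bound telescope, so that the induction on [m] closes. *)
have tail n m : nrm (\sum_(i < n + m) t i - \sum_(i < n) t i) <= 2 * K / 2 ^+ n - 2 * K / 2 ^+ (n + m).
  elim: m => [|m ih]; first by rewrite addn0 !subrr nrm0.
  rewrite addnS big_ord_recr /= addrAC (le_trans (nrmD _ _))//.
  have := ht (n + m); rewrite exprS invfM.
  have -> : 2 * K * (2^-1 * (2 ^+ (n + m))^-1) = K / 2 ^+ (n + m) by rewrite mulrACA divff ?mul1r.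
  have e : 2 * K / 2 ^+ (n + m) = K / 2 ^+ (n + m) + K / 2 ^+ (n + m).
    by rewrite -mulrA mulr_natl mulr2n.
  by rewrite e in ih; lra.
have tail' n m : nrm (\sum_(i < n + m) t i - \sum_(i < n) t i) <= 2 * K / 2 ^+ n.
  apply: le_trans (tail n m) _; rewrite gerBl; apply: divr_ge0; [lra|exact: ltW].
have [l hl] : exists l, to_lim (fun n => \sum_(i < n) t i) l.
  apply: to_lim_complete => e e0.
  have [N hN] := cst_div_nat_small (2 * K) (divr_gt0 e0 (ltr0n R 2)).
  have le2 : 2 * K / 2 ^+ N.+1 <= e / 2.
    apply: le_trans (hN N (leqnn _)); apply: ler_wpM2l; first by lra.
    rewrite lef_pV2 ?posrE ?ltr0Sn// -natrX ler_nat; exact: ltnW (ltn_expl _ _).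
  have near n : (N.+1 <= n)%N -> nrm (\sum_(i < n) t i - \sum_(i < N.+1) t i) <= e / 2.
    by move=> Nn; rewrite -(subnKC Nn); apply: le_trans (tail' _ _) le2.
  exists N.+1 => n m /near hn /near hm.
  have := nrm_tri (\sum_(i < N.+1) t i) (\sum_(i < n) t i) (\sum_(i < m) t i).
  by rewrite (nrm_sub (\sum_(i < N.+1) t i)); lra.
exists l => //; apply: to_lim_nrm_le hl _ => M; exists M => //.
by have := tail' 0 M; rewrite big_ord0 subr0 add0n expr0 divr1.
Qed.

Lemma psum_coef_bound (a : nat -> V) (r : R) l : 0 <= r ->
  to_lim (psum a r%:C%C) l -> exists2 M : R, 0 <= M & forall n, r ^+ n * nrm (a n) <= M.
Proof.
move=> r0 /to_lim_bounded[M M0 h]; exists (2 * M); first by lra.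
move=> n; have e : r%:C%C ^+ n *: a n = psum a r%:C%C n.+1 - psum a r%:C%C n.
  by rewrite psumS addrC addKr.
have : nrm (r%:C%C ^+ n *: a n) <= 2 * M.
  by rewrite e (le_trans (nrmB _ _))//; have := h n; have := h n.+1; lra.
by rewrite nrmZ nrmX nrmR ger0_norm.
Qed.

End power_series.

Section local_structure.
Context {R : realType} {V : completeNormedModType R[i]}.
Local Notation C := R[i].
Implicit Types (a : nat -> V) (E G : C -> V).

Lemma natr_le_exp2 n : n%:R <= 2 ^+ n :> R.
Proof. by rewrite -natrX ler_nat ltnW// ltn_expl. Qed.

Lemma coef_bound_div (x r M : R) n : 0 < r -> r ^+ n * x <= M -> x <= M / r ^+ n.
Proof. by move=> r0; rewrite ler_pdivlMr ?exprn_gt0// mulrC. Qed.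

(** Second order Taylor bound of order [n^2 s^(n-2)]; the exponent is written as a quotient by
    [s ^+ 2] to cover [n < 2]. The remainder of order [n + 1] is [x] times that of order [n], plus
    [n y^(n-1) (x - y)^2]. *)
Lemma expr_taylor2 (x y : C) (s : R) n : 0 < s -> nrm x <= s -> nrm y <= s ->
  nrm (x ^+ n - y ^+ n - n%:R * y ^+ n.-1 * (x - y)) <= n%:R ^+ 2 * s ^+ n / s ^+ 2 * nrm (x - y) ^+ 2.
Proof.
move=> s0 xs ys; have d0 := nrm_ge0 (x - y).
elim: n => [|n ih]; first by rewrite !expr0 subrr !mul0r subrr nrm0 expr0n/= !mul0r.
have -> : x ^+ n.+1 - y ^+ n.+1 - n.+1%:R * y ^+ n.+1.-1 * (x - y) =
    x * (x ^+ n - y ^+ n - n%:R * y ^+ n.-1 * (x - y)) + n%:R * y ^+ n.-1 * (x - y) ^+ 2.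
  case: n {ih} => [|n]; first by rewrite /= !expr0 !expr1; ring.
  by rewrite -!natr1 /= !exprS; ring.
rewrite (le_trans (nrmD _ _))// !nrmM !nrmX nrm_nat.
have h1 : nrm x * nrm (x ^+ n - y ^+ n - n%:R * y ^+ n.-1 * (x - y)) <=
    s * (n%:R ^+ 2 * s ^+ n / s ^+ 2 * nrm (x - y) ^+ 2).
  by rewrite ler_pM ?nrm_ge0.
have h2 : n%:R * nrm y ^+ n.-1 * nrm (x - y) ^+ 2 <= n%:R * (s ^+ n.+1 / s ^+ 2) * nrm (x - y) ^+ 2.
  case: n {ih h1} => [|n]; first by rewrite !mul0r.
  rewrite ler_wpM2r ?sqr_ge0// ler_wpM2l//= -[n.+2]addn2 exprD mulfK ?expf_neq0 ?gt_eqF//.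
  by apply: lerXn2r; rewrite ?nnegrE ?nrm_ge0// ltW.
apply: le_trans (lerD h1 h2) _.
have s2 : 0 <= (s ^+ 2)^-1 by rewrite invr_ge0 sqr_ge0.
have d2 := sqr_ge0 (nrm (x - y)).
have -> : s * (n%:R ^+ 2 * s ^+ n / s ^+ 2 * nrm (x - y) ^+ 2) +
    n%:R * (s ^+ n.+1 / s ^+ 2) * nrm (x - y) ^+ 2 =
    (n%:R ^+ 2 + n%:R) * s ^+ n.+1 / s ^+ 2 * nrm (x - y) ^+ 2.
  by rewrite [s ^+ n.+1]exprS; ring.
have sn : 0 <= s ^+ n.+1 by apply/exprn_ge0/ltW.
rewrite ler_wpM2r// ler_wpM2r// ler_wpM2r// -natr1.
have : 0 <= n%:R :> R by [].
by nra.
Qed.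

(** Termwise expansion on the disc of radius [s = r / 8]. The coefficient bound provides
    [8^-n = 2^-n 4^-n]: the factor [4^-n] absorbs the [n^2] of the Taylor bound and [2^-n] is left
    for summation. *)
Lemma psum_c11 a G (z0 : C) (r M : R) : 0 < r -> (forall n, r ^+ n * nrm (a n) <= M) ->
  (forall w, nrm (w - z0) < r / 8 -> to_lim (psum a (w - z0)) (G w)) -> c11_at G z0.
Proof.
move=> r0 aM hG; set s := r / 8 in hG; have s0 : 0 < s by rewrite divr_gt0.
have M0 : 0 <= M by have := aM 0; rewrite expr0 mul1r; have := nrm_ge0 (a 0); lra.
have rs : r = 8 * s by rewrite /s; lra.
have an n : nrm (a n) <= M / (8 ^+ n * s ^+ n).
  by rewrite -exprMn -rs; exact: coef_bound_div.
have sn n : 0 < s ^+ n by rewrite exprn_gt0.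
have e2 n : (0 : R) < 2 ^+ n by rewrite exprn_gt0.
have e8 n : (8 : R) ^+ n = 2 ^+ n * 2 ^+ n * 2 ^+ n by rewrite -!exprMn; congr (_ ^+ _); ring.
exists s, (2 * (M / s) + 2 * (M / s ^+ 2)); split=> //.
  by rewrite addr_ge0// mulr_ge0// divr_ge0// ltW.
move=> z zs; set y := z - z0 in zs *.
have [n|v hv vM] := @geometric_series _ _ (fun n => (n%:R * y ^+ n.-1) *: a n) (M / s).
  rewrite nrmZ nrmM nrm_nat nrmX.
  have h1 : n%:R * nrm y ^+ n.-1 <= 2 ^+ n * (s ^+ n / s).
    case: n => [|n].
      by rewrite mul0r mulr_ge0// divr_ge0 ?expr0// ltW.
    rewrite [s ^+ n.+1]exprSr mulfK ?gt_eqF//.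
    rewrite ler_pM ?exprn_ge0 ?nrm_ge0 ?natr_le_exp2//.
    by apply: lerXn2r; rewrite ?nnegrE ?nrm_ge0// ltW.
  have : n%:R * nrm y ^+ n.-1 * nrm (a n) <= 2 ^+ n * (s ^+ n / s) * (M / (8 ^+ n * s ^+ n)).
    by rewrite ler_pM ?mulr_ge0 ?exprn_ge0 ?nrm_ge0.
  move=> h; apply: le_trans h _.
  have -> : 2 ^+ n * (s ^+ n / s) * (M / (8 ^+ n * s ^+ n)) = M / s / 2 ^+ n / 2 ^+ n.
    by rewrite e8; field; rewrite !gt_eqF// ?e2 ?sn.
  have q0 : 0 <= M / s / 2 ^+ n by rewrite divr_ge0 ?exprn_ge0// divr_ge0// ltW.
  by rewrite ler_pdivrMr// ler_peMr// exprn_ege1// ler1n.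
have MS : 0 <= M / s ^+ 2 by rewrite divr_ge0// sqr_ge0.
exists v; first by lra.
move=> w ws; set x := w - z0 in ws.
have wz : w - z = x - y by rewrite /x /y opprB addrA subrK.
have [n|l hl lM] := @geometric_series _ _
    (fun n => (x ^+ n - y ^+ n - n%:R * y ^+ n.-1 * (x - y)) *: a n)
    (M / s ^+ 2 * nrm (x - y) ^+ 2).
  rewrite nrmZ; have h1 := @expr_taylor2 x y s n s0 (ltW ws) (ltW zs).
  have : nrm (x ^+ n - y ^+ n - n%:R * y ^+ n.-1 * (x - y)) * nrm (a n) <=
      (n%:R ^+ 2 * s ^+ n / s ^+ 2 * nrm (x - y) ^+ 2) * (M / (8 ^+ n * s ^+ n)).
    by rewrite ler_pM ?nrm_ge0.
  move=> h; apply: le_trans h _.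
  have -> : n%:R ^+ 2 * s ^+ n / s ^+ 2 * nrm (x - y) ^+ 2 * (M / (8 ^+ n * s ^+ n)) =
     (n%:R ^+ 2 / (2 ^+ n * 2 ^+ n)) * (M / s ^+ 2 * nrm (x - y) ^+ 2 / 2 ^+ n).
    by rewrite e8; field; rewrite !gt_eqF// ?e2 ?sn.
  rewrite ler_piMl//; first by apply: divr_ge0; [exact: mulr_ge0 MS (sqr_ge0 _)|exact: ltW].
  by rewrite ler_pdivrMr ?mulr_gt0// mul1r expr2 ler_pM ?natr_le_exp2.
have -> : G w - G z - (w - z) *: v = l.
  apply: to_lim_uniq hl; rewrite wz.
  apply: eq_to_lim (to_limB (to_limB (hG w ws) (hG z zs)) (to_limZ (x - y) hv)) => n.
  rewrite /psum -/x -/y scaler_sumr -!sumrB; apply: eq_bigr => i _.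
  by rewrite scalerA -!scalerBl [(x - y) * _]mulrC.
have Ms : 0 <= M / s by rewrite divr_ge0// ltW.
rewrite wz; apply: le_trans lM _; rewrite mulrA; apply: ler_wpM2r; first exact: sqr_ge0.
by lra.
Qed.

(** The factor [G] is the power series with the first [m] coefficients shifted out. Taken at the
    order of vanishing, it removes the zero of [E] at [z]. *)
Lemma psum_taylor a E (z : C) (r : R) : 0 < r ->
  (forall w, nrm (w - z) < r -> to_lim (psum a (w - z)) (E w)) -> forall m,
  exists G (s : R), [/\ 0 < s, c11_at G z, G z = a m &
   forall w, nrm (w - z) < s -> E w = psum a (w - z) m + (w - z) ^+ m *: G w].
Proof.
move=> r0 hE m; have r2 : 0 < r / 2 by rewrite divr_gt0.
have [M M0 aM] : exists2 M : R, 0 <= M & forall n, (r / 2) ^+ n * nrm (a n) <= M.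
  apply: (@psum_coef_bound _ _ a _ (E (z + (r / 2)%:C%C)) (ltW r2)).
  have := hE (z + (r / 2)%:C%C); rewrite [z + _ - z]addrC addKr; apply.
  by rewrite nrmR gtr0_norm//; lra.
set q := r / 2 in r2 aM; pose b n := a (n + m)%N.
have bM n : q ^+ n * nrm (b n) <= M / q ^+ m.
  by rewrite ler_pdivlMr ?exprn_gt0// mulrAC -exprD.
have ex w : exists l, nrm (w - z) <= q / 2 -> to_lim (psum b (w - z)) l.
  have [wq|_] := leP (nrm (w - z)) (q / 2); last by exists 0.
  have [n|l hl _] := @geometric_series _ _ (fun n => (w - z) ^+ n *: b n) (M / q ^+ m); last by exists l.
  rewrite nrmZ nrmX.
  have : nrm (w - z) ^+ n * nrm (b n) <= (q / 2) ^+ n * nrm (b n).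
    by rewrite ler_wpM2r ?nrm_ge0// lerXn2r ?nnegrE ?nrm_ge0// divr_ge0// ltW.
  move=> h; apply: le_trans h _.
  by rewrite expr_div_n mulrAC ler_wpM2r// invr_ge0 exprn_ge0.
have [G hG] := choice ex.
have q20 : 0 < q / 2 by rewrite divr_gt0.
exists G, (q / 2); split=> //.
- apply: (psum_c11 r2 bM) => w wq; apply: hG; lra.
- apply: (@to_lim_uniq _ _ (psum b 0)); first by have := hG z; rewrite subrr nrm0; apply; exact: ltW.
  apply: (@to_lim_near _ _ (fun=> a m) _ _ 1) (to_lim_cst _) => -[//|n] _.
  rewrite /psum big_ord_recl expr0 scale1r big1 ?addr0// => i _.
  by rewrite expr0n scale0r.
- move=> w wq; apply: (@to_lim_uniq _ _ (fun n => psum a (w - z) (m + n))).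
    apply: (to_lim_subseq (s := fun n => (m + n)%N)) (hE w _); first by move=> n; exact: leq_addl.
    by move: wq; rewrite /q; lra.
  apply: eq_to_lim (to_limD (to_lim_cst (psum a (w - z) m)) (to_limZ ((w - z) ^+ m) (hG w (ltW wq)))).
  move=> n; rewrite /psum big_split_ord /=; congr (_ + _); rewrite scaler_sumr.
  by apply: eq_bigr => i _; rewrite scalerA -exprD /b addnC.
Qed.

End local_structure.

(** * Zeros of analytic functions *)

Section identity_theorem.
Context {R : realType} {V : completeNormedModType R[i]} {W : normedModType R[i]}.
Local Notation C := R[i].
Variable L : V -> W.
Hypothesis Llin : forall a x y, L (a *: x + y) = a *: L x + L y.
Hypothesis Lbound : forall x, nrm (L x) <= 2 * nrm x.

Let L0 : L 0 = 0.
Proof. by have := Llin (-1) 0 0; rewrite scaler0 addr0 scaleN1r addNr. Qed.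

Let LZ a x : L (a *: x) = a *: L x.
Proof. by have := Llin a x 0; rewrite L0 !addr0. Qed.

Let LD x y : L (x + y) = L x + L y.
Proof. by have := Llin 1 x y; rewrite !scale1r. Qed.

Lemma to_lim_linear (u : nat -> V) l : to_lim u l -> to_lim (L \o u) (L l).
Proof.
move=> h e e0; have [N hN] := h _ (divr_gt0 e0 (ltr0n R 2)); exists N => n /hN hn /=.
have -> : L (u n) - L l = L (u n - l) by rewrite -scaleN1r -LZ -LD scaleN1r.
by have := Lbound (u n - l); lra.
Qed.

Let L_psum a (x : C) n : (forall i, (i < n)%N -> L (a i) = 0) -> L (psum a x n) = 0.
Proof.
elim: n => [|n ih] h; first by rewrite /psum big_ord0.
rewrite psumS LD LZ h// scaler0 addr0 ih// => i ni; apply: h; exact: ltnW.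
Qed.

Section at_a_point.
Variables (a : nat -> V) (E : C -> V) (z : C) (r : R).
Hypothesis r0 : 0 < r.
Hypothesis hE : forall w, nrm (w - z) < r -> to_lim (psum a (w - z)) (E w).

(** [L] will be either the identity, to measure the order of [E], or a functional [xi], to measure
    that of [xi o E]; the bound 2 covers both. *)
Lemma order_factor m : (forall i, (i < m)%N -> L (a i) = 0) -> exists G (s : R),
  [/\ 0 < s, c11_at G z, G z = a m &
   forall w, nrm (w - z) < s -> L (E w) = (w - z) ^+ m *: L (G w)].
Proof.
move=> am; have [G [s [s0 cG Gz h]]] := psum_taylor r0 hE m.
exists G, s; split=> // w /h ->.
by rewrite LD LZ L_psum// add0r.
Qed.

(** Isolation of zeros. If [m] is the first index with [L (a m)] non-zero, then [L (E w)] is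
    [(w - z)^m L (G w)], and [L (G w)] stays within [nrm (L (a m)) / 2] of [L (a m)]: this is where
    the quarter comes from, since [L] may double norms. *)
Lemma order_dichotomy :
  (forall n, L (a n) = 0) /\ (exists2 s : R, 0 < s & forall w, nrm (w - z) < s -> L (E w) = 0) \/
  (exists2 m, forall i, (i < m)%N -> L (a i) = 0 & L (a m) != 0) /\
  (exists2 s : R, 0 < s & forall w, 0 < nrm (w - z) -> nrm (w - z) < s -> L (E w) != 0).
Proof.
have [a0|] := pselect (forall n, L (a n) = 0); [left|move=> /existsNP[n0 n0P]; right].
  split=> //; exists r => // w /hE /to_lim_linear h; apply: to_lim_uniq h _.
  by apply: eq_to_lim (to_lim_cst _) => n /=; rewrite L_psum.
have [m ma mmin] := @ex_minnP (fun n => L (a n) != 0) (ex_intro _ n0 (introN eqP n0P)).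
have am i : (i < m)%N -> L (a i) = 0.
  move=> im; apply/eqP; apply: contraT => /mmin; by rewrite leqNgt im.
split; first by exists m.
have [G [s [s0 cG Gz h]]] := order_factor am.
have nL := nrm_gt0 ma.
have [|t t0 ht] := c11_continuous cG (e := nrm (L (a m)) / 4); first by rewrite divr_gt0.
exists (Num.min s t); first by rewrite lt_min s0.
move=> w w0; rewrite lt_min => /andP[/h -> /ht wt].
rewrite scaler_eq0 negb_or expf_neq0 /=; last first.
  by apply/eqP => w1; move: w0; rewrite w1 nrm0 ltxx.
apply/eqP => LG; have := Lbound (G w - a m).
have -> : L (G w - a m) = - L (a m) by rewrite addrC -scaleN1r Llin LG scaleN1r addr0.
by rewrite nrmN; move: wt; rewrite Gz; lra.
Qed.

End at_a_point.
End identity_theorem.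

Section identity_path.
Context {R : realType} {W : normedModType R[i]}.
Local Notation C := R[i].

Lemma not_vanishing_isolated (F : C -> W) z :
  (exists2 s : R, 0 < s & forall w, nrm (w - z) < s -> F w = 0) ->
  (exists2 s : R, 0 < s & forall w, 0 < nrm (w - z) -> nrm (w - z) < s -> F w != 0) -> False.
Proof.
move=> [s s0 hs] [r r0 hr].
pose q := Num.min s r / 2; have q0 : 0 < q by rewrite divr_gt0// lt_min s0.
have qs : q < s by have : Num.min s r <= s; [rewrite ge_min lexx|rewrite /q; lra].
have qr : q < r by have : Num.min s r <= r; [rewrite ge_min lexx orbT|rewrite /q; lra].
have nq : nrm (z + q%:C%C - z) = q by rewrite addrC addKr nrmR gtr0_norm.
by have := hr (z + q%:C%C); rewrite nq => /(_ q0 qr); rewrite hs ?eqxx// nq.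
Qed.

(* The set of parameters near which [F] vanishes is open and closed. *)
Lemma identity_along_path (F : C -> W) (g : R -> C) (k : R) : 0 < k ->
  (forall s t, nrm (g s - g t) <= k * `|s - t|) ->
  (forall t, 0 <= t <= 1 ->
    (exists2 s : R, 0 < s & forall w, nrm (w - g t) < s -> F w = 0) \/
    (exists2 s : R, 0 < s & forall w, 0 < nrm (w - g t) -> nrm (w - g t) < s -> F w != 0)) ->
  (exists2 s : R, 0 < s & forall w, nrm (w - g 0) < s -> F w = 0) ->
  exists2 s : R, 0 < s & forall w, nrm (w - g 1) < s -> F w = 0.
Proof.
move=> k0 glip dich van0.
pose U := [set t | exists2 s : R, 0 < s & forall w, nrm (w - g t) < s -> F w = 0].
pose N := [set t | exists2 s : R, 0 < s & forall w, 0 < nrm (w - g t) -> nrm (w - g t) < s -> F w != 0].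
have near_g t (s : R) : 0 < s -> exists2 e : R, 0 < e & forall u, `|t - u| < e -> nrm (g u - g t) < s / 2.
  move=> s0; exists (s / 2 / k); first by rewrite !divr_gt0.
  by move=> u; rewrite ltr_pdivlMr// mulrC -(distrC u) => h; exact: le_lt_trans (glip _ _) h.
have oU : open U.
  rewrite openE => t [s s0 h]; have [e e0 he] := near_g t s s0.
  apply/nbhs_ballP; exists e => //= u; rewrite -ball_normE /= => /he gu.
  exists (s / 2); first by rewrite divr_gt0.
  by move=> w ws; apply: h; have := nrm_tri (g u) w (g t); lra.
have oN : open N.
  rewrite openE => t [s s0 h]; have [e e0 he] := near_g t s s0.
  apply/nbhs_ballP; exists e => //= u; rewrite -ball_normE /= => /he gu.
  have [ut|ut] := eqVneq (g u) (g t); first by exists s => //; rewrite ut.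
  have d0 : 0 < nrm (g u - g t) by rewrite nrm_gt0// subr_eq0.
  (* The disc around [g u] does not reach [g t], the only point nearby at which [F] may vanish. *)
  exists (nrm (g u - g t)) => // w _ wu; apply: h.
    rewrite nrm_gt0// subr_eq0; apply/eqP => wt; move: wu; rewrite wt nrm_sub; lra.
  by have := nrm_tri (g u) w (g t); lra.
have UN t : U t -> N t -> False by exact: not_vanishing_isolated.
suff e : `[0, 1] `&` U = `[0, 1]%classic.
  have : (`[0, 1]%classic : set R) 1 by rewrite /= in_itv /= ler01 lexx.
  by rewrite -e => -[].
apply: (@segment_connected R 0 1).
- by exists 0; split=> //; rewrite /= in_itv /= lexx ler01.
- by exists U.
- exists (~` N); first exact: open_closedC.
  apply/seteqP; split=> t [t01 h]; split=> //; first by move=> /(UN _ h).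
  by have [//|/h] := dich t t01.
Qed.

End identity_path.

(** * Dividing a vector field by its image under a functional *)

Section division.
Context {R : realType} {V : completeNormedModType R[i]}.
Local Notation C := R[i].
Variable xi : V -> C.
Hypothesis xi_lin : forall a x y, xi (a *: x + y) = a * xi x + xi y.
Hypothesis xi_bound : forall x, nrm (xi x) <= 2 * nrm x.

Let xiZ a x : xi (a *: x) = a * xi x.
Proof.
have x0 : xi 0 = 0 by have := xi_lin (-1) 0 0; rewrite scaler0 addr0 mulN1r addNr.
by have := xi_lin a x 0; rewrite x0 !addr0.
Qed.

(* [E / xi E] has at most a pole at [z], of order [m]. *)
Definition quotient_pole (E : C -> V) (z : C) (m : nat) (G : C -> V) (s : R) :=
  [/\ 0 < s, forall w, nrm (w - z) < s -> c11_at G w &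
    forall w, 0 < nrm (w - z) -> nrm (w - z) < s ->
      xi (E w) != 0 /\ (w - z) ^+ m *: E w = xi (E w) *: G w].

(** If [E] vanishes to order [l] and [xi o E] to order [m'], then [l <= m'] and the pole has order
    [m' - l], the regular part being the quotient of the two factors left. There is no pole as soon
    as [xi] does not kill the leading coefficient of [E]. *)
Lemma quotient_pole_exists (a : nat -> V) (E : C -> V) (z : C) (r : R) : 0 < r ->
  (forall w, nrm (w - z) < r -> to_lim (psum a (w - z)) (E w)) ->
  (exists n, xi (a n) != 0) ->
  exists m G s, quotient_pole E z m G s /\
    ((exists2 l, forall i, (i < l)%N -> a i = 0 & xi (a l) != 0) -> m = 0%N).
Proof.
move=> r0 hE [n0 n0P].
have [m' ma mmin] := @ex_minnP (fun n => xi (a n) != 0) (ex_intro _ n0 n0P).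
have xi0 : xi 0 = 0 by have := xiZ 0 0; rewrite scale0r mul0r.
have [l la lmin] := @ex_minnP (fun n => a n != 0) (ex_intro _ m' (contra_neq (fun e => etrans (congr1 xi e) xi0) ma)).
have lm : (l <= m')%N by apply: lmin; apply: contra_neq ma => ->.
have al i : (i < l)%N -> a i = 0.
  by move=> il; apply/eqP; apply: contraT => /lmin; rewrite leqNgt il.
have am i : (i < m')%N -> xi (a i) = 0.
  by move=> il; apply/eqP; apply: contraT => /mmin; rewrite leqNgt il.
have [G1 [s1 [s10 cG1 G1z h1]]] := @order_factor _ V V id (fun _ _ _ => erefl)
  a E z r r0 hE l al.
have [G2 [s2 [s20 cG2 G2z h2]]] := @order_factor _ V R[i]^o xi xi_lin a E z r r0 hE m' am.
have cH := c11_functional xi_lin xi_bound cG2.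
have Hz : xi (G2 z) != 0 by rewrite G2z.
have cHi := c11_inv cH Hz.
have cG := c11_scale cHi cG1.
have [s3 s30 h3] := c11_at_open cG.
have [s4 s40 h4] := c11_continuous cH (divr_gt0 (nrm_gt0 Hz) (ltr0n R 2)).
exists (m' - l)%N, (fun w => (xi (G2 w))^-1 *: G1 w), (Num.min (Num.min s1 s2) (Num.min s3 s4)).
split.
  split; first by rewrite !lt_min s10 s20 s30.
    by move=> w; rewrite !lt_min => /andP[_ /andP[/h3]].
  move=> w w0; rewrite !lt_min => /andP[/andP[/h1 e1 /h2 e2] /andP[_ /h4 w4]].
  have Hw : xi (G2 w) != 0.
    apply/eqP => Hw; move: w4; rewrite Hw.
    have -> : nrm ((0 : C^o) - xi (G2 z)) = nrm (xi (G2 z)) by rewrite sub0r nrmN.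
    by have := nrm_gt0 Hz; lra.
  have wz : w - z != 0 by apply/eqP => e; rewrite e nrm0 ltxx in w0.
  have e2' : xi (E w) = (w - z) ^+ m' * xi (G2 w) by exact: e2.
  rewrite e2' mulf_neq0 ?expf_neq0//; split=> //.
  by rewrite e1 !scalerA -exprD subnK// mulfK.
move=> [k ak xk]; apply/eqP; rewrite subn_eq0; apply: leq_trans (mmin _ xk) _.
by rewrite leqNgt; apply/negP => /ak e; rewrite e eqxx in la.
Qed.

(** Finitely many discs cover [K], and inside each of them only the centre can be a zero of
    [xi o E]. Multiplying [E / xi E] by the product [p] of the [(X - c)^(m c)] clears all poles, and
    [xi] of the result is [p]. No pole at [0] means no factor [X], hence [p(0)] is not zero.
    Relations to [E] are claimed off the centres [s] only. *)
Lemma c11_quotient (K : set C) (E : C -> V) : finitely_coverable K ->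
  (forall z, K z -> exists m G s, quotient_pole E z m G s /\ (z = 0 -> m = 0%N)) ->
  exists (E1 : C -> V) (p : {poly C}) (s : seq C), [/\ p.[0] != 0,
    forall z, K z -> c11_at E1 z &
    forall z, K z -> z \notin s -> [/\ xi (E1 z) = p.[z],
      exists c, E1 z = c *: E z & exists c, E z = c *: E1 z]].
Proof.
move=> Kcov poles.
have /choice[f hf] : forall z, exists q : nat * (C -> V) * R, K z ->
    quotient_pole E z q.1.1 q.1.2 q.2 /\ (z = 0 -> q.1.1 = 0%N).
  move=> z; have [Kz|nK] := pselect (K z); last by exists (0%N, E, 0).
  by have [m [G [s h]]] := poles _ Kz; exists (m, G, s).
have [z Kz|s0 [s0K scov]] := Kcov (fun z => (f z).2); first by have [[]] := hf _ Kz.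
pose s := undup s0; have us : uniq s by exact: undup_uniq.
have sK c : c \in s -> K c by rewrite mem_undup => /s0K.
have cov z : K z -> exists2 c, c \in s & nrm (z - c) < (f c).2.
  by move=> /scov[c]; rewrite -mem_undup; exists c.
pose m c := (f c).1.1; pose G c := (f c).1.2.
pose P (r : seq C) : {poly C} := \prod_(c <- r) ('X - c%:P) ^+ m c.
have PE r w : (P r).[w] = \prod_(c <- r) (w - c) ^+ m c.
  by rewrite /P horner_prod; apply: eq_bigr => c _; rewrite horner_exp hornerXsubC.
have Psplit c w : c \in s -> (P s).[w] = (w - c) ^+ m c * (P (rem c s)).[w].
  by move=> cs; rewrite !PE (perm_big _ (perm_to_rem cs)) big_cons.
have Pneq r w : w \notin r -> (P r).[w] != 0.
  rewrite PE prodf_seq_neq0 => wr; apply/allP => c cr /=.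
  by rewrite expf_neq0// subr_eq0; apply: contraNneq wr => ->.
(* At a centre the quotient may be undefined; the value there is the one given by the regular part,
   with the factor of this centre removed from the product. *)
pose E1 w := if w \in s then (P (rem w s)).[w] *: G w w else ((P s).[w] / xi (E w)) *: E w.
have xiE w : K w -> w \notin s -> xi (E w) != 0.
  move=> Kw ws; have [c cs wc] := cov w Kw.
  have [[_ _ h] _] := hf c (sK c cs); apply: (h w _ wc).1.
  by rewrite nrm_gt0// subr_eq0; apply: contraNneq ws => ->.
exists E1, (P s), s; split.
- rewrite PE prodf_seq_neq0; apply/allP => c cs /=.
  have [_ hm] := hf c (sK c cs); have [c0|c0] := eqVneq c 0; first by rewrite /m hm// expr0 oner_neq0.
  by rewrite expf_neq0// sub0r oppr_eq0.
- move=> z Kz.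
  have [c cs [zc zs]] : exists2 c, c \in s & nrm (z - c) < (f c).2 /\ (z \in s -> z = c).
    have [zs|zs] := boolP (z \in s); last by have [c] := cov z Kz; exists c.
    by exists z => //; rewrite subrr nrm0; have [[]] := hf z Kz.
  have [[f0 cG h] _] := hf c (sK c cs).
  have cP := c11_scale (c11_horner (P (rem c s)) z) (cG z zc).
  apply: eq_c11_at cP.
  (* Staying closer to [z] than all other centres, [E1] is given near [z] by the single formula
     [P (rem c s)] times the regular part at [c]. *)
  have [t t0 ht] : exists2 t : R, 0 < t & forall c', c' \in rem c s -> t <= nrm (z - c').
    have zr : z \notin rem c s.
      by apply/negP => zr; move: (zr); rewrite (zs (mem_rem zr)) mem_rem_uniq// inE eqxx.
    elim: (rem c s) zr => [|x l ih]; first by exists 1.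
    rewrite inE negb_or => /andP[zx /ih[t t0 ht]].
    exists (Num.min t (nrm (z - x))).
      by rewrite lt_min t0 nrm_gt0// subr_eq0.
    move=> y; rewrite inE => /orP[/eqP ->|/ht ty]; first by rewrite ge_min lexx orbT.
    by rewrite ge_min ty.
  exists (Num.min t ((f c).2 - nrm (z - c))); first by rewrite lt_min t0 subr_gt0.
  move=> w; rewrite lt_min => /andP[wt wf]; rewrite /E1.
  have wr : w \notin rem c s.
    by apply/negP => /ht; rewrite nrm_sub leNgt wt.
  case: ifPn => [ws|ws].
    have -> : w = c.
      by apply/eqP; apply: contraNT wr => wc; rewrite mem_rem_uniq// inE wc.
    by [].
  have wc : w - c != 0 by rewrite subr_eq0; apply: contraNneq ws => ->.
  have [||xw ew] := h w; first by rewrite nrm_gt0.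
    by have := nrm_tri z w c; lra.
  rewrite (Psplit c)// mulrAC mulrC -scalerA.
  by congr (_ *: _); rewrite mulrC -scalerA ew scalerA mulVf// scale1r.
- move=> z Kz zs; rewrite /E1 (negPf zs); have xz := xiE z Kz zs.
  have Pz := Pneq s z zs; split.
  + by rewrite xiZ divfK.
  + by exists ((P s).[z] / xi (E z)).
  + exists (xi (E z) / (P s).[z]); rewrite scalerA mulrA divfK// divff// scale1r.
    by [].
Qed.

End division.

(** * Fourier coefficients *)

Section circle_mean.
Context {R : realType}.
Local Notation C := R[i].

Definition grid (M k : nat) : R := k%:R * (pi / M%:R).

(** Riemann sum of the normalized integral over a period. The [2 M] nodes match the [2 M]
    frequencies [-M, ..., M - 1] of the finite Fourier sums. *)
Definition circle_mean {V : lmodType C} (M : nat) (h : R -> V) : V :=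
  ((2 * M)%:R^-1 : C) *: \sum_(k < 2 * M) h (grid M k).

Lemma gridS M k : grid M k.+1 = grid M k + pi / M%:R.
Proof. by rewrite /grid -natr1 mulrDl mul1r. Qed.

Lemma grid_full M : (0 < M)%N -> grid M (2 * M) = 2 * pi.
Proof.
by move=> M0; rewrite /grid natrM -mulrA [M%:R * _]mulrCA divff ?mulr1// pnatr_eq0 -lt0n.
Qed.

Lemma grid_double M k : grid (2 * M) (2 * k) = grid M k.
Proof.
rewrite /grid !natrM invfM [2 * _]mulrC -!mulrA; congr (_ * _).
by rewrite [pi * _]mulrCA mulVKf.
Qed.

Lemma cis_int_2pi (n : int) : cis (n%:~R * (2 * pi)) = 1 :> C.
Proof.
have nat k : cis (k%:R * (2 * pi)) = 1 :> C by rewrite cisMn cis_2pi expr1n.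
case: n => k; first exact: nat.
apply: (mulIf (cis_neq0 (k.+1%:R * (2 * pi) : R))).
by rewrite -cisD mul1r NegzE rmorphN /= mulNr addNr cis0 nat.
Qed.

Section vector.
Context {V : normedModType C}.
Implicit Types h : R -> V.

Lemma circle_meanZ M (a : C) h : circle_mean M (fun t => a *: h t) = a *: circle_mean M h.
Proof. by rewrite /circle_mean -scaler_sumr !scalerA mulrC. Qed.

Lemma eq_circle_mean M h1 h2 : h1 =1 h2 -> circle_mean M h1 = circle_mean M h2.
Proof. by move=> e; rewrite /circle_mean; congr (_ *: _); apply: eq_bigr. Qed.

Lemma circle_meanD M h1 h2 : circle_mean M (fun t => h1 t + h2 t) =
  circle_mean M h1 + circle_mean M h2.
Proof. by rewrite /circle_mean -scalerDr big_split. Qed.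

Lemma circle_mean_shift M h : (0 < M)%N -> (forall t, h (t + 2 * pi) = h t) ->
  circle_mean M (fun t => h (t + pi / M%:R)) = circle_mean M h.
Proof.
move=> M0 per; rewrite /circle_mean; congr (_ *: _).
under eq_bigr do rewrite -gridS.
have : \sum_(k < (2 * M).+1) h (grid M k) = \sum_(k < (2 * M).+1) h (grid M k) by [].
rewrite {1}big_ord_recl big_ord_recr /= grid_full// addrC.
have -> : h (2 * pi) = h (grid M 0) by rewrite -[2 * pi]add0r per /grid mul0r.
by move=> e; apply: (@addrI _ (h (grid M 0))); exact: e.
Qed.

Lemma circle_mean_le M h (B : R) : (forall t, nrm (h t) <= B) -> (0 < M)%N ->
  nrm (circle_mean M h) <= B.
Proof.
move=> hB M0; rewrite nrmZ nrmV nrm_nat.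
have M2 : 0 < (2 * M)%:R :> R by rewrite ltr0n muln_gt0.
rewrite ler_pdivrMl// (le_trans (nrm_sum _ _ _))//.
apply: le_trans (_ : \sum_(k < 2 * M) B <= _); first by apply: ler_sum => k _.
by rewrite sumr_const card_ord mulr_natl.
Qed.

(** The finer mean is the average of the coarse mean and of its translate by half a step, so the
    difference is half a mean of small increments. Along [M = 2^j] these differences are summable,
    which defines the integral of a Lipschitz function. *)
Lemma circle_mean_double M h (L : R) : (0 < M)%N -> 0 <= L ->
  (forall s t, nrm (h s - h t) <= L * `|s - t|) ->
  nrm (circle_mean (2 * M) h - circle_mean M h) <= L * pi / M%:R.
Proof.
move=> M0 L0 lip; have p0 := pi_ge0 R.
have M1 : 0 < M%:R :> R by rewrite ltr0n.
have -> : circle_mean (2 * M) h - circle_mean M h =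
    circle_mean M (fun t => (2^-1 : C) *: (h (t + pi / (2 * M)%:R) - h t)).
  rewrite circle_meanZ.
  have -> : circle_mean (2 * M) h = (2^-1 : C) *: (circle_mean M h + circle_mean M (fun t => h (t + pi / (2 * M)%:R))).
    rewrite -circle_meanD /circle_mean scalerA [(2 * (2 * M))%:R]natrM invfM; congr (_ *: _).
    have split2 n (u : nat -> V) : \sum_(k < 2 * n) u k = \sum_(k < n) (u (2 * k)%N + u (2 * k).+1).
      elim: n => [|n ih]; first by rewrite !big_ord0.
      by rewrite mulnSr addn2 !big_ord_recr /= ih addrA.
    rewrite (split2 (2 * M)%N (fun k => h (grid (2 * M) k))); apply: eq_bigr => k _; congr (_ + h _).
      by rewrite grid_double.
    by rewrite gridS grid_double.
  have -> : circle_mean M (fun t => h (t + pi / (2 * M)%:R) - h t) =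
     circle_mean M (fun t => h (t + pi / (2 * M)%:R)) - circle_mean M h.
    by rewrite /circle_mean -scalerBr sumrB.
  rewrite [circle_mean M h + _]addrC.
  have {2}-> : circle_mean M h = (2^-1 : C) *: (circle_mean M h + circle_mean M h).
    by rewrite -mulr2n -[circle_mean M h *+ 2]scaler_nat scalerA mulVf ?scale1r// pnatr_eq0.
  by rewrite -scalerBr opprD addrA addrK.
apply: circle_mean_le => // t; rewrite nrmZ nrmV nrm_nat.
have h1 := lip (t + pi / (2 * M)%:R) t.
have -> : L * pi / M%:R = 2^-1 * (2 * (L * (pi / M%:R))) by rewrite mulKf// mulrA.
apply: ler_wpM2l => //; apply: le_trans h1 _.
rewrite addrAC subrr add0r ger0_norm ?divr_ge0// natrM invfM [pi * _]mulrCA mulrCA.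
have : 0 <= L * (pi / M%:R) by rewrite mulr_ge0// divr_ge0.
by lra.
Qed.

End vector.

(** Discrete orthogonality of characters. A negative frequency is replaced by its sum with [2 M],
    which takes the same values on the grid. *)
Lemma circle_mean_cis M (m : int) : (0 < M)%N -> (`|m| < 2 * M)%N ->
  circle_mean M (fun t => cis (m%:~R * t) : C^o) = (m == 0)%:R.
Proof.
move=> M0 mM; have M1 : M%:R != 0 :> R by rewrite pnatr_eq0 -lt0n.
have M2 : (2 * M)%:R != 0 :> C by rewrite pnatr_eq0 -lt0n muln_gt0.
have pM : 0 < pi / M%:R :> R by rewrite divr_gt0 ?pi_gt0// ltr0n.
have p2 : (2 * M)%:R * (pi / M%:R) = 2 * pi :> R by exact: grid_full.
have main (n : nat) : (0 < n < 2 * M)%N ->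
    \sum_(k < 2 * M) cis (n%:R * grid M k) = 0 :> C.
  move=> /andP[n0 nM].
  have := @sum_cis R (2 * M) (n%:R * (pi / M%:R)).
  rewrite mulr_gt0 ?ltr0n// -p2 ltr_pM2r// ltr_nat nM => /(_ isT isT).
  rewrite [(2 * M)%:R * _]mulrCA p2 cisMn cis_2pi expr1n => /(_ erefl) h; rewrite -[RHS]h.
  by apply: eq_bigr => k _; rewrite /grid mulrCA.
rewrite /circle_mean; case: m mM => [[|n]|n] mM /=.
- under eq_bigr do rewrite mul0r cis0.
  by rewrite sumr_const card_ord -[_ *: _]/(_ * _) mulVf.
- by rewrite main// scaler0.
- rewrite -[RHS](scaler0 _ ((2 * M)%:R^-1 : C)); congr (_ *: _).
  rewrite -[RHS](main (2 * M - n.+1)%N); last by move: mM; lia.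
  apply: eq_bigr => k _; rewrite natrB ?(ltnW mM)// mulrBl cisD NegzE rmorphN /= mulNr.
  have -> : (2 * M)%:R * grid M k = k%:R * (2 * pi) by rewrite /grid mulrCA p2.
  by rewrite cisMn cis_2pi expr1n mul1r.
Qed.

End circle_mean.

(** As [Negz k] is [-(k+1)], the sum runs over the [2 N] integers from [-N] to [N - 1]. *)
Definition bsum {V : nmodType} (N : nat) (F : int -> V) : V :=
  \sum_(k < N) (F (Posz k) + F (Negz k)).

Section bsum_theory.
Context {V : zmodType}.
Implicit Types F G : int -> V.

Lemma bsum0 F : bsum 0 F = 0.
Proof. by rewrite /bsum big_ord0. Qed.

Lemma bsumS N F : bsum N.+1 F = bsum N F + (F (Posz N) + F (Negz N)).
Proof. by rewrite /bsum big_ord_recr. Qed.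

Lemma eq_bsum N F G : F =1 G -> bsum N F = bsum N G.
Proof. by move=> e; apply: eq_bigr => k _; rewrite !e. Qed.

Lemma bsumD N F G : bsum N (fun n => F n + G n) = bsum N F + bsum N G.
Proof. by rewrite /bsum -big_split; apply: eq_bigr => k _; rewrite addrACA. Qed.

Lemma bsumB N F G : bsum N (fun n => F n - G n) = bsum N F - bsum N G.
Proof. by rewrite /bsum -sumrB; apply: eq_bigr => k _; rewrite addrACA opprD. Qed.

Lemma bsum_ord N F : bsum N F = \sum_(i < N + N) F (Posz i - Posz N).
Proof.
rewrite /bsum big_split big_split_ord /= addrC; congr (_ + _); last first.
  by apply: eq_bigr => i _; rewrite PoszD addrC addKr.
rewrite (reindex_inj rev_ord_inj) /=; apply: eq_bigr => i _; congr F.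
by have := ltn_ord i; rewrite NegzE; lia.
Qed.

End bsum_theory.

Section bsum_norm.
Context {R : realType} {V : normedModType R[i]}.
Implicit Types F : int -> V.

Lemma nrm_bsum N F : nrm (bsum N F) <= bsum N (nrm \o F).
Proof.
apply: le_trans (nrm_sum _ _ _) _; apply: ler_sum => k _; exact: nrmD.
Qed.

Lemma bsumZ N (a : R[i]) F : bsum N (fun n => a *: F n) = a *: bsum N F.
Proof. by rewrite /bsum scaler_sumr; apply: eq_bigr => k _; rewrite scalerDr. Qed.

Lemma to_lim_bsum N (u : int -> nat -> V) (l : int -> V) :
  (forall n, to_lim (u n) (l n)) ->
  to_lim (fun k => bsum N (fun n => u n k)) (bsum N l).
Proof. by move=> h; apply: to_lim_sum => i; exact: to_limD. Qed.

End bsum_norm.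

Section fourier.
Context {R : realType} {V : completeNormedModType R[i]}.
Local Notation C := R[i].
Variable E : C -> V.
Hypothesis cE : forall z, nrm z = 1 -> c11_at E z.

(** Discrete version, on [2 M] nodes, of the [n]-th Fourier coefficient of [t |-> E (e^(it))]. *)
Definition fcoef (M : nat) (n : int) : V :=
  circle_mean M (fun t => cis (- (n%:~R * t)) *: E (cis t)).

(** Parameters at distance less than [r] are handled by the uniform expansion, which costs
    [M r + M]; for the others, twice the supremum [B0] divided by [r] is a sufficient slope. *)
Lemma circle_lipschitz : exists2 B : R, 0 <= B & (forall t, nrm (E (cis t)) <= B) /\
  forall s t, nrm (E (cis s) - E (cis t)) <= B * `|s - t|.
Proof.
have [B0 B00 hB0] : exists2 B : R, 0 <= B & forall z, nrm z = 1 -> nrm (E z) <= B.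
  have /choice[r hr] : forall z, exists r : R, nrm z = 1 -> 0 < r /\
      forall w, nrm (w - z) < r -> nrm (E w - E z) <= 1.
    move=> z; have [z1|] := eqVneq (nrm z) 1; last by move=> /eqP nz; exists 0 => /nz.
    by have [r r0 h] := c11_continuous (cE z1) ltr01; exists r.
  have [z /hr[]//|s [sK scov]] := @finitely_coverable_circle R r.
  exists (1 + \sum_(c <- s) nrm (E c)).
    by apply: addr_ge0 => //; apply: sumr_ge0 => *; exact: nrm_ge0.
  move=> z z1; have [c cs zc] := scov z z1.
  have [_ /(_ z zc)] := hr c (sK c cs); have := nrm_le_sub (E z) (E c).
  rewrite (big_rem c cs) /=.
  have : 0 <= \sum_(y <- rem c s) nrm (E y) by apply: sumr_ge0 => *; exact: nrm_ge0.
  lra.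
have [r [M [r0 M0 hu]]] := c11_uniform (@finitely_coverable_circle R) cE.
have B1 : 0 <= 2 * B0 / r by apply: divr_ge0; [lra|exact: ltW].
have B2 : 0 <= M * r + M by rewrite addr_ge0// mulr_ge0//; exact: ltW.
exists (B0 + 2 * B0 / r + (M * r + M)); first by lra.
split=> [t|s t]; first by have := hB0 _ (nrm_cis t); lra.
have x0 := normr_ge0 (s - t); have [st|st] := ltP `|s - t| r.
  have [v vM hv] := hu _ (nrm_cis t); have le := nrm_cisB s t.
  have := hv (cis s) (le_lt_trans le st).
  have := nrmD (E (cis s) - E (cis t) - (cis s - cis t) *: v) ((cis s - cis t) *: v).
  rewrite subrK nrmZ.
  have h1 : nrm (cis s - cis t) * nrm v <= `|s - t| * M by rewrite ler_pM ?nrm_ge0.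
  have h2 : M * nrm (cis s - cis t) ^+ 2 <= M * (r * `|s - t|).
    by rewrite ler_wpM2l// expr2 ler_pM ?nrm_ge0//; lra.
  have h3 : 0 <= (B0 + 2 * B0 / r) * `|s - t| by rewrite mulr_ge0// addr_ge0.
  by move=> h4 h5; lra.
have h1 : 2 * B0 <= 2 * B0 / r * `|s - t|.
  by rewrite -[leLHS](divfK (lt0r_neq0 r0)) ler_wpM2l.
have h2 : 0 <= (B0 + (M * r + M)) * `|s - t| by rewrite mulr_ge0// addr_ge0.
have := nrmB (E (cis s)) (E (cis t)); have := hB0 _ (nrm_cis t); have := hB0 _ (nrm_cis s).
by lra.
Qed.

(** The integrand is Lipschitz, so consecutive dyadic Riemann sums differ by [O(2^-j)] and the
    telescoping series converges. *)
Lemma fcoef_lim : exists z : int -> V, forall n, to_lim (fun j => fcoef (2 ^ j) n) (z n).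
Proof.
have [B B0 [EB lip]] := circle_lipschitz.
suff /choice[z hz] : forall n, exists l, to_lim (fun j => fcoef (2 ^ j) n) l by exists z.
move=> n; pose h t := cis (- (n%:~R * t)) *: E (cis t).
have hlip s t : nrm (h s - h t) <= (`|n%:~R| * B + B) * `|s - t|.
  have -> : h s - h t = (cis (- (n%:~R * s)) - cis (- (n%:~R * t))) *: E (cis s) +
      cis (- (n%:~R * t)) *: (E (cis s) - E (cis t)).
    by rewrite /h scalerBl scalerBr addrA subrK.
  rewrite (le_trans (nrmD _ _))// !nrmZ nrm_cis mul1r mulrDl lerD//.
  apply: (@le_trans _ _ (`|n%:~R * (s - t)| * B)); last by rewrite normrM mulrAC.
  rewrite ler_pM ?nrm_ge0// (le_trans (nrm_cisB _ _))//.
  by rewrite -opprD normrN -mulrBr.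
pose L := `|n%:~R| * B + B; have L0 : 0 <= L :> R by rewrite addr_ge0// mulr_ge0.
have [j|l hl _] := @geometric_series _ _ (fun j => fcoef (2 ^ j.+1) n - fcoef (2 ^ j) n) (L * pi).
  rewrite expnS; have := @circle_mean_double R V (2 ^ j) h L _ L0 hlip.
  by rewrite natrX; apply; rewrite expn_gt0.
exists (l + fcoef 1 n); apply: eq_to_lim (to_limD hl (to_lim_cst (fcoef 1 n))) => j.
elim: j => [|j ih]; first by rewrite big_ord0 add0r expn0.
by rewrite big_ord_recr /= addrAC ih addrC subrK.
Qed.

(** Translation by the grid step [d = pi / M] preserves the discrete mean, so the symmetric second
    difference of [E] with step [d] has coefficient [e^(ind) + e^(-ind) - 2] times that of [E]. The
    modulus of this factor is [|e^(ind) - 1|^2], at least of order [(n d)^2] because [|n| <= M]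
    keeps [|n d| <= pi]; the second difference itself is at most [3 B d^2]. The bound is thus
    uniform in [M]. *)
Lemma fcoef_decay : exists (K : R) (M0 : nat), 0 <= K /\ forall M n, (M0 <= M)%N -> (0 < `|n| <= M)%N ->
  nrm (fcoef M n) * (n%:~R) ^+ 2 <= K.
Proof.
have [r [B [r0 B0 hu]]] := c11_uniform (@finitely_coverable_circle R) cE.
have [c c0 hc] := @nrm_cisB1_ge R.
have [N hN] := cst_div_nat_small pi (divr_gt0 r0 (ltr0n R 2)).
have p0 := pi_gt0 R.
exists (3 * B / c ^+ 2), N.+1; split; first by apply: divr_ge0; [lra|exact: sqr_ge0].
case=> [//|M] n NM /andP[n0 nM].
have [d dE] : exists d : R, d = pi / M.+1%:R by exists (pi / M.+1%:R).
have d0 : 0 < d by rewrite dE divr_gt0// ltr0n.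
have dr : d < r by have := hN M NM; rewrite -dE; lra.
have shift (h : R -> V) : (forall t, h (t + 2 * pi) = h t) ->
    circle_mean M.+1 (fun t => h (t + d)) = circle_mean M.+1 h.
  by rewrite dE; exact: circle_mean_shift.
have cisN2pi t : cis (- (n%:~R * (t + 2 * pi))) = cis (- (n%:~R * t)) :> C.
  by rewrite mulrDr opprD cisD -[- (n%:~R * (2 * pi))]mulNr -intrN cis_int_2pi mulr1.
have cis2pi t : cis (t + 2 * pi) = cis t :> C by rewrite cisD cis_2pi mulr1.
pose H (e : R) t := cis (- (n%:~R * t)) *: E (cis (t + e)).
have per e t : H e (t + 2 * pi) = H e t by rewrite /H cisN2pi addrAC cis2pi.
pose cf := fcoef M.+1 n.
have cfE : circle_mean M.+1 (H 0) = cf.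
  by apply: eq_circle_mean => t; rewrite /H addr0.
have cp : circle_mean M.+1 (H d) = cis (n%:~R * d) *: cf.
  rewrite -cfE -(shift _ (per 0)) -circle_meanZ; apply: eq_circle_mean => t.
  by rewrite /H scalerA addr0 mulrDr opprD [cis (- _ - _)]cisD mulrCA -cisD subrr cis0 mulr1.
have cm : circle_mean M.+1 (H (- d)) = cis (- (n%:~R * d)) *: cf.
  rewrite -cfE -(shift _ (per (- d))) -circle_meanZ; apply: eq_circle_mean => t.
  by rewrite /H scalerA addr0 addrK mulrDr opprD [cis (- _ - _)]cisD mulrC.
pose x := n%:~R * d : R.
pose S t := cis (- (n%:~R * t)) *: (E (cis (t + d)) + E (cis (t - d)) - (2 : C) *: E (cis t)).
have SE : circle_mean M.+1 S = (cis x + cis (- x) - 2) *: cf.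
  rewrite scalerBl scalerDl -cp -cm -cfE -scaleNr -!(circle_meanZ, circle_meanD).
  apply: eq_circle_mean => t; rewrite /S /H addr0 scalerBr scalerDr scaleNr; congr (_ - _).
  by rewrite !scalerA mulrC.
have Sle t : nrm (S t) <= 3 * B * d ^+ 2.
  rewrite nrmZ nrm_cis mul1r; have [v vB hv] := hu _ (nrm_cis t).
  have dp : nrm (cis (t + d) - cis t) <= d.
    by apply: le_trans (nrm_cisB _ _) _; rewrite addrAC subrr add0r gtr0_norm.
  have dm : nrm (cis (t - d) - cis t) <= d.
    by apply: le_trans (nrm_cisB _ _) _; rewrite addrAC subrr add0r normrN gtr0_norm.
  have hp := hv _ (le_lt_trans dp dr); have hm := hv _ (le_lt_trans dm dr).
  (* Two expansions at the same point: besides their remainders, only the second difference of the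
     circle itself multiplies the derivative [v], and it is [O(d^2)]. *)
  have -> : E (cis (t + d)) + E (cis (t - d)) - (2 : C) *: E (cis t) =
    (E (cis (t + d)) - E (cis t) - (cis (t + d) - cis t) *: v) +
    (E (cis (t - d)) - E (cis t) - (cis (t - d) - cis t) *: v) +
    (cis t * (cis d + cis (- d) - 2)) *: v.
    rewrite scaler_nat mulr2n mulrBr mulrDr -!cisD mulr_natr mulr2n.
    set p := E (cis (t + d)); set m := E (cis (t - d)); set e := E (cis t).
    set a := cis (t + d); set b := cis (t - d); set c' := cis t.
    rewrite [X in _ = X + _]addrACA -opprD -scalerDl addrACA -opprD.
    have -> : a - c' + (b - c') = a + b - (c' + c') by rewrite addrACA opprD.
    by rewrite subrK.
  have dd : nrm (cis d + cis (- d) - 2 : C) <= d ^+ 2.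
    have -> : cis d + cis (- d) - 2 = - ((cis d - 1) * (cis (- d) - 1)) :> C.
      by rewrite mulrBl mulrBr -cisD subrr cis0; ring.
    rewrite nrmN nrmM expr2 ler_pM ?nrm_ge0//.
      by rewrite (le_trans (nrm_cisB1_le _))// gtr0_norm.
    by rewrite (le_trans (nrm_cisB1_le _))// normrN gtr0_norm.
  have sq y : 0 <= y -> y <= d -> B * y ^+ 2 <= B * d ^+ 2.
    by move=> y0 yd; rewrite ler_wpM2l// lerXn2r ?nnegrE// ltW.
  have := sq _ (nrm_ge0 _) dp; have := sq _ (nrm_ge0 _) dm.
  have : nrm (cis d + cis (- d) - 2 : C) * nrm v <= d ^+ 2 * B by rewrite ler_pM ?nrm_ge0.
  move=> q1 q2 q3.
  rewrite (le_trans (nrmD _ _))// (le_trans (lerD (nrmD _ _) (lexx _)))// nrmZ nrmM nrm_cis mul1r.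
  by lra.
have := circle_mean_le Sle (ltn0Sn M); rewrite SE nrmZ.
have -> : nrm (cis x + cis (- x) - 2 : C) = nrm (cis x - 1) ^+ 2.
  have -> : cis x + cis (- x) - 2 = - ((cis x - 1) * (cis (- x) - 1)) :> C.
    by rewrite mulrBl mulrBr -cisD subrr cis0; ring.
  by rewrite nrmN nrmM expr2 !nrm_cisB1 mulNr sinN normrN.
have xpi : `|x| <= pi.
  rewrite /x dE normrM [`|_ / _|]ger0_norm ?divr_ge0//; last exact: ltW.
  rewrite mulrCA ler_piMr//; first exact: ltW.
  by rewrite ler_pdivrMr ?ltr0n// mul1r -intr_norm -[M.+1%:R]/(M.+1%:~R) ler_int -abszE; rewrite lez_nat.
have := hc x xpi => hx.
have hx2 : (c * `|x|) ^+ 2 <= nrm (cis x - 1) ^+ 2.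
  by rewrite lerXn2r ?nnegrE ?nrm_ge0// mulr_ge0// ltW.
have cf0 := nrm_ge0 cf.
have h1 : (c * `|x|) ^+ 2 * nrm cf <= nrm (cis x - 1) ^+ 2 * nrm cf by rewrite ler_wpM2r.
move=> h2; have h3 := le_trans h1 h2.
have e1 : (c * `|x|) ^+ 2 * nrm cf = (nrm cf * n%:~R ^+ 2 * c ^+ 2) * d ^+ 2.
  by rewrite exprMn real_normK ?num_real// /x exprMn; ring.
by move: h3; rewrite e1 ler_pM2r ?exprn_gt0// ler_pdivlMr ?exprn_gt0.
Qed.

(** Discrete Fourier inversion is exact at the nodes: after exchanging the sums, orthogonality keeps
    the single node [l]. *)
Lemma fcoef_inversion M l : (l < 2 * M)%N ->
  bsum M (fun n => cis (n%:~R * grid M l) *: fcoef M n) = E (cis (grid M l)).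
Proof.
move=> lM; have M0 : (0 < M)%N by lia.
have M2 : (2 * M)%:R != 0 :> C by rewrite pnatr_eq0; lia.
pose F k (n : int) := cis (n%:~R * grid M l - n%:~R * grid M k) : C.
transitivity (\sum_(k < 2 * M) ((2 * M)%:R^-1 * bsum M (F k)) *: E (cis (grid M k))).
  rewrite /bsum /fcoef /circle_mean.
  transitivity (\sum_(j < M) \sum_(k < 2 * M) ((2 * M)%:R^-1 * (F k (Posz j) + F k (Negz j))) *: E (cis (grid M k))).
    apply: eq_bigr => j _; rewrite 2!scalerA 2!scaler_sumr -big_split; apply: eq_bigr => k _ /=.
    rewrite !scalerA -scalerDl /F !cisD; congr (_ *: _); ring.
  rewrite exchange_big; apply: eq_bigr => k _ /=.
  by rewrite -scaler_suml mulr_sumr.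
have FE k : (k < 2 * M)%N -> bsum M (F k) = (k == l)%:R * (2 * M)%:R.
  move=> kM; pose m := Posz l - Posz k.
  have -> : bsum M (F k) = cis (- (M%:R * (m%:~R * (pi / M%:R)))) *
      \sum_(i < 2 * M) cis (m%:~R * grid M i).
    rewrite bsum_ord addnn -mul2n mulr_sumr; apply: eq_bigr => i _.
    rewrite /F -cisD /grid /m; congr cis; rewrite !intrB; ring.
  have := @circle_mean_cis R M m M0; rewrite /circle_mean -[_ *: _]/(_ * _) => h.
  have h' := h ltac:(rewrite /m; lia).
  have -> : \sum_(i < 2 * M) cis (m%:~R * grid M i) = (2 * M)%:R * (m == 0)%:R :> C.
    by rewrite -h' mulVKf.
  rewrite /m subr_eq0 eqz_nat eq_sym.
  have [->|] := eqVneq k l; last by rewrite !mul0r !mulr0.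
  by rewrite subrr mul0r mulr0 oppr0 cis0 !mul1r mulr1.
rewrite (bigD1 (Ordinal lM)) //= FE// eqxx mul1r mulVf// scale1r big1 ?addr0// => k kl.
rewrite FE//; have -> : ((k : nat) == l) = false by apply/negbTE; exact: kl.
by rewrite mul0r mulr0 scale0r.
Qed.

End fourier.

Section summability.
Context {R : realType}.

Lemma intr_sqr_gt0 (n : int) : n != 0 -> 0 < n%:~R ^+ 2 :> R.
Proof. by move=> n0; rewrite exprn_even_gt0//= intr_eq0. Qed.

(** The two terms of absolute index about [n] are together at most [2 K / n^2], hence at most
    [4 K / n - 4 K / (n+1)], and the sum telescopes. *)
Lemma bsum_tail (f : int -> R) (K : R) m N : (0 < m)%N -> (m <= N)%N -> 0 <= K ->
  (forall n, n != 0 -> f n * n%:~R ^+ 2 <= K) ->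
  bsum N f <= bsum m f + 4 * K / m%:R - 4 * K / N%:R.
Proof.
move=> m0 /subnKC <- K0 hf; elim: (N - m)%N => [|k ih]; first by rewrite addn0 addrK.
rewrite addnS bsumS; set n := (m + k)%N in ih *.
have n0 : (0 < n)%N by rewrite addn_gt0 m0.
have nR : 0 < n%:R :> R by rewrite ltr0n.
have n1 : 0 < n%:R + 1 :> R by lra.
have term a : a != 0 -> (n%:R : R) <= `|a%:~R| -> f a <= K / n%:R ^+ 2.
  move=> a0 na; have := hf a a0; rewrite -ler_pdivlMr ?intr_sqr_gt0//.
  move=> h; apply: le_trans h _; apply: ler_wpM2l => //.
  rewrite lef_pV2 ?posrE ?intr_sqr_gt0 ?exprn_gt0//.
  by rewrite -[leRHS]real_normK ?num_real// lerXn2r ?nnegrE// ltW.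
have h1 : f (Posz n) <= K / n%:R ^+ 2 by apply: term; rewrite ?ger0_norm// eqz_nat -lt0n.
have h2 : f (Negz n) <= K / n%:R ^+ 2.
  by apply: term => //; rewrite NegzE rmorphN normrN ger0_norm ?ler0n// ler_nat.
have h3 : K / n%:R ^+ 2 <= 2 * K / n%:R - 2 * K / n.+1%:R.
  rewrite -natr1 -[_ - _](_ : 2 * K / (n%:R * (n%:R + 1)) = _); last first.
    by field; rewrite !gt_eqF.
  rewrite -mulrA [2 * _]mulrCA ler_wpM2l// ler_pdivlMr ?mulr_gt0//.
  have -> : (n%:R ^+ 2)^-1 * (n%:R * (n%:R + 1)) = 1 + n%:R^-1 :> R.
    by field; rewrite gt_eqF.
  have : n%:R^-1 <= 1 :> R by rewrite invf_le1// ler1n.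
  lra.
move: h1 h2 h3 ih; move: (K / n%:R ^+ 2) (n%:R^-1) (n.+1%:R^-1) (f _) (f _) (bsum n f) => q u v a b c.
move: (bsum m f) (4 * K / m%:R) => x y; lra.
Qed.

Lemma le_bsum_widen (f : int -> R) m N : (m <= N)%N -> (forall n, 0 <= f n) -> bsum m f <= bsum N f.
Proof.
move=> /subnKC <- f0; elim: (N - m)%N => [|k ih]; first by rewrite addn0.
by rewrite addnS bsumS (le_trans ih)// lerDl addr_ge0.
Qed.

End summability.

Section fourier_limit.
Context {R : realType} {V : completeNormedModType R[i]}.
Local Notation C := R[i].
Variables (E : C -> V) (z : int -> V).
Hypothesis cE : forall w, nrm w = 1 -> c11_at E w.
Hypothesis hz : forall n, to_lim (fun j => fcoef E (2 ^ j) n) (z n).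

Lemma fourier_decay : exists2 K : R, 0 <= K & (forall n, n != 0 -> nrm (z n) * n%:~R ^+ 2 <= K) /\
  exists M0, forall M n, (M0 <= M)%N -> (0 < `|n| <= M)%N -> nrm (fcoef E M n) * (n%:~R) ^+ 2 <= K.
Proof.
have [K [M0 [K0 h]]] := fcoef_decay cE; exists K => //; split; last by exists M0.
move=> n n0; have n2 := @intr_sqr_gt0 R n n0.
rewrite -ler_pdivlMr//; apply: to_lim_nrm_le (hz n) _ => j.
have e2 k : (k <= 2 ^ k)%N by exact: ltnW (ltn_expl _ _).
exists (maxn j (maxn M0 `|n|)); first exact: leq_maxl.
rewrite ler_pdivlMr//; apply: h; last rewrite absz_gt0 n0 /=; apply: leq_trans (e2 _);
  by rewrite !leq_max leqnn ?orbT.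
Qed.

Lemma fourier_summable : exists B : R, forall N, bsum N (nrm \o z) <= B.
Proof.
have [K K0 [hK _]] := fourier_decay; exists (bsum 1 (nrm \o z) + 4 * K) => N.
have [N0|N0] := leqP 1 N.
  have := @bsum_tail R (nrm \o z) K 1 N isT N0 K0 hK; rewrite divr1.
  have : 0 <= 4 * K / N%:R by rewrite divr_ge0// mulr_ge0.
  lra.
have -> : N = 0%N by move: N0; case: N.
rewrite bsum0 /bsum big_ord1 /=.
by have := nrm_ge0 (z 0); have := nrm_ge0 (z (Negz 0)); lra.
Qed.

(** No convergence theorem for Fourier series is involved. Near [t] lies a point [s] belonging to
    all fine dyadic grids, where inversion is exact; the frequencies beyond [m] are uniformly
    negligible by the decay of the discrete coefficients, and the finitely many others converge to
    the [z n]. *)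
Lemma fourier_dense t (e : R) : 0 < e ->
  exists m (a : int -> C), nrm (E (cis t) - bsum m (fun n => a n *: z n)) <= e.
Proof.
move=> e0; have [K K0 [hK [M0 hM]]] := fourier_decay.
have [B B0 [_ lip]] := circle_lipschitz cE; have p0 := pi_gt0 R.
have [N hN] := cst_div_nat_small (4 * K) (divr_gt0 e0 (ltr0n R 2)).
wlog t0 : t / 0 <= t < 2 * pi.
  move=> wl; have [s /andP[s1 s2] ts] := @cis_surj R (cis t) (nrm_cis t).
  have [s0|s0] := leP 0 s; first by rewrite ts; apply: wl; apply/andP; split; lra.
  have -> : cis t = cis (s + 2 * pi) by rewrite cisD cis_2pi mulr1.
  by apply: wl; apply/andP; split; lra.
have [i hi] : exists i, B * (pi / (2 ^ i)%:R) <= e / 2 :> R.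
  have [i hi] := cst_div_nat_small (B * pi) (divr_gt0 e0 (ltr0n R 2)).
  exists i.+1; rewrite mulrA; apply: le_trans (hi i (leqnn _)).
  rewrite ler_wpM2l ?mulr_ge0//; first exact: ltW.
  by rewrite lef_pV2 ?posrE ?ltr0n ?expn_gt0// ler_nat ltnW// ltn_expl.
pose d : R := pi / (2 ^ i)%:R; have d0 : 0 < d by rewrite divr_gt0// ltr0n expn_gt0.
pose l := Num.truncn (t / d); have /andP[tge tlt] := t0.
have td0 : 0 <= t / d by rewrite divr_ge0// ltW.
have /andP[l1 l2] : l%:R <= t / d < l.+1%:R by exact: truncn_itv.
have ld : l%:R * d <= t by rewrite -ler_pdivlMr.
have ld2 : t < l%:R * d + d by rewrite -[X in _ + X]mul1r -mulrDl natr1 -ltr_pdivrMr.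
have l2i : (l < 2 * 2 ^ i)%N.
  rewrite -(ltr_nat R) natrM; apply: le_lt_trans l1 _; rewrite ltr_pdivrMr// -mulrA.
  by rewrite [(2 ^ i)%:R * _]mulrCA divff ?mulr1 ?pnatr_eq0 ?expn_eq0.
have gE j : grid (2 ^ (i + j)) (l * 2 ^ j) = l%:R * d :> R.
  rewrite /grid /d expnD !natrM -mulrA; congr (_ * _).
  by field; rewrite !pnatr_eq0 !expn_eq0.
have [m mE] : exists m, m = N.+1 by exists N.+1.
have m0 : (0 < m)%N by rewrite mE.
pose s : R := l%:R * d.
(* The approximant is the truncated Fourier series at the dyadic point [s], not at [t]. *)
exists m, (fun n => cis (n%:~R * s)).
have close : nrm (E (cis t) - E (cis s)) <= e / 2.
  apply: le_trans (lip t s) _; apply: le_trans hi; apply: ler_wpM2l => //.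
  rewrite ger0_norm /s; last by lra.
  by rewrite -/d; lra.
suff dyadic : nrm (E (cis s) - bsum m (fun n => cis (n%:~R * s) *: z n)) <= e / 2.
  have := nrm_tri (E (cis s)) (E (cis t)) (bsum m (fun n => cis (n%:~R * s) *: z n)).
  by lra.
have lim : to_lim (fun j => bsum m (fun n => cis (n%:~R * s) *: fcoef E (2 ^ j) n))
    (bsum m (fun n => cis (n%:~R * s) *: z n)).
  by apply: to_lim_bsum => n; apply: to_limZ.
rewrite nrm_sub; apply: to_lim_nrm_sub_le lim _ => j0.
pose j := (i + (j0 + m + M0))%N; exists j; first by rewrite /j -addnA addnCA leq_addr.
have jj : (j <= 2 ^ j)%N by exact: ltnW (ltn_expl _ _).
have inv : bsum (2 ^ j) (fun n => cis (n%:~R * s) *: fcoef E (2 ^ j) n) = E (cis s).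
  rewrite /s -(gE (j0 + m + M0)%N); apply: fcoef_inversion.
  by rewrite [(2 ^ (i + _))%N]expnD mulnA ltn_pmul2r ?expn_gt0.
rewrite nrm_sub -{1}inv /bsum.
have qj : (j0 + m + M0 <= j)%N by exact: leq_addl.
have mj : (m <= 2 ^ j)%N.
  by apply: leq_trans jj; apply: leq_trans qj; rewrite addnAC leq_addl.
have M0j : (M0 <= 2 ^ j)%N by apply: leq_trans jj; apply: leq_trans qj; rewrite leq_addl.
pose F n := cis (n%:~R * s) *: fcoef E (2 ^ j) n.
rewrite -/(bsum (2 ^ j) F) -/(bsum m F).
(* Norms of the discrete coefficients, cut off outside the range of frequencies where their decay is
   known. *)
pose f n : R := if (`|n| <= 2 ^ j)%N then nrm (fcoef E (2 ^ j) n) else 0.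
have nF n : nrm (F n) = nrm (fcoef E (2 ^ j) n) by rewrite /F nrmZ nrm_cis mul1r.
have diff : nrm (bsum (2 ^ j) F - bsum m F) <= bsum (2 ^ j) f - bsum m f.
  have : forall k, (m + k <= 2 ^ j)%N -> nrm (bsum (m + k) F - bsum m F) <= bsum (m + k) f - bsum m f.
    elim=> [|k ih] hk; first by rewrite addn0 !subrr nrm0.
    have hk' : (m + k <= 2 ^ j)%N by apply: ltnW; rewrite -addnS.
    rewrite addnS !bsumS addrAC (le_trans (nrmD _ _))// [leRHS]addrAC lerD ?ih//.
    apply: le_trans (nrmD _ _) _.
    have fp : f (Posz (m + k)) = nrm (fcoef E (2 ^ j) (Posz (m + k))) by rewrite /f ifT.
    have fn : f (Negz (m + k)) = nrm (fcoef E (2 ^ j) (Negz (m + k))).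
      by rewrite /f ifT//=; rewrite addnS in hk.
    by rewrite !nF fp fn.
  by move=> /(_ (2 ^ j - m)%N); rewrite subnKC//; apply.
apply: le_trans diff _.
have fK n : n != 0 -> f n * n%:~R ^+ 2 <= K.
  move=> n0; rewrite /f; case: ifP => [nj|_]; last by rewrite mul0r.
  by apply: hM => //; rewrite absz_gt0 n0.
have := bsum_tail m0 mj K0 fK.
have := hN N (leqnn _); rewrite -mE.
have : 0 <= 4 * K / (2 ^ j)%:R by rewrite divr_ge0// mulr_ge0.
by lra.
Qed.

(** Already on Riemann sums, [A] multiplies the integrand by [e^(it)], which lowers the frequency by
    one; continuity of [A] gives the limit. *)
Lemma fourier_shift (A : V -> V) (c : R) :
  (forall a x y, A (a *: x + y) = a *: A x + A y) -> (forall x, nrm (A x) <= c * nrm x) ->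
  (forall t, A (E (cis t)) = cis t *: E (cis t)) -> forall n, A (z n) = z (n - 1).
Proof.
move=> Alin Ab AE n.
have A0 : A 0 = 0 by have := Alin (-1) 0 0; rewrite scaler0 addr0 scaleN1r addNr.
have AZ a x : A (a *: x) = a *: A x by have := Alin a x 0; rewrite A0 !addr0.
have AD x y : A (x + y) = A x + A y by have := Alin 1 x y; rewrite !scale1r.
have Asum k (u : nat -> V) : A (\sum_(i < k) u i) = \sum_(i < k) A (u i).
  by elim: k => [|k ih]; rewrite ?big_ord0// !big_ord_recr /= AD ih.
have step M : A (fcoef E M n) = fcoef E M (n - 1).
  rewrite /fcoef /circle_mean AZ; congr (_ *: _).
  rewrite (Asum _ (fun k => cis (- (n%:~R * grid M k)) *: E (cis (grid M k)))).
  apply: eq_bigr => k _; rewrite AZ AE scalerA -cisD rmorphB /=; congr (cis _ *: _); ring.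
apply: to_lim_uniq (hz (n - 1)); apply: (@eq_to_lim _ _ (fun j => A (fcoef E (2 ^ j) n))) => //.
move=> e e0; have c0 : 0 < `|c| + 1 by rewrite ltr_wpDl.
have [N hN] := hz n (divr_gt0 e0 c0); exists N => j /hN.
rewrite ler_pdivlMr// => h.
have -> : A (fcoef E (2 ^ j) n) - A (z n) = A (fcoef E (2 ^ j) n - z n).
  by rewrite -scaleN1r -AZ -AD scaleN1r.
apply: le_trans (Ab _) _; have := ler_norm c; have := nrm_ge0 (fcoef E (2 ^ j) n - z n).
by nra.
Qed.

(** As soon as [2 M] exceeds [size p + |n|], the Riemann sum of a polynomial computes its
    coefficient exactly, so the sequence is eventually constant. *)
Lemma fourier_polynomial (xi : V -> C) (p : {poly C}) :
  (forall a x y, xi (a *: x + y) = a * xi x + xi y) -> (forall x, nrm (xi x) <= 2 * nrm x) ->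
  (forall t, xi (E (cis t)) = p.[cis t]) ->
  (forall k : nat, xi (z k) = p`_k) /\ (forall k, xi (z (Negz k)) = 0).
Proof.
move=> xlin xb xE.
have x0 : xi 0 = 0 by have := xlin (-1) 0 0; rewrite scaler0 addr0 mulN1r addNr.
have xZ a x : xi (a *: x) = a * xi x by have := xlin a x 0; rewrite x0 !addr0.
have xD x y : xi (x + y) = xi x + xi y by have := xlin 1 x y; rewrite scale1r mul1r.
have xsum k (u : nat -> V) : xi (\sum_(i < k) u i) = \sum_(i < k) xi (u i).
  by elim: k => [|k ih]; rewrite ?big_ord0// !big_ord_recr /= xD ih.
have step M n : (0 < M)%N -> (size p + `|n| < 2 * M)%N ->
    xi (fcoef E M n) = \sum_(i < size p) p`_i * (Posz i == n)%:R.
  move=> M0 hM; rewrite /fcoef {1}/circle_mean xZ.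
  rewrite (xsum _ (fun k => cis (- (n%:~R * grid M k)) *: E (cis (grid M k)))).
  have cE1 (k : 'I_(2 * M)) : xi (cis (- (n%:~R * grid M k)) *: E (cis (grid M k))) =
      \sum_(i < size p) p`_i * cis ((Posz i - n)%:~R * grid M k).
    rewrite xZ xE horner_coef mulr_sumr; apply: eq_bigr => i _.
    by rewrite -cisMn mulrCA -cisD intrB mulrBl addrC.
  rewrite (eq_bigr _ (fun k _ => cE1 k)) exchange_big mulr_sumr; apply: eq_bigr => i _ /=.
  rewrite -mulr_sumr mulrCA; congr (_ * _); rewrite -subr_eq0 -(circle_mean_cis M0)//.
  by have := ltn_ord i; move: hM; move: (2 * M)%N (size p) (nat_of_ord i) => a b c; lia.
have lim n : xi (z n) = \sum_(i < size p) p`_i * (Posz i == n)%:R.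
  apply: (@to_lim_uniq _ C (fun j => xi (fcoef E (2 ^ j) n))).
    move=> e e0; have [N hN] := hz n (divr_gt0 e0 (ltr0n R 2)); exists N => j /hN h.
    have -> : xi (fcoef E (2 ^ j) n) - xi (z n) = xi (fcoef E (2 ^ j) n - z n).
      by rewrite -[- z n]scaleN1r xD (xZ (-1)) mulN1r.
    by have := xb (fcoef E (2 ^ j) n - z n); lra.
  apply: (@to_lim_near _ _ (fun=> \sum_(i < size p) p`_i * (Posz i == n)%:R) _ _ (size p + `|n|)%N) (to_lim_cst _).
  move=> j hj; rewrite step ?expn_gt0//; apply: leq_ltn_trans hj _.
  by rewrite (ltn_trans (ltn_expl j (ltnSn 1)))// mul2n -addnn -addn1 leq_add2l expn_gt0.
split=> k; rewrite lim; last by rewrite big1// => i _; rewrite mulr0.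
have [kp|kp] := ltnP k (size p).
  rewrite (bigD1 (Ordinal kp)) //= eqxx mulr1 big1 ?addr0// => i ik.
  by rewrite eqz_nat (negbTE (_ : (i : nat) != k)) ?mulr0.
rewrite big1 ?nth_default// => i _.
by rewrite eqz_nat ltn_eqF ?mulr0// (leq_trans (ltn_ord i)).
Qed.

End fourier_limit.

(** * Mean value property on the disk *)

Section mean_value.
Context {R : realType} {V : normedModType R[i]}.
Local Notation C := R[i].

(** The mean over the circle of radius [s] is compared with that of radius [s + h]. By expansion,
    the increment is [h] times the mean of the radial derivative [u], up to [B h^2]; this mean is
    [O(1/M)], so moving from radius 0 to radius 1 by small steps changes the mean by an arbitrarily
    small amount. *)
Lemma disk_mean_value (H : C -> V) : (forall w, nrm w <= 1 -> c11_at H w) ->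
  to_lim (fun j => circle_mean (2 ^ j) (fun t => H (cis t))) (H 0).
Proof.
move=> cH; have [r [B [r0 B0 hu]]] := c11_uniform (@finitely_coverable_disk R) cH.
have p0 := pi_gt0 R.
have /choice[v hv] : forall z, exists v, nrm z <= 1 -> nrm v <= B /\
    forall w, nrm (w - z) < r -> nrm (H w - H z - (w - z) *: v) <= B * nrm (w - z) ^+ 2.
  move=> z; have [z1|_] := leP (nrm z) 1; last by exists 0.
  by have [v vB h] := hu z z1; exists v.
pose mean M (s : R) := circle_mean M (fun t => H (s%:C%C * cis t)).
have nsc (s t : R) : 0 <= s -> nrm (s%:C%C * cis t) = s.
  by move=> s0; rewrite nrmM nrm_cis mulr1 nrmR ger0_norm.
have step M (s h : R) : (0 < M)%N -> pi / M%:R < r -> 0 < h -> h < r -> 0 <= s -> s + h <= 1 ->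
    nrm (mean M (s + h) - mean M s) <= B * h * (h + pi / M%:R).
  move=> M0 dr h0 hr s0 s1; have [d dE] : exists d : R, d = pi / M%:R by exists (pi / M%:R).
  rewrite -dE in dr *; have d0 : 0 < d by rewrite dE divr_gt0// ltr0n.
  pose u t := cis t *: v (s%:C%C * cis t).
  have z1 t : nrm (s%:C%C * cis t) <= 1 by rewrite nsc//; lra.
  have mB (f g : R -> V) : circle_mean M (fun t => f t - g t) = circle_mean M f - circle_mean M g.
    by rewrite /circle_mean -scalerBr sumrB.
  (* Rotating by one grid step [d] does not change the mean of [H], while its first order effect is
     [s (e^(id) - 1)] times the mean of [u]. So this product is bounded by the quadratic remainder,
     and one divides by [s |e^(id) - 1|]. At [s = 0], [u] is a multiple of [e^(it)] and has mean
     zero. *)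
  have umean : nrm (circle_mean M u) <= B * d.
    have [s00|sn0] := eqVneq s 0.
      have -> : circle_mean M u = (circle_mean M (fun t => cis (1%:~R * t) : C^o) : C) *: v 0.
        rewrite /circle_mean -[X in _ = X *: _]/(_ * _) -scalerA scaler_suml; congr (_ *: _).
        by apply: eq_bigr => k _; rewrite /u s00 rmorph0 mul0r mul1r.
      rewrite circle_mean_cis//; last by case: (M) M0 => [|k] // _; rewrite mulnS.
      by rewrite scale0r nrm0 mulr_ge0// ltW.
    have sp : 0 < s by rewrite lt_neqAle eq_sym sn0.
    pose g t := H (s%:C%C * cis (t + d)) - H (s%:C%C * cis t) - ((s%:C%C * (cis d - 1)) *: u t).
    have gle t : nrm (g t) <= B * (s * nrm (cis d - 1 : C)) ^+ 2.
      have e : s%:C%C * cis (t + d) - s%:C%C * cis t = s%:C%C * (cis d - 1) * cis t by rewrite cisD; ring.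
      have ne : nrm (s%:C%C * cis (t + d) - s%:C%C * cis t) = s * nrm (cis d - 1 : C).
        by rewrite e !nrmM nrm_cis mulr1 nrmR gtr0_norm.
      have [_] := hv _ (z1 t) => /(_ (s%:C%C * cis (t + d))); rewrite ne /g /u scalerA -e; apply.
      apply: le_lt_trans dr; have := nrm_cisB1_le d; rewrite gtr0_norm// => h1.
      have : s * nrm (cis d - 1 : C) <= 1 * d by rewrite ler_pM ?nrm_ge0//; lra.
      by rewrite mul1r.
    have gm : circle_mean M g = - ((s%:C%C * (cis d - 1)) *: circle_mean M u).
      rewrite /g !mB circle_meanZ.
      rewrite (_ : circle_mean M (fun t => H (s%:C%C * cis (t + d))) = circle_mean M (fun t => H (s%:C%C * cis t))).
        by rewrite subrr sub0r.
      rewrite dE (circle_mean_shift (h := fun t => H (s%:C%C * cis t)))// => t.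
      by rewrite cisD cis_2pi mulr1.
    have := circle_mean_le gle M0; rewrite gm nrmN nrmZ nrmM nrmR gtr0_norm//.
    set x := nrm (cis d - 1 : C); set y := nrm _ => hxy.
    have xd : x <= d by rewrite /x (le_trans (nrm_cisB1_le d))// gtr0_norm.
    have x0 : 0 <= x by exact: nrm_ge0.
    have y0 : 0 <= y by exact: nrm_ge0.
    have xp : 0 < x.
      rewrite lt_neqAle x0 andbT eq_sym; apply/eqP => xz.
      have [c c0 hc] := @nrm_cisB1_ge R; have := hc d.
      rewrite -/x xz gtr0_norm//; have : 0 < c * d by exact: mulr_gt0.
      have : d <= pi by rewrite dE ler_pdivrMr ?ltr0n// ler_peMr ?ler1n//; exact: ltW.
      by move=> h1 h2 /(_ h1); lra.
    have sx : 0 < s * x by exact: mulr_gt0.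
    have : y <= B * (s * x) by rewrite -(ler_pM2l sx); rewrite expr2 in hxy; lra.
    have : s * x <= 1 * d by apply: ler_pM => //; lra.
    by rewrite mul1r => h1 h2; apply: le_trans h2 _; rewrite ler_wpM2l.
  have -> : mean M (s + h) - mean M s = circle_mean M (fun t =>
      H ((s + h)%:C%C * cis t) - H (s%:C%C * cis t) - h%:C%C *: u t) + h%:C%C *: circle_mean M u.
    by rewrite !mB circle_meanZ subrK.
  rewrite (le_trans (nrmD _ _))// (nrmZ h%:C%C) nrmR gtr0_norm//.
  have : h * nrm (circle_mean M u) <= h * (B * d) by rewrite ler_wpM2l// ltW.
  suff : nrm (circle_mean M (fun t =>
      H ((s + h)%:C%C * cis t) - H (s%:C%C * cis t) - h%:C%C *: u t)) <= B * h ^+ 2.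
    by rewrite expr2; lra.
  apply: circle_mean_le => // t.
  have e : (s + h)%:C%C * cis t - s%:C%C * cis t = h%:C%C * cis t by rewrite rmorphD /=; ring.
  have ne : nrm ((s + h)%:C%C * cis t - s%:C%C * cis t) = h by rewrite e nsc// ltW.
  by have [_] := hv _ (z1 t) => /(_ ((s + h)%:C%C * cis t)); rewrite ne e /u scalerA; apply.
have mean0 M : (0 < M)%N -> mean M 0 = H 0.
  move=> M0; rewrite /mean /circle_mean; under eq_bigr do rewrite rmorph0 mul0r.
  rewrite sumr_const card_ord -[X in _ *: X]scaler_nat scalerA mulVf ?scale1r//.
  by rewrite pnatr_eq0 -lt0n muln_gt0.
(* [J + 1] radial steps of length [h = 1 / (J + 1)], each costing [B h (h + pi / M)]. *)
have total M J : (0 < M)%N -> pi / M%:R < r -> J.+1%:R^-1 < r ->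
    nrm (mean M 1 - H 0) <= B * (J.+1%:R^-1 + pi / M%:R).
  move=> M0 dr hr; pose h : R := J.+1%:R^-1; have h0 : 0 < h by rewrite invr_gt0 ltr0n.
  have J1 : J.+1%:R * h = 1 by rewrite divff// pnatr_eq0.
  pose q := B * h * (h + pi / M%:R).
  have : forall i, (i <= J.+1)%N -> nrm (mean M (i%:R * h) - H 0) <= i%:R * q.
    elim=> [|i ih] iJ; first by rewrite !mul0r mean0// subrr nrm0.
    have e : i.+1%:R * h = i%:R * h + h by rewrite -natr1 mulrDl mul1r.
    have s1 : i%:R * h + h <= 1.
      by rewrite -e -[leRHS]J1 ler_wpM2r ?ler_nat//; exact: ltW.
    have := step M (i%:R * h) h M0 dr h0 hr (mulr_ge0 (ler0n _ _) (ltW h0)) s1.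
    have := nrm_tri (mean M (i%:R * h)) (mean M (i%:R * h + h)) (H 0).
    have := ih (ltnW iJ); rewrite e -natr1 [(_ + 1) * q]mulrDl mul1r -/q.
    lra.
  rewrite {}/q.
  move=> /(_ _ (leqnn _)); rewrite J1 mulrA [B * h]mulrC mulrA J1 mul1r.
  by [].
move=> e e0; have B1 : 0 < B + 1 by lra.
have e1 : 0 < e / (B + 1) / 2 by rewrite !divr_gt0.
have [N1 hN1] := inv_nat_small e1.
have [N2 hN2] := inv_nat_small (divr_gt0 r0 (ltr0n R 2)).
have [N3 hN3] := cst_div_nat_small pi e1.
have [N4 hN4] := cst_div_nat_small pi (divr_gt0 r0 (ltr0n R 2)).
exists (maxn N3 N4).+1 => j; rewrite gtn_max => /andP[j3 j4].
have pj N (b : R) : (forall n, (N <= n)%N -> pi / n.+1%:R <= b) -> (N < j)%N -> pi / (2 ^ j)%:R <= b.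
  move=> hN Nj; have := hN (2 ^ j).-1; rewrite prednK ?expn_gt0//; apply.
  by rewrite -ltnS prednK ?expn_gt0// (ltn_trans Nj)// ltn_expl.
have q1 := pj _ _ hN3 j3; have q2 := pj _ _ hN4 j4.
have q3 := hN1 (maxn N1 N2) (leq_maxl _ _); have q4 := hN2 (maxn N1 N2) (leq_maxr _ _).
have c1 : pi / (2 ^ j)%:R < r by lra.
have c2 : (maxn N1 N2).+1%:R^-1 < r by apply: le_lt_trans q4 _; lra.
have := @total (2 ^ j)%N (maxn N1 N2).
rewrite expn_gt0 => /(_ isT c1 c2); rewrite /mean.
rewrite (eq_circle_mean _ (fun t => congr1 H (mul1r (cis t)))).
move=> h; apply: le_trans h _.
have : B * ((maxn N1 N2).+1%:R^-1 + pi / (2 ^ j)%:R) <= B * (e / (B + 1)).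
  by rewrite ler_wpM2l// [leRHS]splitr lerD.
move=> h; apply: le_trans h _.
have e0' := ltW e0.
by rewrite mulrCA ler_piMr// ler_pdivrMr//; lra.
Qed.

End mean_value.

(** * The backward orbit of an eigenvectorfield *)

Section backward_orbit.
Context {R : realType} {V : completeNormedModType R[i]}.
Local Notation C := R[i].

(* The Fourier coefficients [z n] of an eigenvectorfield form a bilateral
   backward orbit; [xi] sees only finitely many of them. *)
Record backward_orbit (A : V -> V) (z : int -> V) (xi : V -> C) (p : {poly C}) : Prop := {
  orbit_shift : forall n, A (z n) = z (n - 1);
  orbit_summable : exists B : R, forall N, bsum N (nrm \o z) <= B;
  orbit_dense : forall y (e : R), 0 < e ->
    exists m (a : int -> C), nrm (y - bsum m (fun n => a n *: z n)) <= e;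
  orbit_lin : forall a x y, xi (a *: x + y) = a * xi x + xi y;
  orbit_bound : forall x, nrm (xi x) <= 2 * nrm x;
  orbit_pos : forall k : nat, xi (z k) = p`_k;
  orbit_neg : forall k, xi (z (Negz k)) = 0;
  orbit_coef0 : p`_0 != 0 }.

(** The points [cis (t + e / (k+1))] are pairwise distinct, since they lie on an arc shorter than
    half a turn; among [size s + 1] of them one is not in [s]. *)
Lemma cis_avoid (s : seq C) (t d : R) : 0 < d ->
  exists2 t', `|t' - t| < d & cis t' \notin s.
Proof.
move=> d0; pose e := Num.min d 1 / 2.
have [c c0 hc] := @nrm_cisB1_ge R.
have ed : e < d by have : Num.min d 1 <= d; [rewrite ge_min lexx|rewrite /e; lra].
have e1 : e <= 1 by have : Num.min d 1 <= 1; [rewrite ge_min lexx orbT|rewrite /e; lra].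
have e0 : 0 < e by rewrite divr_gt0// lt_min d0 ltr01.
pose u (k : nat) : R := e / k.+1%:R.
have u0 k : 0 < u k by rewrite divr_gt0// ltr0n.
have ue k : u k <= e.
  by rewrite ler_pdivrMr ?ltr0n// ler_peMr ?ler1n//; exact: ltW.
have uinj k l : cis (t + u k) = cis (t + u l) -> k = l.
  move=> ekl; have : cis (u k - u l) - 1 = 0 :> C.
    apply: (mulfI (cis_neq0 (t + u l))); rewrite mulr0 mulrBr mulr1 -cisD.
    by rewrite addrACA subrr addr0 ekl subrr.
  move=> h; have := hc (u k - u l); rewrite h nrm0.
  have ukl : `|u k - u l| <= pi.
    have p2 := pi_ge2 R; rewrite ler_norml; apply/andP; split;
      have := u0 k; have := u0 l; have := ue k; have := ue l; lra.
  move=> /(_ ukl); rewrite pmulr_rle0// normr_le0 subr_eq0 => /eqP.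
  move=> /(mulfI (lt0r_neq0 e0)) /invr_inj /eqP; rewrite eqr_nat => /eqP.
  by case.
have [k ks] : exists k, cis (t + u k) \notin s.
  apply: contrapT => /forallNP h.
  have sub : {subset [seq cis (t + u k) | k <- iota 0 (size s).+1] <= s}.
    by move=> _ /mapP[k _ ->]; apply: contrapT => /negP; exact: h.
  have us : uniq [seq cis (t + u k) | k <- iota 0 (size s).+1].
    by rewrite map_inj_uniq ?iota_uniq//; exact: uinj.
  by have := uniq_leq_size us sub; rewrite size_map size_iota ltnn.
exists (t + u k) => //; rewrite addrAC subrr add0r gtr0_norm//.
exact: le_lt_trans (ue k) ed.
Qed.

Lemma c11_cis_continuous {W : normedModType C} (F : C -> W) t : c11_at F (cis t) ->
  forall e : R, 0 < e -> exists2 d : R, 0 < d & forall t', `|t' - t| < d -> nrm (F (cis t') - F (cis t)) <= e.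
Proof.
move=> cF e /(c11_continuous cF)[r r0 h]; exists r => // t' tt'.
by apply: h; exact: le_lt_trans (nrm_cisB _ _) tt'.
Qed.

(** Identities known off the finitely many centres of the division extend to the whole circle by
    continuity. *)
Lemma generic_eq {W : normedModType C} (f g : R -> W) (s : seq C) :
  (forall t e, 0 < e -> exists2 d : R, 0 < d & forall t', `|t' - t| < d -> nrm (f t' - f t) <= e) ->
  (forall t e, 0 < e -> exists2 d : R, 0 < d & forall t', `|t' - t| < d -> nrm (g t' - g t) <= e) ->
  (forall t, cis t \notin s -> f t = g t) -> f =1 g.
Proof.
move=> cf cg fg t; apply/eqP; rewrite -subr_eq0; apply/eqP/nrm_eq0/eqP.
rewrite eq_le nrm_ge0 andbT; apply/ler_addgt0Pr => e e0; rewrite add0r.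
have e2 : 0 < e / 2 by rewrite divr_gt0.
have [d d0 hd] := cf t _ e2; have [d' d'0 hd'] := cg t _ e2.
have [|t' tt' ts] := @cis_avoid s t (Num.min d d'); first by rewrite lt_min d0.
move: tt'; rewrite lt_min => /andP[/hd h1 /hd' h2].
have := nrm_tri (f t') (f t) (g t); rewrite (nrm_sub (f t) (f t')) (fg t' ts) => h3.
by rewrite (fg t' ts) in h1; lra.
Qed.

(** The constant of [bounded_operator] is complex; comparing real parts allows it to be replaced by
    its modulus. *)
Lemma bounded_operator_nrm (A : V -> V) : bounded_operator A ->
  exists2 c : R, 0 <= c & forall x, nrm (A x) <= c * nrm x.
Proof.
move=> [M hM]; exists (nrm M) => [|x]; first exact: nrm_ge0.
have Re_le (w : C) : complex.Re w <= nrm w.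
  rewrite /nrm normc_def /=; apply: le_trans (ler_norm _) _.
  by rewrite -sqrtr_sqr ler_wsqrtr// lerDl sqr_ge0.
have := hM x; rewrite lecE => /andP[_ h]; apply: le_trans h _.
by apply: le_trans (Re_le _) _; rewrite nrmM -nrmE nrmR ger0_norm ?nrm_ge0.
Qed.

(** Off [s], [E1] is a multiple of [E], so it satisfies the eigenvector equation there, and
    everywhere by continuity. Conversely [E] is a multiple of [E1] off [s], so the closed span of
    the [z n] contains [E] off [s], then on the whole circle, and is the whole space. The
    convergence of the discrete coefficients is kept in the conclusion to identify the negative ones
    in the disk case. *)
Lemma eigenvectorfield_orbit (A : V -> V) (K : set C) (E E1 : C -> V) (xi : V -> C)
    (p : {poly C}) (s : seq C) :
  (forall a x y, A (a *: x + y) = a *: A x + A y) -> bounded_operator A ->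
  (forall a x y, xi (a *: x + y) = a * xi x + xi y) -> (forall x, nrm (xi x) <= 2 * nrm x) ->
  (forall z, nrm z = 1 -> K z) -> p.[0] != 0 ->
  (forall z, K z -> c11_at E z) -> (forall z, K z -> c11_at E1 z) ->
  (forall z, K z -> z \notin s -> [/\ xi (E1 z) = p.[z],
      exists c, E1 z = c *: E z & exists c, E z = c *: E1 z]) ->
  eigenvectorfield A E -> closure (lin_span (E @` unit_circle)) = setT ->
  exists z, backward_orbit A z xi p /\ forall n, to_lim (fun j => fcoef E1 (2 ^ j) n) (z n).
Proof.
move=> Alin /bounded_operator_nrm[c c0 Ab] xlin xb TK p0 cE cE1 hs AE Edense.
have A0 : A 0 = 0 by have := Alin (-1) 0 0; rewrite scaler0 addr0 scaleN1r addNr.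
have AZ a x : A (a *: x) = a *: A x by have := Alin a x 0; rewrite A0 !addr0.
have AB x y : A x - A y = A (x - y).
  by have := Alin (-1) y x; rewrite !scaleN1r => h; rewrite [LHS]addrC -h [- y + x]addrC.
have Kt t : K (cis t) by apply: TK; exact: nrm_cis.
have cE1T z : nrm z = 1 -> c11_at E1 z by move=> /TK /cE1.
have cAE1 t e : 0 < e -> exists2 d : R, 0 < d & forall t', `|t' - t| < d ->
    nrm (A (E1 (cis t')) - A (E1 (cis t))) <= e.
  move=> e0; have c1 : 0 < c + 1 by lra.
  have [d d0 h] := c11_cis_continuous (cE1 _ (Kt t)) (divr_gt0 e0 c1); exists d => // t' /h.
  rewrite ler_pdivlMr// AB => ht; apply: le_trans (Ab _) _.
  by have := nrm_ge0 (E1 (cis t') - E1 (cis t)); lra.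
have AE1 : forall t, A (E1 (cis t)) = cis t *: E1 (cis t).
  apply: (@generic_eq _ _ _ s cAE1).
    move=> t e e0; have cz : c11_at (fun z => (z - 0) *: E1 z) (cis t).
      by apply: c11_scale (c11_linear 0 _) (cE1 _ (Kt t)).
    have [d d0 h] := c11_cis_continuous cz e0; exists d => // t' /h.
    by rewrite !subr0.
  move=> t ts; have [_ [a E1E] _] := hs _ (Kt t) ts.
  by rewrite E1E AZ AE ?scalerA 1?mulrC// /unit_circle /= -nrmE nrm_cis.
have xE1 : forall t, xi (E1 (cis t)) = p.[cis t].
  apply: (@generic_eq C^o (fun t => xi (E1 (cis t))) (fun t => p.[cis t]) s).
  - move=> t e e0; exact: (c11_cis_continuous (c11_functional xlin xb (cE1 _ (Kt t))) e0).
  - move=> t e e0; exact: (c11_cis_continuous (c11_horner p (cis t)) e0).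
  - by move=> t ts; have [] := hs _ (Kt t) ts.
have [z hz] := fcoef_lim cE1T; exists z; split=> //.
have [zpos zneg] := fourier_polynomial hz xlin xb xE1.
split=> //.
- exact: (fourier_shift hz Alin Ab AE1).
- exact: (fourier_summable cE1T hz).
- pose D := [set y | forall e : R, 0 < e -> exists m (a : int -> C), nrm (y - bsum m (fun n => a n *: z n)) <= e].
  have Dclosed y : (forall e : R, 0 < e -> exists2 y', D y' & nrm (y - y') <= e) -> D y.
    move=> h e e0; have e2 : 0 < e / 2 by rewrite divr_gt0.
    have [y' Dy' yy'] := h _ e2; have [m [a ha]] := Dy' _ e2; exists m, a.
    by have := nrm_tri y' y (bsum m (fun n => a n *: z n)); lra.
  have DZ b y : D y -> D (b *: y).
    move=> Dy e e0; have b0 : 0 < nrm b + 1 by have := nrm_ge0 b; lra.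
    have [m [a ha]] := Dy _ (divr_gt0 e0 b0); exists m, (fun n => b * a n).
    move: ha; rewrite ler_pdivlMr// => ha.
    rewrite (@eq_bsum _ m _ (fun n => b *: (a n *: z n))); last by move=> n; rewrite scalerA.
    by rewrite bsumZ -scalerBr nrmZ; have := nrm_ge0 (y - bsum m (fun n => a n *: z n)); lra.
  have Dext m N a : (m <= N)%N -> exists b : int -> C,
      bsum N (fun n => b n *: z n) = bsum m (fun n => a n *: z n).
    move=> mN; exists (fun n => if (if n is Posz k then (k < m)%N else (absz n <= m)%N) then a n else 0).
    rewrite /bsum -(subnKC mN) big_split_ord /= [X in _ + X]big1 ?addr0.
      by apply: eq_bigr => i _; rewrite !ltn_ord.
    by move=> i _; rewrite /= ltnNge leq_addr /= !scale0r addr0.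
  have DD y y' : D y -> D y' -> D (y + y').
    move=> Dy Dy' e e0; have e2 : 0 < e / 2 by rewrite divr_gt0.
    have [m [a ha]] := Dy _ e2; have [m' [a' ha']] := Dy' _ e2.
    have [b hb] := Dext _ _ a (leq_maxl m m'); have [b' hb'] := Dext _ _ a' (leq_maxr m m').
    exists (maxn m m'), (fun n => b n + b' n).
    rewrite (@eq_bsum _ (maxn m m') _ (fun n => b n *: z n + b' n *: z n)); last by move=> n; rewrite scalerDl.
    rewrite bsumD hb hb' opprD addrACA; apply: le_trans (nrmD _ _) _.
    by rewrite (splitr e) lerD.
  have D0 : D 0 by move=> e e0; exists 0%N, (fun=> 0); rewrite bsum0 subrr nrm0 ltW.
  have DE t : D (E (cis t)).
    apply: Dclosed => e e0; have [d d0 hd] := c11_cis_continuous (cE _ (Kt t)) e0.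
    have [t' /hd h ts] := cis_avoid s t d0.
    exists (E (cis t')); last by rewrite nrm_sub.
    have [_ _ [b ->]] := hs _ (Kt t') ts; apply: DZ => e' e'0.
    exact: (fourier_dense cE1T hz).
  have Dspan y : lin_span (E @` unit_circle) y -> D y.
    move=> [n [a [x [hx ->]]]]; elim/big_ind : _ => // i _; apply: DZ.
    have [w] := hx i; rewrite /unit_circle /= => w1 <-.
    have [|t _ ->] := @cis_surj R w; last exact: DE.
    by rewrite /nrm w1.
  move=> y; apply: Dclosed => e e0.
  have : closure (lin_span (E @` unit_circle)) y by rewrite Edense.
  by move=> /closure_nrm /(_ e e0)[y' /Dspan Dy' yy']; exists y' => //; rewrite nrm_sub ltW.
- by rewrite -horner_coef0.
Qed.

End backward_orbit.

Section orbit_of_eigenvectorfield.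
Context {R : realType} {V : completeNormedModType R[i]}.
Local Notation C := R[i].

Lemma unit_circleE (z : C) : unit_circle z <-> nrm z = 1.
Proof.
rewrite /unit_circle /=; split=> h; first by rewrite /nrm h.
by rewrite -nrmE h.
Qed.

Lemma analytic_c11 (E : C -> V) z : analytic_at E z -> c11_at E z.
Proof.
move=> /analytic_psum[a [r [r0 h]]]; have [G [s [s0 cG _ hG]]] := psum_taylor r0 h 0.
apply: eq_c11_at cG; exists s => // w /hG ->.
by rewrite /psum big_ord0 add0r expr0 scale1r.
Qed.

(** If [E] vanished on the circle, the closed span would be [0], which the empty family spans,
    against infinite dimension. *)
Lemma spanning_nonzero (E : C -> V) : infinite_dimensional V ->
  closure (lin_span (E @` unit_circle)) = setT -> exists2 z, nrm z = 1 & E z != 0.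
Proof.
move=> Vinf Ed; apply: contrapT => h.
have E0 z : nrm z = 1 -> E z = 0.
  by move=> z1; apply/eqP; apply: contrapT => /negP Ez; apply: h; exists z.
have span0 y : lin_span (E @` unit_circle) y -> y = 0.
  move=> [n [a [x [hx ->]]]]; apply: big1 => i _.
  by have [w /unit_circleE /E0 -> <-] := hx i; rewrite scaler0.
apply: (Vinf 0%N (fun=> 0)); apply/seteqP; split=> // y _.
have y0 : y = 0.
  apply/nrm_eq0/eqP; rewrite eq_le nrm_ge0 andbT; apply/ler_addgt0Pr => e e0; rewrite add0r.
  have : closure (lin_span (E @` unit_circle)) y by rewrite Ed.
  by move=> /closure_nrm /(_ e e0)[y' /span0 ->]; rewrite sub0r nrmN => /ltW.
by exists 0%N, (fun=> 0), (fun=> 0); split=> [[]//|]; rewrite big_ord0.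
Qed.

Let idlin (a : C) (x y : V) : id (a *: x + y) = a *: id x + id y.
Proof. by []. Qed.

Let idbound (x : V) : nrm (id x) <= 2 * nrm x.
Proof. by have := nrm_ge0 x; rewrite /=; lra. Qed.

Lemma functional_analytic_dichotomy (W : normedModType C) (L : V -> W) (E : C -> V) z :
  (forall a x y, L (a *: x + y) = a *: L x + L y) -> (forall x, nrm (L x) <= 2 * nrm x) ->
  analytic_at E z ->
  (exists2 s : R, 0 < s & forall w, nrm (w - z) < s -> L (E w) = 0) \/
  (exists2 s : R, 0 < s & forall w, 0 < nrm (w - z) -> nrm (w - z) < s -> L (E w) != 0).
Proof.
move=> Llin Lb /analytic_psum[a [r [r0 h]]].
by have [[_]|[_]] := order_dichotomy Llin Lb r0 h; [left|right].
Qed.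

Lemma functional_pole (xi : V -> C) (E : C -> V) z :
  (forall a x y, xi (a *: x + y) = a * xi x + xi y) -> (forall x, nrm (xi x) <= 2 * nrm x) ->
  analytic_at E z ->
  ~ (exists2 s : R, 0 < s & forall w, nrm (w - z) < s -> xi (E w) = 0) ->
  exists m G s, quotient_pole xi E z m G s.
Proof.
move=> xlin xb /analytic_psum[a [r [r0 h]]] nv.
have [[_ /nv//]|[[m _ am] _]] := @order_dichotomy R V C^o xi xlin xb a E z r r0 h.
have [k [G [s [hG _]]]] := quotient_pole_exists xlin xb r0 h (ex_intro _ m am).
by exists k, G, s.
Qed.

(** With [xi] non-zero at one value [E z0], the identity theorem along arcs of the circle shows that
    [xi o E] vanishes identically near no point of the circle, so that all quotients have at most
    poles. The requirement at [0] is vacuous, as [0] is not on the circle. *)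
Lemma orbit_circle (A : {linear V -> V}) (E : C -> V) : infinite_dimensional V ->
  bounded_operator A -> spanning_analytic_eigenvectorfield unit_circle A E ->
  exists z xi p, backward_orbit A z xi p.
Proof.
move=> Vinf Ab [[Om [_ KOm Ean]] AE Ed].
have Alin a x y : A (a *: x + y) = a *: A x + A y by rewrite linearP.
have an z : nrm z = 1 -> analytic_at E z by move=> /unit_circleE /KOm /Ean.
have [z0 z01 Ez0] := spanning_nonzero Vinf Ed.
have [xi [xlin xb xz0]] := exists_functional Ez0.
have nv z : nrm z = 1 -> ~ (exists2 s : R, 0 < s & forall w, nrm (w - z) < s -> xi (E w) = 0).
  move=> z1; have [t _ ->] := cis_surj z1; have [t0 _ z0t] := cis_surj z01.
  pose g (u : R) : C := cis (t + u * (t0 - t)).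
  have glip s u : nrm (g s - g u) <= (`|t0 - t| + 1) * `|s - u|.
    apply: le_trans (nrm_cisB _ _) _.
    have -> : t + s * (t0 - t) - (t + u * (t0 - t)) = (t0 - t) * (s - u) by ring.
    by rewrite normrM ler_wpM2r// lerDl.
  have k0 : 0 < `|t0 - t| + 1 by rewrite ltr_wpDl.
  move=> van; have := @identity_along_path R C^o (fun w => xi (E w)) g _ k0 glip.
  have -> : g 0 = cis t by rewrite /g mul0r addr0.
  have -> : g 1 = cis t0 by rewrite /g mul1r addrC subrK.
  move=> /(_ _ van) [].
    move=> u _; apply: functional_analytic_dichotomy => //.
    by apply: an; exact: nrm_cis.
  move=> s s0 /(_ (cis t0)); rewrite subrr nrm0 => /(_ s0) /eqP.
  by rewrite -z0t; exact/negP.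
have poles z : nrm z = 1 -> exists m G s, quotient_pole xi E z m G s /\ (z = 0 -> m = 0%N).
  move=> z1; have [m [G [s h]]] := functional_pole xlin xb (an z z1) (nv z z1).
  exists m, G, s; split=> // z0'; move: z1; rewrite z0' nrm0 => /eqP.
  by rewrite eq_sym oner_eq0.
have [E1 [p [s [p0 cE1 hs]]]] := c11_quotient xlin (@finitely_coverable_circle R) poles.
have cE z : nrm z = 1 -> c11_at E z by move=> /an /analytic_c11.
have [z [hz _]] := eigenvectorfield_orbit Alin Ab xlin xb
  (fun z h => h) p0 cE cE1 hs AE Ed.
by exists z, xi, p.
Qed.

(** The path of the identity theorem is now a segment inside the disk. Since [E 0] may vanish, [xi]
    is chosen non-zero on the first non-zero Taylor coefficient [a l] of [E] at [0]: [E / xi E] is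
    then regular at [0], and [p(0)] is not zero. *)
Lemma orbit_disk (A : {linear V -> V}) (E : C -> V) : infinite_dimensional V ->
  bounded_operator A -> spanning_analytic_eigenvectorfield closed_unit_disk A E ->
  exists z xi p, backward_orbit A z xi p /\ forall k, z (Negz k) = 0.
Proof.
move=> Vinf Ab [[Om [_ KOm Ean]] AE Ed].
have Alin a x y : A (a *: x + y) = a *: A x + A y by rewrite linearP.
have an z : nrm z <= 1 -> analytic_at E z.
  by move=> z1; apply/Ean/KOm; rewrite /closed_unit_disk /= -(rmorph1 (real_complex R)) normr_le.
have [z0 z01 Ez0] := spanning_nonzero Vinf Ed.
have path0 (W : normedModType C) (L : V -> W) (z1 z2 : C) :
    (forall a x y, L (a *: x + y) = a *: L x + L y) -> (forall x, nrm (L x) <= 2 * nrm x) ->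
    nrm z1 <= 1 -> nrm z2 <= 1 ->
    (exists2 s : R, 0 < s & forall w, nrm (w - z1) < s -> L (E w) = 0) ->
    (exists2 s : R, 0 < s & forall w, nrm (w - z2) < s -> L (E w) = 0).
  move=> Llin Lb h1 h2 van.
  pose g (u : R) : C := (1 - u)%:C%C * z1 + u%:C%C * z2.
  have glip s u : nrm (g s - g u) <= 2 * `|s - u|.
    have -> : g s - g u = (s - u)%:C%C * (z2 - z1) by rewrite /g !rmorphB /=; ring.
    rewrite nrmM nrmR mulrC ler_wpM2r//; apply: le_trans (nrmB _ _) _; lra.
  have := @identity_along_path R W (fun w => L (E w)) g 2 ltac:(lra) glip.
  have -> : g 0 = z1 by rewrite /g subr0 rmorph1 rmorph0 mul0r addr0 mul1r.
  have -> : g 1 = z2 by rewrite /g subrr rmorph1 rmorph0 mul0r add0r mul1r.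
  apply=> // t /andP[t0 t1]; apply: functional_analytic_dichotomy => //; apply: an.
  apply: le_trans (nrmD _ _) _; rewrite !nrmM !nrmR !ger0_norm//; last by lra.
  have : (1 - t) * nrm z1 <= (1 - t) * 1 by rewrite ler_wpM2l//; lra.
  have : t * nrm z2 <= t * 1 by rewrite ler_wpM2l.
  lra.
have z01' : nrm z0 <= 1 by rewrite z01.
have n01 : nrm (0 : C) <= 1 by rewrite nrm0.
have /analytic_psum[a [r [r0 h]]] := an 0 n01.
have [l al la] : exists2 l, forall i, (i < l)%N -> a i = 0 & a l != 0.
  have [[_ van]|[[l al la] _]] := @order_dichotomy R V V id idlin idbound a E 0 r r0 h.
    have [s s0 hs] := path0 V id _ _ idlin idbound n01 z01' van.
    by have := hs z0; rewrite subrr nrm0 => /(_ s0) /= e; rewrite e eqxx in Ez0.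
  by exists l.
have [xi [xlin xb xal]] := exists_functional la.
have iso0 : exists2 s : R, 0 < s & forall w, 0 < nrm (w - 0) -> nrm (w - 0) < s -> xi (E w) != 0.
  have [[al0 _]|[_ //]] := @order_dichotomy R V C^o xi xlin xb a E 0 r r0 h.
  by rewrite al0 eqxx in xal.
have poles z : nrm z <= 1 -> exists m G s, quotient_pole xi E z m G s /\ (z = 0 -> m = 0%N).
  move=> z1; have [z_0|zn0] := eqVneq z 0.
    have [m [G [s [hG hm]]]] := quotient_pole_exists xlin xb r0 h (ex_intro _ l xal).
    by exists m, G, s; rewrite z_0; split=> // _; apply: hm; exists l.
  have [|m [G [s hG]]] := functional_pole xlin xb (an z z1).
    move=> van; apply: (@not_vanishing_isolated R C^o (fun w => xi (E w)) 0) => //.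
    exact: (path0 C^o xi z 0 xlin xb z1 n01 van).
  by exists m, G, s; split=> // z_0; rewrite z_0 eqxx in zn0.
have [E1 [p [s [p0 cE1 hs]]]] := c11_quotient xlin (@finitely_coverable_disk R) poles.
have cE z : nrm z <= 1 -> c11_at E z by move=> /an /analytic_c11.
have [z [hz lz]] := eigenvectorfield_orbit Alin Ab xlin xb
  (fun z (h : nrm z = 1) => eq_ind_r (fun c => c <= 1) (lexx 1) h) p0 cE cE1 hs AE Ed.
exists z, xi, p; split=> // k.
(* The coefficient of index [-(k+1)] is the mean of [H] over the circle, hence its value at the
   centre, which is zero. *)
pose H w : V := w ^+ k.+1 *: E1 w.
have cH w : nrm w <= 1 -> c11_at H w.
  move=> w1; have := c11_scale (c11_horner ('X^(k.+1))%R w) (cE1 w w1).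
  by apply: eq_c11_at; exists 1 => // y _; rewrite hornerXn.
have := disk_mean_value cH; rewrite /H expr0n scale0r => hm.
apply: to_lim_uniq (lz (Negz k)) _; apply: eq_to_lim hm => j.
apply: eq_circle_mean => t; rewrite -cisMn; congr (cis _ *: _).
by rewrite NegzE rmorphN /= mulNr opprK.
Qed.

End orbit_of_eigenvectorfield.

(** * Finite-valued functions *)

Section finite_valued.
Context d (X : measurableType d).

(** Simple functions with values in a bare type: all preimages are required to be measurable, so
    that no sigma-algebra on [V] is needed and composition with an arbitrary map of the values is
    harmless. *)
Definition fin_meas {V : Type} (f : X -> V) :=
  finite_set (range f) /\ forall B, measurable (f @^-1` B).

Lemma fin_meas_comp {V W : Type} (h : V -> W) (f : X -> V) : fin_meas f -> fin_meas (h \o f).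
Proof.
move=> [ff mf]; split; last by move=> B; rewrite comp_preimage; exact: mf.
by apply: sub_finite_set (finite_image h ff) => _ [x _ <-]; exists (f x) => //; exists x.
Qed.

Lemma fin_meas_cst {V : Type} (c : V) : fin_meas (fun _ : X => c).
Proof.
split=> [|B].
  apply: (@sub_finite_set _ _ [set c]); last exact: finite_set1.
  by move=> _ [x _ <-].
have [Bc|nBc] := pselect (B c).
  by rewrite (_ : _ @^-1` _ = setT)//; apply/seteqP; split.
by rewrite (_ : _ @^-1` _ = set0)//; apply/seteqP; split.
Qed.

Lemma fin_meas_precomp {V : Type} (f : X -> V) (t : X -> X) :
  (forall B, measurable B -> measurable (t @^-1` B)) -> fin_meas f -> fin_meas (f \o t).
Proof.
move=> mt [ff mf]; split; last by move=> B; rewrite comp_preimage; exact: mt.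
by apply: sub_finite_set ff => _ [x _ <-]; exists (t x).
Qed.

Lemma fin_meas_pair {V W : Type} (f : X -> V) (g : X -> W) : fin_meas f -> fin_meas g ->
  fin_meas (fun x => (f x, g x)).
Proof.
move=> [ff mf] [fg mg]; split.
  apply: (@sub_finite_set _ _ (range f `*` range g)); last exact: finite_setX.
  by move=> _ [x _ <-]; split; exists x.
move=> B.
rewrite (_ : _ @^-1` B = \bigcup_(q in (range f `*` range g) `&` B) (f @^-1` [set q.1] `&` g @^-1` [set q.2])).
  apply: fin_bigcup_measurable; first exact/finite_setIl/finite_setX.
  by move=> q _; apply: measurableI; [exact: mf|exact: mg].
apply/seteqP; split=> x /=.
  by move=> Bx; exists (f x, g x) => //=; split=> //; split; exists x.
by move=> [[a b] [_ Bab] /= [-> ->]].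
Qed.

Lemma fin_meas_comp2 {V W U : Type} (op : V -> W -> U) (f : X -> V) (g : X -> W) :
  fin_meas f -> fin_meas g -> fin_meas (fun x => op (f x) (g x)).
Proof. by move=> ff fg; exact: (fin_meas_comp (fun q => op q.1 q.2) (fin_meas_pair ff fg)). Qed.

Lemma fin_meas_sum {V : zmodType} n (f : 'I_n -> X -> V) : (forall i, fin_meas (f i)) ->
  fin_meas (fun x => \sum_(i < n) f i x).
Proof.
elim: n f => [|n ih] f hf.
  have -> : (fun x => \sum_(i < 0) f i x) = fun=> 0 by apply: funext => x; rewrite big_ord0.
  exact: fin_meas_cst.
have -> : (fun x => \sum_(i < n.+1) f i x) =
    fun x => \sum_(i < n) f (widen_ord (leqnSn n) i) x + f ord_max x.
  by apply: funext => x; rewrite big_ord_recr.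
by apply: (fin_meas_comp2 +%R) => //; apply: ih.
Qed.

Lemma fin_meas_mem (A : set X) : measurable A -> fin_meas (fun x => x \in A).
Proof.
move=> mA; split; first exact: (sub_finite_set (subsetT _)).
move=> B; have mT : measurable ((fun x => x \in A) @^-1` [set true]).
  by rewrite (_ : _ @^-1` _ = A)//; apply/seteqP; split=> x /=; [exact: set_mem|exact: mem_set].
have mF : measurable ((fun x => x \in A) @^-1` [set false]).
  rewrite (_ : _ @^-1` _ = ~` A); first exact: measurableC.
  by apply/seteqP; split=> x /=; [move=> h /mem_set; rewrite h|exact: memNset].
rewrite (_ : _ @^-1` B = (if pselect (B true) then (fun x => x \in A) @^-1` [set true] else set0) `|`
  (if pselect (B false) then (fun x => x \in A) @^-1` [set false] else set0)).
  by apply: measurableU; (case: pselect => ?; [by []|exact: measurable0]).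
apply/seteqP; split=> x /=.
  case E : (x \in A) => Bx; [left|right]; case: pselect => // _; exact: E.
by case=> /=; case: pselect => //= Bb ->.
Qed.

Lemma fin_meas_bounded {R : realType} {V : normedZmodType R[i]} (f : X -> V) : fin_meas f ->
  exists2 M : R, 0 < M & forall x, nrm (f x) <= M.
Proof.
move=> [ff _].
have [M hM] : exists M : R, forall v, range f v -> nrm v <= M.
  move/finite_seqP: ff => [s ->]; elim: s => [|v s [M hM]]; first by exists 0 => v; rewrite /= in_nil.
  exists (Num.max M (nrm v)) => w /=; rewrite inE => /orP[/eqP ->|/hM h].
    by rewrite le_max lexx orbT.
  by rewrite le_max h.
exists (Num.max M 1) => [|x]; first by rewrite lt_max ltr01 orbT.
by rewrite le_max hM//; exists x.
Qed.

End finite_valued.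

Section real_probability.
Context {R : realType} d (X : measurableType d) (mu : {measure set X -> \bar R}).
Hypothesis mu1 : mu setT = 1%E.
Implicit Types A B : set X.

Definition pr A : R := fine (mu A).

Lemma mu_le1 A : measurable A -> (mu A <= 1)%E.
Proof. by move=> mA; rewrite -mu1 le_measure ?inE. Qed.

Lemma prE A : measurable A -> (pr A)%:E = mu A.
Proof.
move=> mA; rewrite fineK// ge0_fin_numE//; apply: le_lt_trans (mu_le1 mA) _.
exact: ltry.
Qed.

Lemma pr_ge0 A : 0 <= pr A.
Proof. exact: fine_ge0. Qed.

Lemma pr_le A B : measurable A -> measurable B -> A `<=` B -> pr A <= pr B.
Proof. by move=> mA mB AB; rewrite -lee_fin !prE// le_measure ?inE. Qed.

Lemma prT : pr setT = 1.
Proof. by rewrite /pr mu1. Qed.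

Lemma pr_setC A : measurable A -> pr (~` A) = 1 - pr A.
Proof.
move=> mA; have mC : measurable (~` A) by exact: measurableC.
have : mu (A `|` ~` A) = (mu A + mu (~` A))%E.
  by apply: measureU => //; rewrite setICr.
rewrite setUv mu1 -!prE// -EFinD => -[->].
by rewrite addrAC subrr add0r.
Qed.

Lemma prU A B : measurable A -> measurable B -> pr (A `|` B) <= pr A + pr B.
Proof.
move=> mA mB; have mU : measurable (A `|` B) by exact: measurableU.
by rewrite -lee_fin EFinD !prE// measureU2.
Qed.

Lemma pr_disjU A B : measurable A -> measurable B -> A `&` B = set0 -> pr (A `|` B) = pr A + pr B.
Proof.
move=> mA mB AB; have mU : measurable (A `|` B) by exact: measurableU.
by apply: EFin_inj; rewrite EFinD !prE// measureU.
Qed.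

Lemma pr_bigsetU n (F : nat -> set X) (e : R) : (forall k, measurable (F k)) ->
  (forall k, (k < n)%N -> pr (F k) <= e) -> pr (\bigcup_(k in `I_n) F k) <= n%:R * e.
Proof.
move=> mF; elim: n => [|n ih] h.
  by rewrite II0 bigcup_set0 mul0r /pr measure0.
rewrite IIS bigcup_setU bigcup_set1 -natr1 mulrDl mul1r.
have mI : measurable (\bigcup_(k in `I_n) F k) by apply: bigcup_measurable.
apply: le_trans (prU mI (mF n)) _; rewrite lerD ?h// ih// => k kn; apply: h; exact: ltnW.
Qed.

Lemma pr_bigcup_le (F : nat -> set X) (c : R) : (forall k, measurable (F k)) ->
  (forall n, pr (\bigcup_(k in `I_n) F k) <= c) -> pr (\bigcup_k F k) <= c.
Proof.
move=> mF h; pose G n := \bigcup_(k in `I_n) F k.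
have mG n : measurable (G n) by apply: bigcup_measurable.
have GF : \bigcup_n G n = \bigcup_k F k.
  apply/seteqP; split=> x; first by move=> [n _ [k _ Fk]]; exists k.
  by move=> [k _ Fk]; exists k.+1 => //; exists k => //=.
have mU : measurable (\bigcup_k F k) by apply: bigcup_measurable.
rewrite -lee_fin prE// -GF.
have := @nondecreasing_cvg_mu _ _ _ mu G mG; rewrite GF => /(_ mU).
have nd : nondecreasing_seq G.
  move=> m n mn; apply/subsetPset => x [k km Fk]; exists k => //=; exact: leq_trans km mn.
move=> /(_ nd) cv; rewrite -(cvg_lim _ cv)//.
apply: lime_le; first by apply/cvg_ex; eexists; exact: cv.
by apply: nearW => n /=; rewrite -prE// lee_fin; exact: h.
Qed.

(** Quantitative Borel-Cantelli estimate: with halving bounds, finite unions are at most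
    [2 e m - 2 e (m + n)], which telescopes. *)
Lemma pr_geo_bigcup (F : nat -> set X) (e : nat -> R) m : (forall k, measurable (F k)) ->
  (forall k, pr (F k) <= e k) -> (forall k, 0 <= e k) -> (forall k, e k.+1 <= e k / 2) ->
  pr (\bigcup_(k in [set k | (m <= k)%N]) F k) <= 2 * e m.
Proof.
move=> mF h e0 eS.
rewrite (_ : \bigcup_(k in _) F k = \bigcup_k F (m + k)%N); last first.
  apply/seteqP; split=> x; last by move=> [k _ Fk]; exists (m + k)%N => //=; exact: leq_addr.
  by move=> [k /= mk Fk]; exists (k - m)%N => //; rewrite subnKC.
apply: pr_bigcup_le => // n.
suff : pr (\bigcup_(k in `I_n) F (m + k)%N) <= 2 * e m - 2 * e (m + n)%N.
  by have := e0 (m + n)%N; lra.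
elim: n => [|n ih]; first by rewrite II0 bigcup_set0 addn0 subrr /pr measure0.
rewrite IIS bigcup_setU bigcup_set1.
have mI : measurable (\bigcup_(k in `I_n) F (m + k)%N) by apply: bigcup_measurable.
apply: le_trans (prU mI (mF _)) _; rewrite addnS.
by have := h (m + n)%N; have := eS (m + n)%N; lra.
Qed.

Lemma pr_decreasing (F : nat -> set X) (e : R) : (forall n, measurable (F n)) ->
  (forall n, F n.+1 `<=` F n) -> mu (\bigcap_n F n) = 0%E -> 0 < e ->
  exists n, pr (F n) <= e.
Proof.
move=> mF dF F0 e0.
have mI : measurable (\bigcap_n F n) by apply: bigcapT_measurable.
have cv := @nonincreasing_cvg_mu _ _ _ mu F.
have F0oo : (mu (F 0%N) < +oo)%E by apply: le_lt_trans (mu_le1 (mF _)) _; exact: ltry.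
have ni : nonincreasing_seq F.
  apply/nonincreasing_seqP => n; apply/subsetPset; exact: dF.
have {}cv := cv F0oo mF mI ni; rewrite F0 in cv.
apply: contrapT => /forallNP h.
have : (e%:E <= 0)%E.
  rewrite -(cvg_lim _ cv)//; apply: lime_ge; first by apply/cvg_ex; eexists; exact: cv.
  by apply: nearW => n /=; rewrite -prE// lee_fin ltW// ltNge; apply/negP; exact: h.
by rewrite lee_fin leNgt e0.
Qed.

End real_probability.

(** * Separating an orbit segment by small intervals *)

Section cells.
Context {R : realType}.
Local Notation X := (measurableTypeR R).

(** Number of the interval of length [1 / (n+1)] containing [x]. The point [1] gets the number
    [n + 1], and points outside [[0, 1]] the dummy [0]. *)
Definition cell (n : nat) (x : R) : nat :=
  if (0 <= x <= 1) then Num.truncn (n.+1%:R * x) else 0%N.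

Lemma cellP n x : 0 <= x <= 1 -> (cell n x)%:R / n.+1%:R <= x < (cell n x).+1%:R / n.+1%:R.
Proof.
move=> x01; rewrite /cell x01; have /andP[x0 x1] := x01.
have : 0 <= n.+1%:R * x by rewrite mulr_ge0.
by move=> /truncn_itv; rewrite ler_pdivrMr ?ltr0n// ltr_pdivlMr ?ltr0n// ![x * _]mulrC.
Qed.

Lemma cell_eq n x k : 0 <= x <= 1 -> k%:R / n.+1%:R <= x < k.+1%:R / n.+1%:R -> cell n x = k.
Proof.
move=> x01; rewrite /cell x01 ler_pdivrMr ?ltr0n// ltr_pdivlMr ?ltr0n// ![x * _]mulrC => h.
exact: truncn_def.
Qed.

Lemma cell_near n x : 0 <= x <= 1 -> `|(cell n x)%:R / n.+1%:R - x| <= n.+1%:R^-1.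
Proof.
move=> /(@cellP n)/andP[h1 h2]; rewrite ler_norml; move: h2.
have n0 : 0 <= n.+1%:R^-1 :> R by rewrite invr_ge0.
move: h1 n0; move: (n.+1%:R^-1) (cell n x) => q k; rewrite -natr1 mulrDl mul1r => h1 n0 h2.
by apply/andP; split; lra.
Qed.

Lemma cell_sep n x y : 0 <= x <= 1 -> 0 <= y <= 1 -> n.+1%:R^-1 <= `|x - y| -> cell n x <> cell n y.
Proof.
move=> /(@cellP n)/andP[x1 x2] /(@cellP n)/andP[y1 y2] + e; apply/negP; rewrite -ltNge ltr_norml.
move: x1 x2 y1 y2; rewrite -e; move: (n.+1%:R^-1) (cell n x) => q k; rewrite -natr1 mulrDl mul1r => x1 x2 y1 y2.
by apply/andP; split; lra.
Qed.

Lemma fin_meas_cell n : fin_meas (cell n : X -> nat).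
Proof.
have bnd x : (cell n x < n.+2)%N.
  rewrite /cell; case: ifP => // /andP[x0 x1]; rewrite -(ltr_nat R).
  have : 0 <= n.+1%:R * x by rewrite mulr_ge0.
  move=> /truncn_itv /andP[h _]; apply: le_lt_trans h _; apply: (@le_lt_trans _ _ n.+1%:R).
    by rewrite ler_piMr.
  by rewrite ltr_nat.
split; first by apply: sub_finite_set (finite_II n.+2) => _ [x _ <-] /=; exact: bnd.
move=> B.
have mk k : measurable ((cell n : X -> nat) @^-1` [set k]).
  have m01 : measurable (`[0, 1]%classic : set X) by exact: measurable_itv.
  rewrite (_ : _ @^-1` _ = (`[0, 1]%classic `&` `[k%:R / n.+1%:R, k.+1%:R / n.+1%:R[%classic) `|`
    (if k == 0%N then ~` `[0, 1]%classic else set0)).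
    apply: measurableU; first by apply: measurableI => //; exact: measurable_itv.
    by case: ifP => _ //; exact: measurableC.
  apply/seteqP; split=> x /=.
    move=> <-; have [x01|x01] := boolP (0 <= x <= 1).
      by left; rewrite !in_itv /=; split=> //; exact: cellP.
    by right; rewrite /cell (negPf x01) eqxx /= in_itv /=; exact/negP.
  case=> [[]|]; first by rewrite !in_itv /= => x01 /cell_eq; exact.
  case: eqP => [->|//]; rewrite /= in_itv /= => /negP/negPf x01.
  by rewrite /cell x01.
rewrite (_ : _ @^-1` B = \bigcup_(k in B) ((cell n : X -> nat) @^-1` [set k])).
  by apply: bigcup_measurable.
by apply/seteqP; split=> x /=; [move=> Bx; exists (cell n x)|move=> [k Bk /= ->]].
Qed.

Section separation.
Variable lam : {measure set X -> \bar R}.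
Hypothesis lam1 : lam setT = 1%E.
Hypothesis lam01 : lam (~` `[0, 1]%classic) = 0%E.
Variable S : R -> R.
Hypothesis mS : forall B : set X, measurable B -> measurable (S @^-1` B : set X).
Hypothesis lamS : forall B : set X, measurable B -> lam (S @^-1` B) = lam B.
Hypothesis aperiodic : forall k, lam.-negligible [set x : X | iter k.+1 S x = x].

Lemma iter_measurable k (B : set X) : measurable B -> measurable (iter k S @^-1` B : set X).
Proof.
by elim: k B => [|k ih] B mB //; exact: (ih _ (mS mB)).
Qed.

Lemma iter_preserves k (B : set X) : measurable B -> lam (iter k S @^-1` B) = lam B.
Proof.
elim: k B => [|k ih] B mB //.
by rewrite -[LHS]/(lam (iter k S @^-1` (S @^-1` B))) ih ?lamS//; exact: mS.
Qed.

(** For almost every [x] the points [x, ..., S^L x] lie in [[0, 1]] and are distinct, by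
    aperiodicity; their least distance is positive, hence at least [1 / (n+1)] for large [n].
    Continuity of the measure makes one [n] valid off a set of measure at most [e]. *)
Lemma cells_separate (L n0 : nat) (e : R) : 0 < e -> exists n (W : set X), [/\ (n0 <= n)%N, measurable W,
  pr lam (~` W) <= e &
  forall x, W x -> 0 <= x <= 1 /\
    forall i j, (i < j)%N -> (j <= L)%N -> cell n (iter i S x) <> cell n (iter j S x)].
Proof.
move=> e0.
pose G n i j := [set x : X | n.+1%:R^-1 <= `|iter i S x - iter j S x|].
have m01 : measurable (`[0, 1]%classic : set X) by exact: measurable_itv.
pose U i := iter i S @^-1` (`[0, 1]%classic : set X).
have mI i : measurable (U i) by exact: iter_measurable.
have UE i y : U i y -> 0 <= iter i S y <= 1 by rewrite /U /preimage /= in_itv.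
have mG n i j : measurable (G n i j).
  have mit k : measurable_fun setT (iter k S : X -> R).
    by move=> _ B mB; rewrite setTI; exact: iter_measurable.
  have : measurable_fun setT (fun x : X => `|iter i S x - iter j S x|).
    by apply: measurableT_comp => //; apply: measurable_funB.
  move=> /(_ measurableT `[n.+1%:R^-1, +oo[%classic (measurable_itv _)).
  by rewrite setTI; congr measurable; apply/seteqP; split=> x /=; rewrite /G /= in_itv /= andbT.
pose T := [set ij : nat * nat | (ij.1 < ij.2)%N /\ (ij.2 <= L)%N].
(* Bad points at scale [n]: some iterate leaves [[0, 1]], or two iterates are closer than
   [1 / (n+1)]. These sets decrease to a null set. *)
pose F n := (\bigcup_(i in `I_L.+1) ~` U i) `|` \bigcup_(ij in T) ~` G n ij.1 ij.2.
have mF n : measurable (F n).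
  apply: measurableU; first by apply: bigcup_measurable => i _; exact: measurableC.
  apply: fin_bigcup_measurable; last by move=> ij _; apply: measurableC; exact: mG.
  apply: sub_finite_set (finite_setX (finite_II L.+1) (finite_II L.+1)).
  by move=> [i j] [/= ij jL]; split => /=; lia.
have dF n : F n.+1 `<=` F n.
  move=> x [h|[[i j] Tij /= h]]; [by left|right; exists (i, j) => //= Gn; apply: h].
  by apply: le_trans Gn; rewrite lef_pV2 ?posrE ?ltr0n// ler_nat.
have F0 : lam (\bigcap_n F n) = 0%E.
  have sub : \bigcap_n F n `<=` (\bigcup_i ~` U i) `|`
     \bigcup_i \bigcup_j (iter i S @^-1` [set x : X | iter j.+1 S x = x]).
    move=> x Fx; apply: contrapT => /not_orP[h1 h2].
    have x01 i : U i x by apply: contrapT => nI; apply: h1; exists i.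
    have hd i j : (i < j)%N -> 0 < `|iter i S x - iter j S x|.
      move=> ij; rewrite normr_gt0 subr_eq0; apply/eqP => e1; apply: h2.
      exists i => //; exists (j - i.+1)%N => //=.
      by rewrite -iterS -iterD (_ : ((j - i.+1).+1 + i)%N = j)//; lia.
    have [n hn] : exists n : nat, forall ij, T ij -> n.+1%:R^-1 <= `|iter ij.1 S x - iter ij.2 S x|.
      have fT : finite_set T.
        apply: sub_finite_set (finite_setX (finite_II L.+1) (finite_II L.+1)).
        by move=> [i j] [/= ij jL]; split => /=; lia.
      have [m m0 hm] : exists2 m : R, 0 < m & forall ij, T ij -> m <= `|iter ij.1 S x - iter ij.2 S x|.
        have : forall ij, T ij -> 0 < `|iter ij.1 S x - iter ij.2 S x| by move=> ij [+ _]; exact: hd.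
        move/finite_seqP: fT => [s ->]; elim: s => [|ij s ih] pos; first by exists 1.
        have [|m m0 hm] := ih; first by move=> kl kls; apply: pos; rewrite /= inE kls orbT.
        exists (Num.min m `|iter ij.1 S x - iter ij.2 S x|).
          by rewrite lt_min m0 pos//= mem_head.
        by move=> kl /=; rewrite inE => /orP[/eqP ->|/hm h]; rewrite ge_min ?lexx ?h ?orbT.
      have [N hN] := inv_nat_small m0; exists N => ij Tij.
      by apply: le_trans (hN N (leqnn _)) _; exact: hm.
    have [[i _ nI]|[ij Tij nG]] := Fx n I; first exact: nI (x01 i).
    by apply: nG; exact: hn.
  suff [N [mN N0 sN]] : lam.-negligible ((\bigcup_i ~` U i) `|`
      \bigcup_i \bigcup_j (iter i S @^-1` [set x : X | iter j.+1 S x = x])).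
    apply: (@subset_measure0 _ _ _ lam _ N) => //; first by apply: bigcapT_measurable.
    exact: subset_trans sub sN.
  apply: negligibleU.
    apply: negligible_bigcup => i; apply/negligibleP; first by apply: measurableC; exact: mI.
    by have := @iter_preserves i (~` `[0, 1]%classic) (measurableC m01); rewrite lam01.
  apply: negligible_bigcup => i; apply: negligible_bigcup => j.
  have [N [mN N0 sN]] := aperiodic j; exists (iter i S @^-1` N); split.
  - exact: iter_measurable.
  - by rewrite iter_preserves.
  - by move=> y /sN.
have [n1 hn1] := pr_decreasing lam1 mF dF F0 e0.
pose n := maxn n0 n1.
have hn : pr lam (F n) <= e.
  apply: le_trans (pr_le lam1 (mF _) (mF _) _) hn1; rewrite /n -(subnK (leq_maxr n0 n1)).
  by elim: (_ - _)%N => [//|k]; apply: subset_trans; rewrite addSn; exact: dF.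
exists n, (~` F n); split; [exact: leq_maxl|by apply: measurableC; exact: mF|by rewrite setCK|].
move=> x nF; split.
  by apply: (UE 0%N); apply: contrapT => nU; apply: nF; left; exists 0%N.
move=> i j ij jL; have xi k : (k <= L)%N -> 0 <= iter k S x <= 1.
  by move=> kL; apply: UE; apply: contrapT => nU; apply: nF; left; exists k => //=; rewrite ltnS.
apply: cell_sep; [exact/xi/(leq_trans (ltnW ij))|exact: xi|].
by apply: contrapT => nG; apply: nF; right; exists (i, j).
Qed.

End separation.
End cells.

(** * Factor maps *)

Section factor_map.
Context {R : realType} {V : completeNormedModType R[i]}.
Local Notation C := R[i].
Local Notation X := (measurableTypeR R).
Variables (A : V -> V) (z : int -> V) (xi : V -> C) (p : {poly C}).
Hypothesis orb : backward_orbit A z xi p.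
Hypothesis Alin : forall a x y, A (a *: x + y) = a *: A x + A y.
Variable cA : R.
Hypothesis cA0 : 0 <= cA.
Hypothesis Abound : forall x, nrm (A x) <= cA * nrm x.

Lemma to_lim_of_bounded {W : normedModType C} (L : V -> W) (c : R) (u : nat -> V) l :
  (forall a x y, L (a *: x + y) = a *: L x + L y) -> 0 <= c ->
  (forall x, nrm (L x) <= c * nrm x) -> to_lim u l -> to_lim (fun n => L (u n)) (L l).
Proof.
move=> Llin c0 Lb h e e0; have c1 : 0 < c + 1 by lra.
have [N hN] := h _ (divr_gt0 e0 c1); exists N => n /hN; rewrite ler_pdivlMr// => hn.
have -> : L (u n) - L l = L (u n - l).
  have := Llin (-1) l (u n); rewrite !scaleN1r => e1.
  by rewrite [LHS]addrC -e1 [- l + _]addrC.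
by apply: le_trans (Lb _) _; have := nrm_ge0 (u n - l); lra.
Qed.

Let A0 : A 0 = 0.
Proof. by have := Alin (-1) 0 0; rewrite scaler0 addr0 scaleN1r addNr. Qed.

Let AZ a x : A (a *: x) = a *: A x.
Proof. by have := Alin a x 0; rewrite A0 !addr0. Qed.

Let AD x y : A (x + y) = A x + A y.
Proof. by have := Alin 1 x y; rewrite !scale1r. Qed.

Lemma iter_lin m a x y : iter m A (a *: x + y) = a *: iter m A x + iter m A y.
Proof. by elim: m => //= m ->; rewrite Alin. Qed.

Lemma iter_bound m x : nrm (iter m A x) <= cA ^+ m * nrm x.
Proof.
elim: m => [|m ih]; first by rewrite expr0 mul1r.
by rewrite /= (le_trans (Abound _))// exprS -mulrA ler_wpM2l.
Qed.

Lemma bsum_shift {W : zmodType} N (F : int -> W) :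
  bsum N (fun n => F (n + 1)) = bsum N F + F (Posz N) - F (- Posz N).
Proof.
elim: N => [|N ih]; first by rewrite !bsum0 add0r oppr0 subrr.
rewrite !bsumS ih (_ : Posz N + 1 = Posz N.+1); last by lia.
rewrite (_ : Negz N + 1 = - Posz N); last by lia.
rewrite (_ : - Posz N.+1 = Negz N); last by lia.
have alg (b a c d e : W) : b + a - c + (d + c) = b + (a + e) + d - e.
  by rewrite [d + c]addrC addrA subrK [RHS]addrAC [b + (a + e)]addrA addrK.
exact: alg.
Qed.

Variable tau : int -> R -> R.

(* [tau n] stands for the power [S^n], and [phi f x] for the sum of the series
   of the [f (S^n x) *: z n].  When [S] has no inverse, [tau n] is a dummy for
   [n < 0], where [z n = 0]; the indices with a genuine [tau n] are called [good]. *)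
Definition phi_sum (f : R -> C) (N : nat) (x : R) : V := bsum N (fun n => f (tau n x) *: z n).

Definition phi (f : R -> C) (x : R) : V :=
  xget 0 [set l | to_lim (fun N => phi_sum f N x) l].

Lemma phi_sum_diff f (M : R) m N x : (forall y, nrm (f y) <= M) -> (m <= N)%N ->
  nrm (phi_sum f N x - phi_sum f m x) <= M * (bsum N (nrm \o z) - bsum m (nrm \o z)).
Proof.
move=> fM /subnKC <-; elim: (N - m)%N => [|k ih]; first by rewrite addn0 !subrr nrm0 mulr0.
rewrite addnS /phi_sum !bsumS addrAC; apply: le_trans (nrmD _ _) _.
rewrite [in leRHS]addrAC [leRHS]mulrDr lerD//.
apply: le_trans (nrmD _ _) _; rewrite !nrmZ mulrDr lerD//; apply: ler_wpM2r => //; exact: nrm_ge0.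
Qed.

Lemma orbit_tail (e : R) : 0 < e -> exists m, forall N, (m <= N)%N ->
  bsum N (nrm \o z) - bsum m (nrm \o z) <= e.
Proof.
move=> e0; have [B hB] := orbit_summable orb.
pose U := range (fun N => bsum N (nrm \o z)).
have U0 : has_sup U by split; [exists (bsum 0 (nrm \o z)); exists 0%N|exists B => _ [N _ <-]].
have [_ [m _ <-] hm] := sup_adherent e0 U0; exists m => N mN.
have : bsum N (nrm \o z) <= sup U by apply: ub_le_sup; [exact: U0.2|exists N].
by lra.
Qed.

Lemma phi_lim f (M : R) x : (forall y, nrm (f y) <= M) ->
  to_lim (fun N => phi_sum f N x) (phi f x).
Proof.
move=> fM; suff : exists l, to_lim (fun N => phi_sum f N x) l.
  by move=> [l hl]; rewrite /phi; case: xgetP => [l' _ //|/(_ l)]; exact.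
apply: to_lim_complete => e e0.
have M0 : 0 <= M by apply: le_trans (fM 0); exact: nrm_ge0.
have M1 : 0 < 2 * (M + 1) by lra.
have [m hm] := orbit_tail (divr_gt0 e0 M1); exists m.
have near N : (m <= N)%N -> nrm (phi_sum f N x - phi_sum f m x) <= e / 2.
  move=> mN; apply: le_trans (phi_sum_diff x fM mN) _.
  apply: le_trans (ler_wpM2l M0 (hm N mN)) _.
  rewrite mulrA ler_pdivrMr//; nra.
move=> N N' /near h /near h'; have := nrm_tri (phi_sum f m x) (phi_sum f N x) (phi_sum f N' x).
by rewrite (nrm_sub (phi_sum f m x)); lra.
Qed.

Lemma phi_tail f (M e : R) m x : (forall y, nrm (f y) <= M) ->
  (forall N, (m <= N)%N -> bsum N (nrm \o z) - bsum m (nrm \o z) <= e) ->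
  nrm (phi f x - phi_sum f m x) <= M * e.
Proof.
move=> fM hm; apply: to_lim_nrm_sub_le (phi_lim x fM) _ => k.
exists (maxn k m); first exact: leq_maxl.
apply: le_trans (phi_sum_diff x fM (leq_maxr _ _)) _.
by rewrite ler_wpM2l ?hm ?leq_maxr//; apply: le_trans (fM 0); exact: nrm_ge0.
Qed.

Lemma phi_sup_le (B M d : R) f g x : (forall N, bsum N (nrm \o z) <= B) ->
  (forall y, nrm (f y) <= M) -> (forall y, nrm (g y) <= M) ->
  (forall y, nrm (f y - g y) <= d) -> nrm (phi f x - phi g x) <= d * B.
Proof.
move=> hB fM gM fg; apply: to_lim_nrm_le (to_limB (phi_lim x fM) (phi_lim x gM)) _ => k.
exists k => //; rewrite -bsumB; apply: le_trans (nrm_bsum _ _) _.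
have d0 : 0 <= d by apply: le_trans (fg 0); exact: nrm_ge0.
apply: (@le_trans _ _ (d * bsum k (nrm \o z))); last by rewrite ler_wpM2l.
rewrite /bsum mulr_sumr; apply: ler_sum => i _; rewrite mulrDr lerD//=;
  by rewrite -scalerBl nrmZ ler_wpM2r ?nrm_ge0.
Qed.

Lemma eq_phi_sum f g N x : (forall k : nat, (k < N)%N ->
    f (tau k x) = g (tau k x) /\ f (tau (Negz k) x) = g (tau (Negz k) x)) ->
  phi_sum f N x = phi_sum g N x.
Proof. by move=> h; apply: eq_bigr => i _; have [-> ->] := h i (ltn_ord i). Qed.

Hypothesis tau_pos : forall (k : nat) x, tau k x = iter k (tau 1) x.
Local Notation S := (tau 1).

Lemma iter_orbit m n : iter m A (z n) = z (n - Posz m).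
Proof.
elim: m n => [|m ih] n; first by rewrite subr0.
by rewrite iterSr (orbit_shift orb) ih; congr z; lia.
Qed.

(** [A^m] sends [z n] to [z (n - m)], and [xi] kills [z n] unless [0 <= n < size p]. Only the times
    from [m] to [m + size p - 1] survive, and the partial sums are constant from [m + size p] on. *)
Lemma xi_phi f (M : R) m x : (forall y, nrm (f y) <= M) ->
  xi (iter m A (phi f x)) = \sum_(j < size p) p`_j * f (iter (m + j) S x).
Proof.
move=> fM; have x0 : xi 0 = 0 by have := orbit_lin orb (-1) 0 0; rewrite scaler0 addr0 mulN1r addNr.
pose L y : C^o := xi (iter m A y).
have Llin a u v : L (a *: u + v) = a *: L u + L v.
  by rewrite /L iter_lin (orbit_lin orb).
have Lb y : nrm (L y) <= 2 * cA ^+ m * nrm y.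
  by apply: le_trans (orbit_bound orb _) _; rewrite -mulrA ler_wpM2l// iter_bound.
have c0 : 0 <= 2 * cA ^+ m by rewrite mulr_ge0// exprn_ge0.
have lim := to_lim_of_bounded Llin c0 Lb (phi_lim x fM).
apply: (to_lim_uniq lim); apply: (@to_lim_near _ _ (fun=> \sum_(j < size p) p`_j * f (iter (m + j) S x)) _ _ (m + size p)%N); last exact: to_lim_cst.
move=> N hN; rewrite /L /phi_sum.
have L0 : L 0 = 0 by have := Llin (-1) 0 0; rewrite scaler0 addr0 scaleN1r addNr.
have LZ a u : L (a *: u) = a * L u by have := Llin a u 0; rewrite L0 !addr0.
have LD u v : L (u + v) = L u + L v by have := Llin 1 u v; rewrite !scale1r.
have -> : xi (iter m A (bsum N (fun n => f (tau n x) *: z n))) =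
    bsum N (fun n => f (tau n x) * xi (z (n - Posz m))).
  rewrite -/(L _) /bsum; elim: N {hN} => [|N ih]; first by rewrite !big_ord0.
  by rewrite !big_ord_recr /= LD ih LD !LZ /L !iter_orbit.
have neg n : n < 0 -> xi (z n) = 0 by case: n => // n _; exact: orbit_neg orb n.
have -> : bsum N (fun n => f (tau n x) * xi (z (n - Posz m))) =
    \sum_(k < N) f (iter k S x) * xi (z (Posz k - Posz m)).
  by apply: eq_bigr => k _; rewrite tau_pos [X in _ + X](_ : _ = 0) ?addr0// neg ?mulr0//; lia.
rewrite -(subnKC hN) -addnA big_split_ord /= [X in X + _]big1 ?add0r; last first.
  by move=> i _; rewrite neg ?mulr0// subr_lt0 ltz_nat.
rewrite big_split_ord /= [X in _ + X]big1 ?addr0; last first.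
  move=> i _; rewrite (_ : Posz (m + (size p + i)) - Posz m = (size p + i)%N); last by lia.
  by rewrite (orbit_pos orb) nth_default ?mulr0// leq_addr.
apply: eq_bigr => i _; rewrite (_ : Posz (m + i) - Posz m = i); last by lia.
by rewrite (orbit_pos orb) mulrC.
Qed.

Section equivariance.
Variable lam : {measure set X -> \bar R}.
Variable good : int -> Prop.
Hypothesis z_good : forall n, ~ good n -> z n = 0.
Hypothesis tau_S : forall n, good n -> lam.-negligible [set x : X | tau n (S x) <> tau (n + 1) x].

Lemma orbit_cvg0 (e : R) : 0 < e -> exists m, forall k, (m <= k)%N ->
  nrm (z (Posz k)) <= e /\ nrm (z (Negz k)) <= e.
Proof.
move=> /orbit_tail[m hm]; exists m => k mk.
have := hm k.+1 (leqW mk); rewrite bsumS /=.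
have := le_bsum_widen mk (fun n => nrm_ge0 (z n)).
by have := nrm_ge0 (z k); have := nrm_ge0 (z (Negz k)); rewrite /comp; split; lra.
Qed.

(** On partial sums, replacing [x] by [S x] and applying [A] differ by two boundary terms only,
    which vanish in the limit because [z n] tends to [0] in both directions. *)
Lemma phi_equivariant f (M : R) : (forall y, nrm (f y) <= M) ->
  lam.-negligible [set x : X | phi f (S x) <> A (phi f x)].
Proof.
move=> fM; have neg : lam.-negligible (\bigcup_k ([set x : X | good (Posz k) /\ tau k (S x) <> tau (Posz k + 1) x] `|`
    [set x : X | good (Negz k) /\ tau (Negz k) (S x) <> tau (Negz k + 1) x])).
  apply: negligible_bigcup => k; apply: negligibleU.
    have [g|ng] := pselect (good (Posz k)); first by apply: negligibleS (tau_S g) => x [].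
    by apply: negligibleS (negligible_set0 _) => x [].
  have [g|ng] := pselect (good (Negz k)); first by apply: negligibleS (tau_S g) => x [].
  by apply: negligibleS (negligible_set0 _) => x [].
apply: negligibleS neg => x nx; apply: contrapT => h; apply: nx.
have hx n : f (tau n (S x)) *: z n = f (tau (n + 1) x) *: z n.
  have [g|/z_good ->] := pselect (good n); last by rewrite !scaler0.
  congr (f _ *: _); apply: contrapT => ne; apply: h.
  by case: n g ne => k g ne; exists k => //; [left|right].
have M0 : 0 <= M by apply: le_trans (fM 0); exact: nrm_ge0.
have lim := to_lim_of_bounded Alin cA0 Abound (phi_lim x fM).
apply: to_lim_uniq (phi_lim (S x) fM) _.
pose F n := f (tau n x) *: z (n - 1).
have Asum N : A (phi_sum f N x) = bsum N F.
  rewrite /phi_sum /bsum; elim: N => [|N ih]; first by rewrite !big_ord0.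
  by rewrite !big_ord_recr /= !AD ih !AZ !(orbit_shift orb).
have Ssum N : phi_sum f N (S x) = A (phi_sum f N x) + F (Posz N) - F (- Posz N).
  rewrite Asum -bsum_shift; apply: eq_bsum => n.
  by rewrite hx /F addrK.
have F0 : to_lim (fun N => F (Posz N) - F (- Posz N)) 0.
  move=> e e0; have M1 : 0 < 2 * (M + 1) by lra.
  have [m hm] := orbit_cvg0 (divr_gt0 e0 M1); exists m.+1 => -[//|N] mN; rewrite subr0.
  apply: le_trans (nrmB _ _) _; rewrite /F !nrmZ.
  rewrite (_ : Posz N.+1 - 1 = Posz N); last by lia.
  rewrite (_ : - Posz N.+1 - 1 = Negz N.+1); last by lia.
  have [h1 _] := hm N mN; have [_ h2] := hm N.+1 (leqW mN).
  have t1 : nrm (f (tau N.+1 x)) * nrm (z N) <= M * (e / (2 * (M + 1))).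
    by rewrite ler_pM ?nrm_ge0.
  have t2 : nrm (f (tau (- Posz N.+1) x)) * nrm (z (Negz N.+1)) <= M * (e / (2 * (M + 1))).
    by rewrite ler_pM ?nrm_ge0.
  have : M * (e / (2 * (M + 1))) <= e / 2 by rewrite mulrA ler_pdivrMr//; nra.
  lra.
rewrite -[A _]addr0; apply: eq_to_lim (to_limD lim F0) => N.
by rewrite Ssum addrA.
Qed.

End equivariance.
End factor_map.

(** * Generic values attached to labels *)

Section generic_values.
Context {R : realType}.
Local Notation C := R[i].

Lemma exists_small_nonroot (Q : {poly C}) (d : R) : Q != 0 -> 0 < d ->
  exists2 t : R, 0 < t <= d & Q.[t%:C%C] != 0.
Proof.
move=> Q0 d0; pose t k : R := d / k.+1%:R.
have t0 k : 0 < t k <= d.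
  by rewrite divr_gt0//= ?ltr0n// ler_pdivrMr ?ltr0n// ler_peMr ?ler1n//; exact: ltW.
have tinj : injective (fun k => (t k)%:C%C).
  move=> k l /complexI /(mulfI (lt0r_neq0 d0)) /invr_inj /eqP; rewrite eqr_nat => /eqP.
  by case.
apply: contrapT => h.
have rt : all (root Q) [seq (t k)%:C%C | k <- iota 0 (size Q)].
  apply/allP => _ /mapP[k _ ->]; apply: contrapT => nr; apply: h.
  by exists (t k) => //; apply/negP.
have := max_poly_roots Q0 rt; rewrite map_inj_uniq// iota_uniq => /(_ isT).
by rewrite size_map size_iota ltnn.
Qed.

(* Windows of pairwise distinct labels are told apart, as far as their first
   label is concerned, by the convolutions with [p] at times [0, ..., size p - 1]:
   if [a 0 = b j] with [j > 0], then [a 0] no longer occurs in [a] after time [j],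
   while it still contributes [p`_0] to the convolution of [b]. *)
Lemma exists_separating_values (p : {poly C}) (K L : nat) (v : 'I_K -> C) (d : R) :
  p`_0 != 0 -> (2 * size p <= L.+1)%N -> 0 < d ->
  exists c : 'I_K -> C, (forall l, nrm (c l - v l) <= d) /\
    forall a b : {ffun 'I_L.+1 -> 'I_K}, injective a -> injective b -> a ord0 != b ord0 ->
    exists2 m, (m < size p)%N &
      \sum_(j < size p) p`_j * c (a (inord (m + j))) !=
      \sum_(j < size p) p`_j * c (b (inord (m + j))).
Proof.
move=> p0 hL d0; set q := size p in hL *.
(* Label [l] is perturbed by [t^(l+1)], with a parameter [t] common to all labels: the coefficient
   of [t^(l+1)] in a convolution then isolates the occurrences of [l], and the exponent is positive
   so that the [v l] do not interfere. *)
pose P (l : 'I_K) : {poly C} := (v l)%:P + 'X^(l.+1).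
pose Q (a b : {ffun 'I_L.+1 -> 'I_K}) (m : 'I_q) : {poly C} :=
  \sum_(j < q) p`_j *: (P (a (inord (m + j))) - P (b (inord (m + j)))).
pose T := ({ffun 'I_L.+1 -> 'I_K} * {ffun 'I_L.+1 -> 'I_K} * 'I_q)%type.
(* Vanishing differences are replaced by 1, so that the product is a non-zero polynomial; a small
   [t] that is not one of its roots serves all pairs of windows at once. *)
pose F (x : T) := if Q x.1.1 x.1.2 x.2 == 0 then 1 else Q x.1.1 x.1.2 x.2.
have F0 : \prod_(x : T) F x != 0.
  by apply/prodf_neq0 => x _; rewrite /F; case: ifPn => // _; rewrite oner_eq0.
have d1 : 0 < Num.min d 1 by rewrite lt_min d0 ltr01.
have [t /andP[t0 td] ht] := exists_small_nonroot F0 d1.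
exists (fun l => (P l).[t%:C%C]); split.
  move=> l; rewrite /P hornerD hornerC hornerXn addrAC subrr add0r nrmX nrmR gtr0_norm//.
  have : t <= d by apply: le_trans td _; rewrite ge_min lexx.
  apply: le_trans; rewrite exprS ler_piMr//; first exact: ltW.
  by rewrite exprn_ile1//; [exact: ltW|apply: le_trans td _; rewrite ge_min lexx orbT].
move=> a b ainj binj ab.
suff [m Qm] : exists m, Q a b m != 0.
  exists m => //; rewrite -subr_eq0 -sumrB.
  have -> : \sum_(j < q) (p`_j * (P (a (inord (m + j)))).[t%:C%C] - p`_j * (P (b (inord (m + j)))).[t%:C%C]) =
      (Q a b m).[t%:C%C].
    rewrite /Q horner_sum; apply: eq_bigr => j _.
    by rewrite hornerZ hornerD hornerN mulrBr.
  move: ht; rewrite horner_prod => /prodf_neq0 /(_ (a, b, m) isT).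
  by rewrite /F /= (negPf Qm).
have coefQ m l : (Q a b m)`_l.+1 = \sum_(j < q) p`_j * ((a (inord (m + j)) == l :> nat)%:R - (b (inord (m + j)) == l :> nat)%:R).
  rewrite coef_sum; apply: eq_bigr => j _.
  by rewrite coefZ coefB /P !coefD !coefC !coefXn /= !add0r !eqSS ![l == _]eq_sym.
have q0 : (0 < q)%N by rewrite lt0n size_poly_eq0; apply: contraNneq p0 => ->; rewrite coef0.
have ordL (i j : nat) : (i < q)%N -> (j < q)%N -> (i + j < L.+1)%N.
  by move=> iq jq; apply: leq_trans hL; rewrite mul2n -addnn -addSn leq_add// ltnW.
have inordE (i j k l : nat) : (i < q)%N -> (j < q)%N -> (k < q)%N -> (l < q)%N ->
    (inord (i + j) == inord (k + l) :> 'I_L.+1) = ((i + j)%N == (k + l)%N).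
  by move=> *; rewrite -val_eqE /= !inordK ?ordL.
apply: contrapT => /forallNP Q0.
have {}Q0 m : Q a b m = 0 by apply/eqP; apply: contrapT => /negP; exact: Q0.
pose l := a ord0; pose m0 := Ordinal q0.
have o0 : ord0 = inord (0 + 0) :> 'I_L.+1 by apply: val_inj; rewrite /= inordK.
(* By injectivity, the label [l] of position 0 occurs in the window [a] at position 0 only. *)
have aE (m j : 'I_q) : (a (inord (m + j)) == l :> nat) = ((m + j)%N == 0%N).
  by rewrite val_eqE /l (inj_eq ainj) o0 inordE.
have sel (k : 'I_q) (u : nat -> bool) : (forall j : 'I_q, u j = (j == k)) ->
    \sum_(j < q) p`_j * (u j)%:R = p`_k.
  move=> hu; rewrite (bigD1 k) //= hu eqxx mulr1 big1 ?addr0// => j jk.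
  by rewrite hu (negPf jk) mulr0.
have sum_b (m : 'I_q) : \sum_(j < q) p`_j * (b (inord (m + j)) == l :> nat)%:R =
    \sum_(j < q) p`_j * (a (inord (m + j)) == l :> nat)%:R.
  apply/eqP; rewrite eq_sym -subr_eq0 -sumrB; apply/eqP.
  transitivity ((Q a b m)`_l.+1); last by rewrite Q0 coef0.
  by rewrite coefQ; apply: eq_bigr => j _; rewrite mulrBr.
have sum_a0 : \sum_(j < q) p`_j * (a (inord (m0 + j)) == l :> nat)%:R = p`_0.
  by apply: (sel m0 (fun j => a (inord (m0 + j)) == l :> nat)) => j; rewrite [LHS](aE m0 j).
have [j0 bj0] : exists j0 : 'I_q, b (inord (m0 + j0)) == l :> nat.
  apply: contrapT => /forallNP nb.
  have s0 : \sum_(j < q) p`_j * (b (inord (m0 + j)) == l :> nat)%:R = 0.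
    by apply: big1 => j _; have /negP/negPf -> := nb j; rewrite mulr0.
  by move: p0; rewrite -sum_a0 -sum_b s0 eqxx.
have j00 : (0 < j0)%N.
  rewrite lt0n; apply: contraNneq ab => j00.
  have j0m : j0 = m0 by apply: val_inj.
  have e : b ord0 == l :> nat by move: bj0; rewrite j0m o0.
  by rewrite eq_sym; exact: e.
have s1 : \sum_(j < q) p`_j * (a (inord (j0 + j)) == l :> nat)%:R = 0.
  by apply: big1 => j _; rewrite aE addn_eq0 eqn0Ngt j00 mulr0.
have s2 : \sum_(j < q) p`_j * (b (inord (j0 + j)) == l :> nat)%:R = p`_0.
  apply: (sel m0 (fun j => b (inord (j0 + j)) == l :> nat)) => j.
  rewrite -(eqP bj0) val_eqE (inj_eq binj).
  have -> : inord (m0 + j0) = inord (j0 + m0) :> 'I_L.+1 by rewrite addnC.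
  by rewrite inordE// eqn_add2l.
by move: p0; rewrite -s2 sum_b s1 eqxx.
Qed.

End generic_values.

Lemma fin_meas_family d (Y : measurableType d) (T : finType) (O : T -> set Y) :
  (forall a, measurable (O a)) -> fin_meas (fun y => [ffun a => y \in O a]).
Proof.
move=> mO; split; first exact: finite_finset.
move=> B; pose P (s : {ffun T -> bool}) a := if s a then O a else ~` O a.
rewrite (_ : _ @^-1` B = \bigcup_(s in B) \bigcap_(a in setT) P s a).
  apply: fin_bigcup_measurable; first exact: finite_finset.
  move=> s _; apply: fin_bigcap_measurable => [|a _]; first exact: finite_finset.
  by rewrite /P; case: ifP => _ //; apply: measurableC.
apply/seteqP; split=> y /=.
  move=> By; exists [ffun a => y \in O a] => // a _; rewrite /P ffunE.
  by case: ifPn => [/set_mem//|/negP h /mem_set].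
move=> [s Bs h]; suff -> : [ffun a => y \in O a] = s by [].
apply/ffunP => a; rewrite ffunE; have := h a Logic.I; rewrite /P.
by case: (s a) => h'; [exact: mem_set h'|exact: memNset h'].
Qed.

Lemma open_borel (T : ptopologicalType) (U : set T) : open U -> measurable (U : set (borel T)).
Proof. by move=> oU; apply: sub_sigma_algebra. Qed.

Section decoding.
Context {R : realType} {V : completeNormedModType R[i]}.
Local Notation C := R[i].
Local Notation X := (measurableTypeR R).
Variables (A : V -> V) (z : int -> V) (xi : V -> C) (p : {poly C}).
Hypothesis orb : backward_orbit A z xi p.
Hypothesis Alin : forall a x y, A (a *: x + y) = a *: A x + A y.
Variable cA : R.
Hypothesis cA0 : 0 <= cA.
Hypothesis Abound : forall x, nrm (A x) <= cA * nrm x.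
Variable tau : int -> R -> R.
Hypothesis tau_pos : forall (k : nat) x, tau k x = iter k (tau 1) x.
Local Notation S := (tau 1).
Variable lam : {measure set X -> \bar R}.
Hypothesis lam1 : lam setT = 1%E.
Hypothesis lam01 : lam (~` `[0, 1]%classic) = 0%E.
Hypothesis mtau : forall n (B : set X), measurable B -> measurable (tau n @^-1` B : set X).
Hypothesis lam_tau : forall n (B : set X), measurable B -> lam (tau n @^-1` B) = lam B.
Hypothesis aperiodic : forall k, lam.-negligible [set x : X | iter k.+1 S x = x].

Local Notation phi := (phi z tau).

Lemma xi_iter_diff m u v : nrm (xi (iter m A u) - xi (iter m A v)) <= 2 * cA ^+ m * nrm (u - v).
Proof.
have -> : xi (iter m A u) - xi (iter m A v) = xi (iter m A (u - v)).
  have -> : u - v = -1 *: v + u by rewrite scaleN1r addrC.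
  by rewrite (iter_lin Alin) (orbit_lin orb) mulN1r addrC.
apply: le_trans (orbit_bound orb _) _; rewrite -mulrA ler_wpM2l//.
exact: iter_bound.
Qed.

(* [g] is a perturbation of [f] whose values are generic functions of the pair
   (cell of [x], [f x]); the numbers [xi (A^m y)] for [m < size p] then determine
   the cell of [x] when [y] is close to [phi g x]. *)
Lemma decode_step (f : R -> C) (d e : R) : fin_meas (f : X -> C) -> 0 < d -> 0 < e ->
  exists (g : R -> C) (h : V -> R) (r : R) (E : set X),
    [/\ fin_meas (g : X -> C), forall x, nrm (phi g x - phi f x) <= d,
        fin_meas (h : borel V -> R) & 0 < r] /\
    [/\ measurable E, pr lam E <= e &
     forall x, ~ E x -> forall y, nrm (y - phi g x) <= r -> `|h y - x| <= e].
Proof.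
move=> ff d0 e0; have [Mf Mf0 fM] := fin_meas_bounded ff.
have [B hB] := orbit_summable orb; have B0 : 0 <= B by have := hB 0%N; rewrite bsum0.
have B1 : 0 < B + 1 by lra.
have q0 : (0 < size p)%N.
  by rewrite lt0n size_poly_eq0; apply: contraNneq (orbit_coef0 orb) => ->; rewrite coef0.
(* A window has [2 q] entries, enough for every position [m + j] with [m, j < q]. *)
set q := size p in q0; pose L := (2 * q).-1.
have LE : L.+1 = (2 * q)%N by rewrite /L prednK// muln_gt0.
have [n0 hn0] := inv_nat_small e0.
have [n [W [nn0 mW We sepW]]] := cells_separate lam1 lam01 (mtau 1) (lam_tau 1) aperiodic L n0 e0.
pose lb x : nat * C := (cell n x, f x).
have flb : fin_meas (lb : X -> nat * C) by apply: fin_meas_pair => //; exact: fin_meas_cell.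
have [s hs] : exists s : seq (nat * C), range (lb : X -> nat * C) = [set` s] by apply/finite_seqP; exact: flb.1.
have lbs x : lb x \in s by have : range (lb : X -> nat * C) (lb x) by [exists x]; rewrite hs.
have s0 : (0 < size s)%N by case: (s) (lbs 0).
pose K := (size s).-1; have KE : K.+1 = size s by rewrite /K prednK.
pose lab x : 'I_K.+1 := inord (index (lb x) s).
have lab_lb x : nth (0%N, 0) s (lab x) = lb x.
  by rewrite /lab inordK ?KE ?index_mem// nth_index.
pose v (l : 'I_K.+1) : C := (nth (0%N, 0) s l).2.
(* The first bound keeps [g] below [Mf + 1]; the second, with [B] bounding the sum of the norms of
   the [z n], keeps [phi g] within [d] of [phi f]. *)
pose dd := Num.min 1 (d / (B + 1)).
have dd0 : 0 < dd by rewrite lt_min ltr01 divr_gt0.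
have [c [cv csep]] := @exists_separating_values R p K.+1 L v dd (orbit_coef0 orb) (eq_leq (esym LE)) dd0.
pose g x : C := c (lab x).
have flab : fin_meas (lab : X -> 'I_K.+1) by exact: (fin_meas_comp (fun l => inord (index l s)) flb).
have fg : fin_meas (g : X -> C) by exact: (fin_meas_comp c flab).
have fE x : f x = v (lab x) by rewrite /v lab_lb.
have gf x : nrm (g x - f x) <= dd by rewrite fE; exact: cv.
have gM x : nrm (g x) <= Mf + 1.
  have := nrm_le_sub (g x) (f x); have := gf x; have := fM x.
  have : dd <= 1 by rewrite ge_min lexx.
  lra.
have fM1 x : nrm (f x) <= Mf + 1 by have := fM x; lra.
pose T := {ffun 'I_L.+1 -> 'I_K.+1}.
pose val (a : T) (m : nat) : C := \sum_(j < q) p`_j * c (a (inord (m + j))).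
(* There are finitely many pairs of windows, so the gap between their readings is uniform. *)
have [r0 r00 hr0] : exists2 r0 : R, 0 < r0 & forall a b : T, injective a -> injective b -> a ord0 != b ord0 ->
    exists2 m, (m < q)%N & r0 <= nrm (val a m - val b m).
  have : forall ab : T * T, exists2 r : R, 0 < r & (injective ab.1 -> injective ab.2 -> ab.1 ord0 != ab.2 ord0 ->
    exists2 m, (m < q)%N & r <= nrm (val ab.1 m - val ab.2 m)).
    move=> [a b]; have [[ia [ib ab]]|nab] := pselect (injective a /\ injective b /\ a ord0 != b ord0).
      have [m mq hm] := csep a b ia ib ab; exists (nrm (val a m - val b m)); last by exists m.
      by rewrite nrm_gt0// subr_eq0.
    by exists 1 => // ia ib ab; case: nab.
  move=> h.
  have : exists2 r0 : R, 0 < r0 & forall ab, ab \in enum {: T * T} -> injective ab.1 -> injective ab.2 -> ab.1 ord0 != ab.2 ord0 ->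
    exists2 m, (m < q)%N & r0 <= nrm (val ab.1 m - val ab.2 m).
    elim: (enum _) => [|x l [r r1 hr]]; first by exists 1.
    have [r' r'0 hr'] := h x; exists (Num.min r r'); first by rewrite lt_min r1.
    move=> ab; rewrite inE => /orP[/eqP ->|abl] i1 i2 i3.
      by have [m mq hm] := hr' i1 i2 i3; exists m => //; rewrite ge_min hm orbT.
    by have [m mq hm] := hr ab abl i1 i2 i3; exists m => //; rewrite ge_min hm.
  by move=> [r0 r00 hr0]; exists r0 => // a b; apply: (hr0 (a, b)); rewrite mem_enum.
pose O (a : T) : set (borel V) := [set y | forall m : 'I_q, nrm (xi (iter m A y) - val a m) < r0 / 2].
have mO a : measurable (O a).
  rewrite (_ : O a = \bigcap_(m in [set: 'I_q]) [set y | nrm (xi (iter m A y) - val a m) < r0 / 2]).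
    apply: fin_bigcap_measurable => [|m _]; first exact: finite_finset.
    apply: open_borel.
    rewrite openE => y /= hy; apply/nbhs_nrm.
    pose k := 2 * cA ^+ m + 1; have k0 : 0 < k by rewrite ltr_wpDl// mulr_ge0// exprn_ge0.
    exists ((r0 / 2 - nrm (xi (iter m A y) - val a m)) / k).
      by rewrite divr_gt0// subr_gt0.
    move=> y'; rewrite ltr_pdivlMr// => hy' /=.
    have := nrm_tri (xi (iter m A y)) (xi (iter m A y')) (val a m).
    have := xi_iter_diff m y' y; have := nrm_ge0 (y' - y).
    by move: hy'; rewrite /k; move: (nrm (y' - y)) (2 * cA ^+ m) => t t'; nra.
  by apply/seteqP; split=> y; [move=> h m _; exact: h|move=> h m; exact: h].
pose key y := [ffun a => y \in O a].
(* Any injective window compatible with the readings of [y] will do, since compatible injective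
   windows share their first label; the output is the left end of the cell of this label, and [0]
   when no window is compatible. *)
pose H (w : {ffun T -> bool}) : R := if [pick a : T | injectiveb a && w a] is Some a
  then (nth (0%N, 0) s (a ord0)).1%:R / n.+1%:R else 0.
pose h y := H (key y).
pose w x : T := [ffun i : 'I_L.+1 => lab (iter i S x)].
have mjL (m j : 'I_q) : (m + j < L.+1)%N.
  rewrite LE; have := ltn_ord m; have := ltn_ord j.
  by move: (nat_of_ord m) (nat_of_ord j) => i k; lia.
(* The reading at time [m] is Lipschitz with constant [2 cA^m]; within [r], all [q] readings move by
   less than [r0 / 2]. *)
pose r := r0 / 2 / (1 + \sum_(m < q) 2 * cA ^+ m).
have Sge0 : 0 <= \sum_(m < q) 2 * cA ^+ m by apply: sumr_ge0 => m _; rewrite mulr_ge0// exprn_ge0.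
have r_gt0 : 0 < r by rewrite divr_gt0 ?divr_gt0//; lra.
have near x y : nrm (y - phi g x) <= r -> O (w x) y.
  move=> yr m; have e1 : val (w x) m = xi (iter m A (phi g x)).
    rewrite (xi_phi orb Alin cA0 Abound tau_pos m x gM); apply: eq_bigr => j _.
    by rewrite /g /w ffunE inordK// mjL.
  rewrite e1; apply: le_lt_trans (xi_iter_diff _ _ _) _.
  have c0 : 0 <= 2 * cA ^+ m by rewrite mulr_ge0// exprn_ge0.
  have cS : 2 * cA ^+ m <= \sum_(m < q) 2 * cA ^+ m.
    rewrite (bigD1 m)//= lerDl; apply: sumr_ge0 => i _; by rewrite mulr_ge0// exprn_ge0.
  have rE : r * (1 + \sum_(m < q) 2 * cA ^+ m) = r0 / 2 by rewrite divfK// gt_eqF//; lra.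
  have h1 : 2 * cA ^+ m * nrm (y - phi g x) <= (\sum_(m < q) 2 * cA ^+ m) * r.
    by rewrite ler_pM ?nrm_ge0.
  by apply: le_lt_trans h1 _; rewrite -rE [ltLHS]mulrC mulrDr mulr1 ltrDr.
exists g, h, r, (~` W); split; split=> //.
- move=> x; apply: le_trans (phi_sup_le orb tau x hB gM fM1 gf) _.
  have ddle : dd <= d / (B + 1) by rewrite ge_min lexx orbT.
  apply: (@le_trans _ _ (d / (B + 1) * B)); first by rewrite ler_wpM2r.
  by rewrite -mulrA ler_piMr//; [exact: ltW|rewrite mulrC ler_pdivrMr//; lra].
- exact: (fin_meas_comp H (fin_meas_family mO)).
- exact: measurableC.
move=> x /contrapT Wx y /near Oy.
have [x01 xsep] := sepW x Wx.
have winj : injective (w x).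
  have cellw (i : 'I_L.+1) : (nth (0%N, 0) s (w x i)).1 = cell n (iter i S x).
    by rewrite /w ffunE lab_lb.
  move=> i j ij; apply: val_inj; have := congr1 (fun l : 'I_K.+1 => (nth (0%N, 0) s l).1) ij.
  rewrite !cellw => cij; have [lt|lt|//] := ltngtP (i : nat) (j : nat).
    by have := xsep i j lt (ltn_ord j).
  by have := xsep j i lt (ltn_ord i); rewrite cij.
rewrite /h /H; case: pickP => [a /andP[/injectiveP ainj]|/(_ (w x))]; last first.
  rewrite /key ffunE mem_set// andbT => /negP[]; exact/injectiveP.
rewrite /key ffunE => /set_mem Oa.
(* Both windows have their readings within [r0 / 2] of those of [y], hence within [r0] of each
   other: with different first labels they would violate the uniform gap. *)
have -> : a ord0 = w x ord0.
  apply: contrapT => /eqP ne; have [m mq hm] := hr0 _ _ ainj winj ne.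
  have h1 := Oa (Ordinal mq); have h2 := Oy (Ordinal mq).
  have := nrm_tri (xi (iter m A y)) (val a m) (val (w x) m).
  by rewrite (nrm_sub (val a m) (xi _)); move: h1 h2 => /=; lra.
have -> : (nth (0%N, 0) s (w x ord0)).1 = cell n x by rewrite /w ffunE lab_lb.
apply: le_trans (cell_near n x01) _; exact: hn0.
Qed.

End decoding.

(** * Visiting a ball by a change on a thin tower *)

Section visiting.
Context {R : realType} {V : completeNormedModType R[i]}.
Local Notation C := R[i].
Local Notation X := (measurableTypeR R).
Variables (A : V -> V) (z : int -> V) (xi : V -> C) (p : {poly C}).
Hypothesis orb : backward_orbit A z xi p.
Variable tau : int -> R -> R.
Hypothesis tau_pos : forall (k : nat) x, tau k x = iter k (tau 1) x.
Local Notation S := (tau 1).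
Variable lam : {measure set X -> \bar R}.
Hypothesis lam1 : lam setT = 1%E.
Hypothesis lam01 : lam (~` `[0, 1]%classic) = 0%E.
Hypothesis mtau : forall n (B : set X), measurable B -> measurable (tau n @^-1` B : set X).
Hypothesis lam_tau : forall n (B : set X), measurable B -> lam (tau n @^-1` B) = lam B.
Hypothesis aperiodic : forall k, lam.-negligible [set x : X | iter k.+1 S x = x].
Variable good : int -> Prop.
Hypothesis z_good : forall n, ~ good n -> z n = 0.
Hypothesis good_next : forall n, good n -> good (n + 1).
Hypothesis S_tau : forall n, good n -> lam.-negligible [set x : X | S (tau n x) <> tau (n + 1) x].

Local Notation phi := (phi z tau).

(** On a set [W] of measure at least [1/2], the successive iterates lie in distinct cells; some cell
    meets [W] in a set of positive measure, which is the base. Its [L' + 1] disjoint preimages have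
    equal measures, so each is at most [1 / (L' + 1)], whence the choice of [L' = maxn L N]. *)
Lemma tower_base (L : nat) (e : R) : 0 < e -> exists D : set X,
  [/\ measurable D, 0 < pr lam D <= e &
      forall i j x, (i < j)%N -> (j <= L)%N -> D (iter i S x) -> D (iter j S x) -> False].
Proof.
move=> e0; have [N hN] := inv_nat_small e0.
pose L' := maxn L N.
have h2 : (0 : R) < 1 / 2 by lra.
have [n [W [_ mW We sepW]]] := cells_separate lam1 lam01 (mtau 1) (lam_tau 1) aperiodic L' 0 h2.
pose D k := W `&` (cell n : X -> nat) @^-1` [set k].
have mD k : measurable (D k) by apply: measurableI => //; exact: (fin_meas_cell n).2.
have [k Dk] : exists k, 0 < pr lam (D k).
  apply: contrapT => /forallNP h.
  have D0 k : pr lam (D k) <= 0 by rewrite leNgt; apply/negP; exact: h.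
  have WD : W = \bigcup_k D k.
    by apply/seteqP; split=> x; [move=> Wx; exists (cell n x)|move=> [k _ []]].
  have : pr lam W <= 0.
    rewrite WD; apply: pr_bigcup_le => // m.
    by have := pr_bigsetU lam1 (e := 0) mD (fun k (_ : (k < m)%N) => D0 k); rewrite mulr0.
  by have := pr_setC lam1 mW; lra.
have disj i j x : (i < j)%N -> (j <= L')%N -> D k (iter i S x) -> D k (iter j S x) -> False.
  move=> ij jL [Wi ci] [_ cj]; have [_ sep] := sepW _ Wi.
  apply: (sep 0%N (j - i)%N); [by rewrite subn_gt0|by apply: leq_trans jL; exact: leq_subr|].
  have -> : iter (j - i) S (iter i S x) = iter j S x by rewrite -iterD subnK// ltnW.
  by rewrite /= ci cj.
exists (D k); split=> //; last first.
  by move=> i j x ij jL; apply: disj => //; apply: leq_trans jL _; exact: leq_maxl.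
rewrite Dk /=; pose U i : set X := iter i S @^-1` (D k).
have mU i : measurable (U i) by exact: (iter_measurable (mtau 1)).
have prU' i : pr lam (U i) = pr lam (D k).
  by rewrite /pr (iter_preserves (mtau 1) (lam_tau 1)).
have tot m : (m <= L'.+1)%N -> pr lam (\bigcup_(i in `I_m) U i) = m%:R * pr lam (D k).
  elim: m => [|m ih] mL; first by rewrite II0 bigcup_set0 mul0r /pr measure0.
  rewrite IIS bigcup_setU bigcup_set1 pr_disjU ?prU'//; last 2 first.
    by apply: bigcup_measurable.
    apply/seteqP; split=> x // [[i /= im Ui] Um]; exact: (disj i m x).
  by rewrite ih 1?ltnW// -natr1 mulrDl mul1r.
have t1 := tot _ (leqnn _).
have mT : measurable (\bigcup_(i in `I_L'.+1) U i) by apply: bigcup_measurable.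
have : pr lam (\bigcup_(i in `I_L'.+1) U i) <= 1.
  by rewrite -(prT lam1) pr_le//.
rewrite t1 => le1; apply: le_trans (hN L' (leq_maxr _ _)).
by rewrite -[leRHS]mul1r ler_pdivlMr ?ltr0n// mulrC.
Qed.

(** Off a single null set, the maps [tau] at good negative times are genuine backward iterates. The
    indices between a good one and [0] are good by [good_next], which lets the induction proceed. *)
Lemma negative_orbit : exists Nul : set X, [/\ measurable Nul, lam Nul = 0%E &
  forall x, ~ Nul x -> forall k, good (Negz k) -> iter k.+1 S (tau (Negz k) x) = x].
Proof.
have : lam.-negligible (\bigcup_k [set x : X | good (Negz k) /\ S (tau (Negz k) x) <> tau (Negz k + 1) x]).
  apply: negligible_bigcup => k; have [g|ng] := pselect (good (Negz k)).
    by apply: negligibleS (S_tau g) => x [].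
  by apply: negligibleS (negligible_set0 _) => x [].
move=> [N [mN N0 sN]]; exists N; split=> // x nN.
have step k : good (Negz k) -> S (tau (Negz k) x) = tau (Negz k + 1) x.
  by move=> g; apply: contrapT => h; apply: nN; apply: sN; exists k.
elim=> [|k ih] g; first by rewrite /= step// (_ : Negz 0 + 1 = 0%N)// tau_pos.
rewrite iterSr step// (_ : Negz k.+1 + 1 = Negz k); last by lia.
apply: ih; have := good_next g; rewrite (_ : Negz k.+1 + 1 = Negz k)//; lia.
Qed.

(* On the tower [D, S^-1 D, ..., S^-2N D], the value of [g] at level [k] is
   [a (N - k)]; hence [g (S^n x) = a n] for [|n| < N] when [x] lies in level [N]. *)
Lemma visit_step (f : R -> C) (c : V) (r d e : R) : fin_meas (f : X -> C) ->
  0 < r -> 0 < d -> 0 < e -> exists (g : R -> C) (E D : set X),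
    [/\ fin_meas (g : X -> C), measurable E, pr lam E <= e &
        forall x, ~ E x -> nrm (phi g x - phi f x) <= d] /\
    [/\ measurable D, 0 < pr lam D & forall x, D x -> nrm (phi g x - c) <= r].
Proof.
move=> ff r0 d0 e0; have [M M0 fM] := fin_meas_bounded ff.
have r2 : 0 < r / 2 by rewrite divr_gt0.
have [m0 [a ha]] := orbit_dense orb c r2.
(* Only the coefficients of index from [-m0] to [m0 - 1] enter the approximation of [c]; the others
   are set to zero on the tower. *)
pose a' (n : int) : C := if (match n with Posz k => (k < m0)%N | Negz k => (k < m0)%N end) then a n else 0.
have [M1 M10 a'M] : exists2 M1 : R, 0 <= M1 & forall n, nrm (a' n) <= M1.
  exists (bsum m0 (nrm \o a)); first by apply: sumr_ge0 => k _; rewrite addr_ge0//= nrm_ge0.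
  move=> n; rewrite /a'; case: n => k; (case: ifP => km; last by rewrite nrm0;
    apply: sumr_ge0 => j _; rewrite addr_ge0//= nrm_ge0); rewrite /bsum (bigD1 (Ordinal km)) //=.
    rewrite -addrA lerDl addr_ge0 ?nrm_ge0//; apply: sumr_ge0 => j _; by rewrite addr_ge0//= nrm_ge0.
  rewrite addrC addrA lerDr addr_ge0 ?nrm_ge0//; apply: sumr_ge0 => j _; by rewrite addr_ge0//= nrm_ge0.
(* A common bound for [f] and for the future [g], known before the tower is chosen: the truncation
   indices [N] and [N'] depend on it, and the tower on them. *)
pose M2 := M + M1; have M20 : 0 < M2 by rewrite /M2; lra.
have fM2 y : nrm (f y) <= M2 by have := fM y; rewrite /M2; lra.
have [N1 hN1] := orbit_tail orb (divr_gt0 r2 M20).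
have d20 : 0 < d / (2 * M2) by rewrite divr_gt0// mulr_gt0.
have [N' hN'] := orbit_tail orb d20.
pose N := maxn m0 N1; have m0N : (m0 <= N)%N by exact: leq_maxl.
have tailN k : (N <= k)%N -> bsum k (nrm \o z) - bsum N (nrm \o z) <= r / 2 / M2.
  move=> Nk; have := hN1 k (leq_trans (leq_maxr _ _) Nk).
  by have := le_bsum_widen (leq_maxr m0 N1) (fun n => nrm_ge0 (z n)); rewrite -/N /comp; lra.
(* [phi] can change by more than [d] only if one of the points [tau n x] with [-N' <= n < N'] hits
   one of the [L + 1] levels, a set of measure at most [2 N' (L + 1)] times that of the base. *)
pose L := (2 * N)%N; pose cnt : R := 2 * N'.+1%:R * L.+1%:R.
have cnt0 : 0 < cnt by rewrite !mulr_gt0// ltr0n.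
have [D [mD /andP[D0 De] disj]] := tower_base L (divr_gt0 e0 cnt0).
have mSD k : measurable (iter k S @^-1` D : set X) by exact: (iter_measurable (mtau 1)).
pose b (k : nat) : C := a' (Posz N - Posz k).
(* The levels are disjoint, so at most one term of the sum differs from zero; it replaces [f x] by
   the prescribed value. *)
pose g x : C := f x + \sum_(k < L.+1) (if (x : X) \in (iter k S @^-1` D) then b k - f x else 0).
have g_in k x : (k <= L)%N -> D (iter k S x) -> g x = b k.
  move=> kL Dk; have kL' : (k < L.+1)%N by rewrite ltnS.
  rewrite /g (bigD1 (Ordinal kL')) //= mem_set// big1 ?addr0; first by rewrite addrC subrK.
  move=> j jk; rewrite memNset// => Dj; have [lt|lt|e1] := ltngtP (j : nat) k.
  - exact: (disj j k x).
  - by apply: (disj k j x) => //; rewrite -ltnS.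
  - by move/eqP: jk; apply; exact: val_inj.
have g_out x : (forall k, (k <= L)%N -> ~ D (iter k S x)) -> g x = f x.
  move=> nD; rewrite /g big1 ?addr0// => k _; rewrite memNset//.
  by apply: nD; rewrite -ltnS.
have gM2 y : nrm (g y) <= M2.
  have [[k [kL Dk]]|nD] := pselect (exists k, (k <= L)%N /\ D (iter k S y)).
    by rewrite (g_in k y kL Dk) /b; have := a'M (Posz N - Posz k); rewrite /M2; lra.
  by rewrite g_out// => k kL Dk; apply: nD; exists k.
have fg : fin_meas (g : X -> C).
  apply: (fin_meas_comp2 +%R ff); apply: fin_meas_sum => k.
  apply: (fin_meas_comp2 (fun (t : bool) (u : C) => if t then b k - u else 0)) ff.
  exact: fin_meas_mem.
have [Nul [mNul Nul0 negN]] := negative_orbit.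
pose U := \bigcup_(k in `I_L.+1) (iter k S @^-1` D : set X).
have mU : measurable U by apply: bigcup_measurable.
have pD k : pr lam (iter k S @^-1` D) = pr lam D.
  by rewrite /pr (iter_preserves (mtau 1) (lam_tau 1)).
have pU : pr lam U <= L.+1%:R * pr lam D.
  by apply: (pr_bigsetU lam1) => // k _; rewrite pD.
pose T k := (tau (Posz k) @^-1` U : set X) `|` tau (Negz k) @^-1` U.
have mT k : measurable (T k) by apply: measurableU; exact: mtau.
have pT k : pr lam (T k) <= 2 * (L.+1%:R * pr lam D).
  apply: le_trans (prU lam1 (mtau _ mU) (mtau _ mU)) _.
  have e1 n : pr lam (tau n @^-1` U) = pr lam U by rewrite /pr lam_tau.
  by rewrite !e1 mulr2n mulrDl mul1r lerD.
pose E := \bigcup_(k in `I_N') T k.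
have mE : measurable E by apply: bigcup_measurable.
exists g, E, ((iter N S @^-1` D : set X) `&` ~` Nul); split; split=> //.
- have := pr_bigsetU lam1 mT (fun k (_ : (k < N')%N) => pT k); rewrite -/E => h.
  apply: le_trans h _; apply: (@le_trans _ _ (cnt * pr lam D)).
    rewrite /cnt; have : N'%:R <= N'.+1%:R :> R by rewrite ler_nat.
    have : 0 <= L.+1%:R * pr lam D by rewrite mulr_ge0// ltW.
    rewrite -[X in _ -> _ -> _ <= X]mulrA; move: (N'%:R) (N'.+1%:R) (L.+1%:R * _) => n1 n2 P h1 h2; nra.
  by rewrite mulrC -ler_pdivlMr.
- move=> x nE.
  have e1 : phi_sum z tau g N' x = phi_sum z tau f N' x.
    apply: eq_phi_sum => k kN; split; apply: g_out => j jL Dj; apply: nE; exists k => //.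
      by left; exists j.
    by right; exists j.
  have := phi_tail orb tau x gM2 hN'; have := phi_tail orb tau x fM2 hN'; rewrite e1.
  have -> : M2 * (d / (2 * M2)) = d / 2.
    by rewrite invfM mulrCA [M2 * _]mulrCA divff ?mulr1// gt_eqF.
  have := nrm_tri (phi_sum z tau f N' x) (phi g x) (phi f x).
  by rewrite (nrm_sub (phi_sum z tau f N' x)); lra.
- by apply: measurableI => //; apply: measurableC.
- have -> : pr lam (iter N S @^-1` D `&` ~` Nul) = pr lam D; last by [].
  have mI : measurable (iter N S @^-1` D `&` ~` Nul : set X) by apply: measurableI => //; apply: measurableC.
  apply/eqP; rewrite eq_le; apply/andP; split.
    by rewrite -(pD N); apply: (pr_le lam1) => //; exact: subIsetl.
  rewrite -(pD N); apply: (@le_trans _ _ (pr lam ((iter N S @^-1` D `&` ~` Nul) `|` Nul))).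
    apply: (pr_le lam1) => //; first exact: measurableU.
    by move=> x Dx; have [Nx|nx] := pselect (Nul x); [right|left].
  by apply: le_trans (prU lam1 mI mNul) _; rewrite {2}/pr Nul0 addr0.
- move=> x [Dx nNul].
  have gpos k : (k < N)%N -> g (tau (Posz k) x) = a' (Posz k).
    move=> kN; have NL : (N - k <= L)%N by exact: leq_trans (leq_subr _ _) (leq_pmull _ _).
    rewrite (g_in _ _ NL); first by rewrite /b subzn ?leq_subr// subKn// ltnW.
    by rewrite tau_pos -iterD subnK//; exact: ltnW.
  have gneg k : (k < N)%N -> good (Negz k) -> g (tau (Negz k) x) = a' (Negz k).
    move=> kN gk; have NL : (N + k.+1 <= L)%N by rewrite /L mul2n -addnn leq_add2l.
    rewrite (g_in _ _ NL); last by rewrite iterD negN.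
    by rewrite /b PoszD opprD addrA subrr add0r NegzE.
  have sumE : phi_sum z tau g N x = bsum m0 (fun n => a n *: z n).
    transitivity (bsum N (fun n => a' n *: z n)).
      apply: eq_bigr => k _; have kN := ltn_ord k; congr (_ + _).
        by rewrite gpos.
      by have [gk|/z_good ->] := pselect (good (Negz k)); [rewrite gneg|rewrite !scaler0].
    rewrite /bsum -(subnKC m0N) big_split_ord /= [X in _ + X]big1 ?addr0.
      by apply: eq_bigr => i _; rewrite /a' ltn_ord.
    by move=> i _; rewrite /a' ltnNge leq_addr /= !scale0r addr0.
  have := phi_tail orb tau x gM2 tailN; rewrite sumE.
  have -> : M2 * (r / 2 / M2) = r / 2 by rewrite mulrC divfK// gt_eqF.
  have := nrm_tri (bsum m0 (fun n => a n *: z n)) (phi g x) c.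
  by rewrite (nrm_sub (bsum _ _) c); lra.
Qed.

End visiting.

Lemma halving_bound {R : realType} (u : nat -> R) : (forall k, 0 <= u k) ->
  (forall k, u k.+1 <= u k / 2) -> forall k, u k <= u 0%N / k.+1%:R.
Proof.
move=> u0 uS; elim=> [|k ih]; first by rewrite divr1.
apply: le_trans (uS k) _; rewrite ler_pdivlMr ?ltr0n//.
move: ih; rewrite ler_pdivlMr ?ltr0n// => ih; apply: le_trans ih.
have k1 : k.+2%:R = k.+1%:R + 1 :> R by rewrite -natr1.
have : 1 <= k.+1%:R :> R by rewrite ler1n.
have := u0 k; rewrite k1; move: (k.+1%:R : R) => t; nra.
Qed.

Lemma halving_small {R : realType} (u : nat -> R) (e : R) : (forall k, 0 <= u k) ->
  (forall k, u k.+1 <= u k / 2) -> 0 < e -> exists N, forall n, (N <= n)%N -> u n <= e.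
Proof.
move=> u0 uS /(cst_div_nat_small (u 0%N))[N hN]; exists N => n /hN.
by apply: le_trans; exact: halving_bound.
Qed.

Lemma countable_range (T : choiceType) (D : set T) : countable D -> D !=set0 -> exists q : nat -> T, range q = D.
Proof.
move=> /countable_injP[f finj] [x0 Dx0]; exists (fun n => xget x0 [set x | D x /\ f x = n]).
apply/seteqP; split=> [_ [n _ <-]|x Dx].
  by case: xgetP => [y _ []|].
exists (f x) => //; case: xgetP => [y _ [Dy fy]|/(_ x)[]//].
by apply: finj fy; exact: mem_set.
Qed.

Lemma dense_sequence {R : realType} {V : normedModType R[i]} : separable V ->
  exists q : nat -> V, forall (y : V) (e : R), 0 < e -> exists n, nrm (q n - y) <= e.
Proof.
move=> [D cD dD].
have near y (e : R) : 0 < e -> exists2 x, D x & nrm (x - y) <= e.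
  move=> e0; have : (ball y e%:C%C `&` D) !=set0.
    apply: dD; last by apply: ball_open; rewrite ltcR.
    by exists y; apply: ballxx; rewrite ltcR.
  move=> [x [yx Dx]]; exists x => //; move: yx; rewrite -ball_normE /= normr_lt nrm_sub.
  exact: ltW.
have D0 : D !=set0 by have [x Dx _] := near 0 1 ltr01; exists x.
have [q qD] := countable_range cD D0; exists q => y e /(near y)[x].
by rewrite -qD => -[n _ <-]; exists n.
Qed.

Lemma ball_base {R : realType} {V : normedModType R[i]} : separable V ->
  exists (c : nat -> V) (r : nat -> R), (forall n, 0 < r n) /\
    forall (y : V) (e : R), 0 < e -> exists n, nrm (c n - y) <= r n <= e.
Proof.
move=> /dense_sequence[q hq]; pose pr2 n : nat * nat := odflt (0%N, 0%N) (unpickle n).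
exists (fun n => q (pr2 n).1), (fun n => (pr2 n).2.+1%:R^-1); split.
  by move=> n; rewrite invr_gt0 ltr0n.
move=> y e e0; have [b hb] := inv_nat_small e0.
have b0 : (0 : R) < b.+1%:R^-1 by rewrite invr_gt0 ltr0n.
have [a ha] := hq y _ b0; exists (pickle (a, b)).
by rewrite /pr2 pickleK /= ha hb.
Qed.

(** [f x] lies in an open [U] if and only if, for some [k], the closed balls of radius [1 / (k+1)]
    around the approximations [w n x] are eventually contained in [U]; this writes the preimage with
    countable operations. *)
Lemma measurable_to_lim {R : realType} d (Y : measurableType d) {V : normedModType R[i]}
    (w : nat -> Y -> V) (f : Y -> V) :
  (forall n, fin_meas (w n)) -> (forall x, to_lim (fun n => w n x) (f x)) ->
  measurable_fun setT (f : Y -> borel V).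
Proof.
move=> wfm wf; apply: (@measurability _ _ Y (borel V) setT f (@open V)) => //.
move=> _ [U oU <-]; rewrite setTI.
pose Uk (k : nat) := [set y : V | forall y', nrm (y' - y) <= k.+1%:R^-1 -> U y'].
have -> : f @^-1` U = \bigcup_k \bigcup_N \bigcap_(n in [set n | (N <= n)%N]) w n @^-1` Uk k.
  apply/seteqP; split=> x /=.
    move=> Ux; have : nbhs (f x) U by apply: open_nbhs_nbhs.
    move=> /nbhs_nrm[r r0 hr]; have r3 : 0 < r / 3 by rewrite divr_gt0.
    have [k hk] := inv_nat_small r3; exists k => //.
    have [N hN] := wf x _ r3; exists N => // n /= Nn y' hy'; apply: hr.
    have := nrm_tri (w n x) y' (f x); have := hN n Nn; have := hk k (leqnn k).
    by move: (k.+1%:R^-1) hy' => t; lra.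
  move=> [k _ [N _ hN]]; have k0 : (0 : R) < k.+1%:R^-1 by rewrite invr_gt0 ltr0n.
  have [M hM] := wf x _ k0; apply: (hN (maxn N M)); first exact: leq_maxl.
  by rewrite nrm_sub; apply: hM; exact: leq_maxr.
apply: bigcup_measurable => k _; apply: bigcup_measurable => N _.
by apply: bigcap_measurable => [|n _]; [exists N => /=|exact: (wfm n).2].
Qed.

(** * Limit of the successive refinements *)

Section model.
Context {R : realType} {V : completeNormedModType R[i]}.
Local Notation C := R[i].
Local Notation X := (measurableTypeR R).
Hypothesis sepV : separable V.
Variables (A : V -> V) (z : int -> V) (xi : V -> C) (p : {poly C}).
Hypothesis orb : backward_orbit A z xi p.
Hypothesis Alin : forall a x y, A (a *: x + y) = a *: A x + A y.
Variable cA : R.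
Hypothesis cA0 : 0 <= cA.
Hypothesis Abound : forall x, nrm (A x) <= cA * nrm x.
Variable tau : int -> R -> R.
Hypothesis tau_pos : forall (k : nat) x, tau k x = iter k (tau 1) x.
Local Notation S := (tau 1).
Variable lam : {measure set X -> \bar R}.
Hypothesis lam1 : lam setT = 1%E.
Hypothesis lam01 : lam (~` `[0, 1]%classic) = 0%E.
Hypothesis mtau : forall n (B : set X), measurable B -> measurable (tau n @^-1` B : set X).
Hypothesis lam_tau : forall n (B : set X), measurable B -> lam (tau n @^-1` B) = lam B.
Hypothesis aperiodic : forall k, lam.-negligible [set x : X | iter k.+1 S x = x].
Variable good : int -> Prop.
Hypothesis z_good : forall n, ~ good n -> z n = 0.
Hypothesis good_next : forall n, good n -> good (n + 1).
Hypothesis S_tau : forall n, good n -> lam.-negligible [set x : X | S (tau n x) <> tau (n + 1) x].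
Hypothesis tau_S : forall n, good n -> lam.-negligible [set x : X | tau n (S x) <> tau (n + 1) x].

Local Notation phi := (phi z tau).

(** [st_f] is the current function, [st_h] a decoder for it, [st_E] the exceptional set of the last
    refinement and [st_D] the set of points sent to the current ball. [st_d] bounds the next change
    of [phi], and [st_e] both the measure of the next exceptional set and the error of the next
    decoder. *)
Record stage := Stage {
  st_f : R -> C; st_h : V -> R; st_E : set X; st_D : set X; st_d : R; st_e : R }.

Definition stage_ok (s : stage) :=
  [/\ fin_meas (st_f s : X -> C), 0 < st_d s & 0 < st_e s].

(* [s'] refines [s] and visits the ball of centre [c] and radius [r]; the
   tolerances [st_d s'] and [st_e s'] are so small that no later refinement
   destroys what has been achieved. *)
Definition stage_next (c : V) (r : R) (s s' : stage) :=
  [/\ stage_ok s', fin_meas (st_h s' : borel V -> R), st_d s' <= st_d s / 2 & st_e s' <= st_e s / 2] /\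
  [/\ measurable (st_E s'), pr lam (st_E s') <= st_e s,
      forall x, ~ st_E s' x -> nrm (phi (st_f s') x - phi (st_f s) x) <= st_d s &
      forall x, ~ st_E s' x -> forall y, nrm (y - phi (st_f s') x) <= 2 * st_d s' ->
        `|st_h s' y - x| <= st_e s] /\
  [/\ measurable (st_D s'), 2 * st_e s' < pr lam (st_D s') &
      forall x, st_D s' x -> forall y, nrm (y - phi (st_f s') x) <= 2 * st_d s' -> nrm (y - c) <= r].

(** The visit comes before the decoding, because a ball reached with margin survives a small
    perturbation. The visit ends within [r / 2] of [c], the decoding step moves by at most [r / 4],
    and the remaining [r / 4] is left to all later stages. *)
Lemma exists_stage_next c r s : 0 < r -> stage_ok s -> exists s', stage_next c r s s'.
Proof.
move: s => [f h E D d e] r0 [/= ff d0 e0].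
have [r2 d2 e2] : [/\ 0 < r / 2, 0 < d / 2 & 0 < e / 2] by split; rewrite divr_gt0.
have [g1 [E1 [D1 [[fg1 mE1 E1e g1f] [mD1 D1p D1c]]]]] :=
  visit_step orb tau_pos lam1 lam01 mtau lam_tau aperiodic z_good good_next S_tau c ff r2 d2 e2.
have d1 : 0 < Num.min (d / 2) (r / 4) by rewrite lt_min d2 divr_gt0.
have [g [h' [r' [E2 [[fg gg1 fh r'0] [mE2 E2e dec]]]]]] :=
  decode_step orb Alin cA0 Abound tau_pos lam1 lam01 mtau lam_tau aperiodic fg1 d1 e2.
have d1d : Num.min (d / 2) (r / 4) <= d / 2 by rewrite ge_min lexx.
have d1r : Num.min (d / 2) (r / 4) <= r / 4 by rewrite ge_min lexx orbT.
(* Later changes add up to at most [2 d']: this must be below the decoding radius [r'] and below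
   [r / 4]. Likewise [2 e'], which bounds the measure of all later exceptional sets together, must
   be less than the measure of [D1]. *)
pose d' := Num.min (d / 2) (Num.min (r' / 2) (r / 8)).
pose e' := Num.min (e / 2) (pr lam D1 / 4).
have d'0 : 0 < d' by rewrite !lt_min d2 !divr_gt0.
have e'0 : 0 < e' by rewrite !lt_min e2 !divr_gt0.
have d'd : d' <= d / 2 by rewrite ge_min lexx.
have d'r' : d' <= r' / 2 by rewrite !ge_min lexx orbT.
have d'r : d' <= r / 8 by rewrite !ge_min lexx !orbT.
have e'e : e' <= e / 2 by rewrite ge_min lexx.
have e'D : e' <= pr lam D1 / 4 by rewrite ge_min lexx orbT.
clearbody d' e'.
exists (Stage g h' (E1 `|` E2) D1 d' e'); split; [by split|split]; split=> //=.
- exact: measurableU.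
- by apply: le_trans (prU lam1 mE1 mE2) _; lra.
- move=> x nE; have := nrm_tri (phi g1 x) (phi g x) (phi f x).
  have := gg1 x; have := g1f x (fun h => nE (or_introl h)); lra.
- move=> x nE y hy; have hy' : nrm (y - phi g x) <= r' by lra.
  by have := dec x (fun h => nE (or_intror h)) y hy'; lra.
- by lra.
- move=> x Dx y hy; have := D1c x Dx; have := gg1 x.
  have := nrm_tri (phi g x) y c; have := nrm_tri (phi g1 x) (phi g x) c; lra.
Qed.

Lemma exists_stages (c : nat -> V) (r : nat -> R) : (forall k, 0 < r k) ->
  exists s : nat -> stage, (forall k, stage_ok (s k)) /\
    forall k, stage_next (c k) (r k) (s k) (s k.+1).
Proof.
move=> r0.
have : forall ks : nat * stage, exists s', stage_ok ks.2 -> stage_next (c ks.1) (r ks.1) ks.2 s'.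
  move=> [k s]; have [ok|nok] := pselect (stage_ok s); last by exists s.
  by have [s' hs'] := exists_stage_next (c k) (r0 k) ok; exists s'.
move=> /choice[next hnext].
pose s := fix s k := if k is k'.+1 then next (k', s k')
  else Stage (fun=> 0) (fun=> 0) set0 set0 1 1.
have ok k : stage_ok (s k).
  elim: k => [|k ih]; first by split=> //=; [exact: fin_meas_cst].
  by have [[]] := hnext (k, s k) ih.
by exists s; split=> // k; exact: (hnext (k, s k) (ok k)).
Qed.

Lemma A_sub u v : nrm (A u - A v) <= cA * nrm (u - v).
Proof.
have -> : A u - A v = A (u - v).
  by have := Alin (-1) v u; rewrite !scaleN1r addrC => ->; rewrite addrC.
exact: Abound.
Qed.

Lemma model_on_interval : exists (Phi : R -> V) (psi : V -> R),
  [/\ measurable_fun setT (Phi : X -> borel V), measurable_fun setT (psi : borel V -> X),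
      lam.-negligible [set x : X | psi (Phi x) <> x],
      lam.-negligible [set x : X | Phi (S x) <> A (Phi x)] &
      forall U : set V, open U -> U !=set0 -> 0 < pr lam (Phi @^-1` U)].
Proof.
have [c [r [r0 base]]] := ball_base sepV.
have [s [ok nxt]] := exists_stages c r0.
(* Indices are shifted: [h k], [F k] and [D k] come from stage [k + 1], and are controlled by the
   tolerances of stage [k]. *)
pose f k := st_f (s k); pose h k := st_h (s k.+1); pose F k := st_E (s k.+1).
pose D k := st_D (s k.+1); pose d k := st_d (s k); pose e k := st_e (s k).
have ff k : fin_meas (f k : X -> C) by have [] := ok k.
have d0 k : 0 < d k by have [] := ok k.
have e0 k : 0 < e k by have [] := ok k.
have fh k : fin_meas (h k : borel V -> R) by have [[]] := nxt k.
have dS k : d k.+1 <= d k / 2 by have [[]] := nxt k.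
have eS k : e k.+1 <= e k / 2 by have [[]] := nxt k.
have mF k : measurable (F k) by have [_ [[]]] := nxt k.
have Fe k : pr lam (F k) <= e k by have [_ [[]]] := nxt k.
have step k x : ~ F k x -> nrm (phi (f k.+1) x - phi (f k) x) <= d k by have [_ [[_ _ h1 _] _]] := nxt k; exact: h1.
have dec k x : ~ F k x -> forall y, nrm (y - phi (f k.+1) x) <= 2 * d k.+1 -> `|h k y - x| <= e k.
  by have [_ [[_ _ _ h1] _]] := nxt k; exact: h1.
have mD k : measurable (D k) by have [_ [_ []]] := nxt k.
have De k : 2 * e k.+1 < pr lam (D k) by have [_ [_ []]] := nxt k.
have Dc k x : D k x -> forall y, nrm (y - phi (f k.+1) x) <= 2 * d k.+1 -> nrm (y - c k) <= r k.
  by have [_ [_ [_ _ h1]]] := nxt k; exact: h1.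
clearbody f h F D d e; clear s ok nxt.
have dle k : 0 <= d k by exact: ltW.
have ele k : 0 <= e k by exact: ltW.
(* Off [B m] the sequence of maps is Cauchy from index [m] on, with total change at most [2 d n]
   after stage [n]; the intersection [NG] is null by Borel-Cantelli. *)
pose B m := \bigcup_(k in [set k | (m <= k)%N]) F k.
have mB m : measurable (B m) by apply: bigcup_measurable => k _.
have Bm m : pr lam (B m) <= 2 * e m by exact: pr_geo_bigcup.
have Bdec m n : (m <= n)%N -> B n `<=` B m.
  by move=> mn x [k /= nk Fx]; exists k => //=; exact: leq_trans nk.
pose NG := \bigcap_m B m.
have mNG : measurable NG by exact: bigcap_measurable.
have NG0 : lam NG = 0%E.
  rewrite -(prE lam1 mNG); congr (_%:E); apply/eqP; rewrite eq_le pr_ge0 andbT.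
  apply/ler_addgt0Pr => t t0; have t2 : 0 < t / 2 by rewrite divr_gt0.
  have [N hN] := halving_small ele eS t2; have := hN N (leqnn N).
  have : pr lam NG <= pr lam (B N) by apply: (pr_le lam1) => // x; exact.
  have := Bm N; lra.
have tele x m : ~ B m x -> forall n k, (m <= n)%N ->
    nrm (phi (f (n + k)%N) x - phi (f n) x) <= 2 * d n - 2 * d (n + k)%N.
  move=> nB n k mn; elim: k => [|k ih]; first by rewrite addn0 !subrr nrm0.
  have nF : ~ F (n + k)%N x by move=> Fx; apply: nB; exists (n + k)%N => //=; exact: leq_trans (leq_addr _ _).
  have := nrm_tri (phi (f (n + k)%N) x) (phi (f (n + k.+1)%N) x) (phi (f n) x).
  have := step _ _ nF; have := dS (n + k)%N; rewrite addnS; move: ih.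
  by move: (d (n + k)%N) (d (n + k).+1) (d n) (nrm _) (nrm _) (nrm _) => ? ? ? ? ? ?; lra.
have cvg x m : ~ B m x -> exists l, to_lim (fun n => phi (f n) x) l.
  move=> nB; apply: to_lim_complete => t t0; have t4 : 0 < t / 4 by rewrite divr_gt0.
  have [N hN] := halving_small dle dS t4; exists (maxn m N).
  have near n : (maxn m N <= n)%N -> nrm (phi (f n) x - phi (f (maxn m N)) x) <= t / 2.
    move=> /subnKC <-; have := tele x m nB (maxn m N) (n - maxn m N)%N (leq_maxl _ _).
    have := d0 (maxn m N + (n - maxn m N))%N; have := hN (maxn m N) (leq_maxr _ _).
    by move: (d (maxn m N)) (d (_ + _)%N) (nrm _) => ? ? ?; lra.
  move=> n n' /near h1 /near h2.
  have := nrm_tri (phi (f (maxn m N)) x) (phi (f n) x) (phi (f n') x).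
  by rewrite (nrm_sub (phi (f (maxn m N)) x)); lra.
pose Phi x := if x \in NG then 0 else xget 0 [set l | to_lim (fun n => phi (f n) x) l].
have notNG x : ~ NG x -> exists m, ~ B m x.
  by move=> nNG; apply: contrapT => /forallNP hB; apply: nNG => m _; exact: contrapT (hB m).
have Plim x : ~ NG x -> to_lim (fun n => phi (f n) x) (Phi x).
  move=> nNG; have [m /cvg[l hl]] := notNG x nNG; rewrite /Phi memNset//.
  by case: xgetP => [l' _ //|/(_ l)].
have BNG x m : ~ B m x -> ~ NG x by move=> nB hx; apply: nB; exact: hx.
have Pnear x m n : ~ B m x -> (m <= n)%N -> nrm (Phi x - phi (f n) x) <= 2 * d n.
  move=> nB mn; apply: to_lim_nrm_sub_le (Plim x (BNG _ _ nB)) _ => k.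
  exists (n + k)%N; first exact: leq_addl.
  by have := tele x m nB n k mn; have := d0 (n + k)%N; lra.
have mPhi : measurable_fun setT (Phi : X -> borel V).
  have : forall n, exists w : R -> V, fin_meas (w : X -> V) /\ forall x, nrm (w x - phi (f n) x) <= d n.
    move=> n; have [M M0 fM] := fin_meas_bounded (ff n).
    have [N hN] := orbit_tail orb (divr_gt0 (d0 n) M0).
    exists (phi_sum z tau (f n) N); split.
      apply: fin_meas_sum => k; apply: (fin_meas_comp2 +%R).
        exact: (fin_meas_comp (fun a : C => a *: z k) (fin_meas_precomp (mtau k) (ff n))).
      exact: (fin_meas_comp (fun a : C => a *: z (Negz k)) (fin_meas_precomp (mtau (Negz k)) (ff n))).
    move=> x; rewrite nrm_sub; apply: le_trans (phi_tail orb tau x fM hN) _.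
    by rewrite mulrC divfK// gt_eqF.
  move=> /choice[w hw].
  (* The finite sums [w n] have finitely many values; setting them to zero on [B n] makes them
     converge everywhere, to the value [0] of [Phi] on [NG]. *)
  apply: (@measurable_to_lim R _ X V (fun n x => if x \in B n then 0 else w n x)).
    by move=> n; exact: (fin_meas_comp2 (fun (t : bool) u => if t then 0 else u) (fin_meas_mem (mB n)) (hw n).1).
  move=> x; have [Nx|nx] := pselect (NG x).
    apply: (@to_lim_near _ _ (fun=> 0) _ _ 0); last by rewrite /Phi mem_set//; exact: to_lim_cst.
    by move=> n _; rewrite mem_set//; exact: Nx.
  have [m nB] := notNG x nx.
  apply: (@to_lim_near _ _ (fun n => w n x) _ _ m).
    by move=> n mn; rewrite memNset// => /(Bdec _ _ mn).
  move=> t t0; have t2 : 0 < t / 2 by rewrite divr_gt0.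
  have [N1 hN1] := Plim x nx _ t2; have [N2 hN2] := halving_small dle dS t2.
  exists (maxn N1 N2) => n; rewrite geq_max => /andP[n1 n2].
  have := hN1 n n1; have := hN2 n n2; have := (hw n).2 x.
  by have := nrm_tri (phi (f n) x) (w n x) (Phi x); lra.
(* The decoders converge at the points [Phi x] with [x] outside [NG]; the upper limit yields a Borel
   map on the whole space. *)
pose psi y := fine (limn_esup (fun n => (h n y)%:E)).
have hx x : ~ NG x -> psi (Phi x) = x.
  move=> nNG; have [m nB] := notNG x nNG; rewrite /psi.
  suff : (h n (Phi x))%:E @[n --> \oo] --> x%:E by move=> /cvg_limn_einf_sup ->.
  apply: cvg_EFin; first by near=> n.
  apply/cvgrPdist_le => t t0; have [N hN] := halving_small ele eS t0.
  exists (maxn m N) => // n /=; rewrite geq_max => /andP[mn Nn].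
  have nF : ~ F n x by move=> Fx; apply: nB; exists n.
  rewrite distrC; apply: le_trans (hN n Nn); apply: dec => //.
  by apply: Pnear nB _; exact: leqW.
exists Phi, psi; split=> //.
- apply: measurableT_comp => //; apply: measurable_fun_limn_esup => n.
  by apply/measurable_EFinP => _ Y mY; rewrite setTI; exact: (fh n).2.
- by exists NG; split=> // x hne; apply: contrapT => nNG; apply: hne; exact: hx.
- have : lam.-negligible (NG `|` S @^-1` NG `|` \bigcup_n [set x : X | phi (f n) (S x) <> A (phi (f n) x)]).
    apply: negligibleU; first apply: negligibleU.
    - by exists NG; split.
    - by exists (S @^-1` NG); split=> //; [exact: mtau|exact: etrans (lam_tau 1 mNG) NG0].
    - apply: negligible_bigcup => n; have [M _ fM] := fin_meas_bounded (ff n).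
      exact: (phi_equivariant orb Alin cA0 Abound z_good tau_S fM).
  apply: negligibleS => x ne; apply: contrapT => no; apply: ne.
  have nx : ~ NG x by move=> Nx; apply: no; left; left.
  have nSx : ~ NG (S x) by move=> Nx; apply: no; left; right.
  have l2 := to_lim_of_bounded Alin cA0 Abound (Plim x nx).
  apply: (to_lim_uniq (Plim _ nSx)); apply: eq_to_lim l2 => n.
  by apply: esym; apply: contrapT => ne; apply: no; right; exists n.
- move=> U oU [y0 Uy0]; have : nbhs y0 U by apply: open_nbhs_nbhs.
  move=> /nbhs_nrm[t t0 hU]; have t3 : 0 < t / 3 by rewrite divr_gt0.
  have [k /andP[hc hr]] := base y0 _ t3.
  have mU : measurable (Phi @^-1` U : set X) by rewrite -[X in measurable X]setTI; apply: mPhi => //; exact: open_borel.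
  have mDB : measurable (Phi @^-1` U `|` B k.+1) by exact: measurableU.
  (* A point of [D k] outside [B k.+1] keeps its image in the ball of centre [c k]. Such points have
     positive measure, as [D k] exceeds [2 e k.+1]. *)
  have : pr lam (D k) <= pr lam (Phi @^-1` U `|` B k.+1).
    apply: (pr_le lam1) => // x Dx; have [Bx|nB] := pselect (B k.+1 x); [by right|left].
    apply: hU; have := Dc k x Dx (Phi x) (Pnear x k.+1 k.+1 nB (leqnn _)).
    by have := nrm_tri (c k) (Phi x) y0; lra.
  by have := prU lam1 mU (mB k.+1); have := Bm k.+1; have := De k; lra.
Unshelve. all: by end_near. Qed.

End model.

(** * Maps preserving measures modulo null sets *)

Section mod_null.
Context {R : realType}.

Lemma eq_measure_negligible d (X : measurableType d) (mu : {measure set X -> \bar R}) (A B : set X) :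
  measurable A -> measurable B -> mu.-negligible (A `+` B) -> mu A = mu B.
Proof.
move=> mA mB nAB.
have le (C D : set X) : measurable C -> measurable D -> mu.-negligible (C `+` D) -> (mu C <= mu D)%E.
  move=> mC mD [N [mN N0 sN]]; apply: (@le_trans _ _ (mu (D `|` N))).
    rewrite le_measure ?inE//; first exact: measurableU.
    by move=> x Cx; have [Dx|nD] := pselect (D x); [left|right; apply: sN; left].
  have := measureU2 mu mD mN; rewrite [X in (_ <= _ + X)%E -> _](_ : _ = 0%E)// adde0.
  exact.
by apply/eqP; rewrite eq_le !le// setYC.
Qed.

Lemma negligible_eq_setY d (X : measurableType d) (mu : {measure set X -> \bar R}) (T : Type)
  (f g : X -> T) (B : set T) :
  mu.-negligible [set x | f x <> g x] -> mu.-negligible (f @^-1` B `+` g @^-1` B).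
Proof. by apply: negligibleS => x; case=> -[/= h1 h2] e; [rewrite e in h1|rewrite e in h2]. Qed.

Lemma setY_sub T (A B C : set T) : A `+` C `<=` (A `+` B) `|` (B `+` C).
Proof.
by move=> x; rewrite /setY /setU /setD /=; have [Bx|nB] := pselect (B x); tauto.
Qed.

Lemma preserving_measurable d1 d2 (X : measurableType d1) (Y : measurableType d2)
    (mu : {measure set X -> \bar R}) (nu : {measure set Y -> \bar R}) (f : X -> Y) :
  measurable_fun setT f -> (forall B, measurable B -> mu (f @^-1` B) = nu B) ->
  preserving_mod_null mu nu f.
Proof.
move=> mf hf B mB; exists (f @^-1` B); split; [|by rewrite setYK; exact: negligible_set0|exact: hf].
by rewrite -[X in measurable X]setTI; exact: mf.
Qed.

Lemma negligible_preimage d1 d2 (X : measurableType d1) (Y : measurableType d2)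
    (mu : {measure set X -> \bar R}) (nu : {measure set Y -> \bar R}) (f : X -> Y) (N : set Y) :
  preserving_mod_null mu nu f -> nu.-negligible N -> mu.-negligible (f @^-1` N).
Proof.
move=> hf [M [mM M0 NM]]; have [A [mA nA A0]] := hf M mM.
apply: (@negligibleS _ _ _ _ (A `|` (A `+` f @^-1` M))).
  by move=> x /NM Mx; have [Ax|nAx] := pselect (A x); [left|right; right].
apply: negligibleU nA; exists A; split=> //; exact: etrans A0 M0.
Qed.

Lemma preserving_comp d1 d2 d3 (X : measurableType d1) (Y : measurableType d2) (Z : measurableType d3)
    (mu : {measure set X -> \bar R}) (nu : {measure set Y -> \bar R}) (rho : {measure set Z -> \bar R})
    (f : X -> Y) (g : Y -> Z) :
  preserving_mod_null mu nu f -> preserving_mod_null nu rho g -> preserving_mod_null mu rho (g \o f).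
Proof.
move=> hf hg B mB; have [A2 [mA2 n2 e2]] := hg B mB; have [A1 [mA1 n1 e1]] := hf A2 mA2.
exists A1; split=> //; last exact: etrans e1 e2.
apply: negligibleS (@setY_sub _ _ (f @^-1` A2) _) (negligibleU n1 _).
exact: negligible_preimage hf n2.
Qed.

Lemma eq_preserving d1 d2 (X : measurableType d1) (Y : measurableType d2)
    (mu : {measure set X -> \bar R}) (nu : {measure set Y -> \bar R}) (f g : X -> Y) :
  mu.-negligible [set x | f x <> g x] -> preserving_mod_null mu nu f -> preserving_mod_null mu nu g.
Proof.
move=> fg hf B mB; have [A [mA nA eA]] := hf B mB; exists A; split=> //.
apply: negligibleS (@setY_sub _ _ (f @^-1` B) _) (negligibleU nA _).
exact: negligible_eq_setY.
Qed.

Lemma preserving_preimage d1 d2 (X : measurableType d1) (Y : measurableType d2)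
    (mu : {measure set X -> \bar R}) (nu : {measure set Y -> \bar R}) (f : X -> Y) (B : set Y) :
  preserving_mod_null mu nu f -> measurable_fun setT f -> measurable B -> mu (f @^-1` B) = nu B.
Proof.
move=> hf mf mB; have [A [mA nA <-]] := hf B mB; apply: eq_measure_negligible => //; last by rewrite setYC.
by rewrite -[X in measurable X]setTI; exact: mf.
Qed.

(** For rational [q], the preimage of []-oo, q]] is measurable up to a null set. Setting [f] to [0]
    on the countable union [N] of these null sets makes all of these preimages measurable, and
    rational half-lines generate the Borel sets. *)
Lemma measurable_version d (X : measurableType d)
    (mu : {measure set X -> \bar R}) (nu : {measure set (measurableTypeR R) -> \bar R}) (f : X -> R) :
  preserving_mod_null mu nu (f : X -> measurableTypeR R) ->
  exists2 g : X -> R, measurable_fun setT (g : X -> measurableTypeR R) & mu.-negligible [set x | f x <> g x].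
Proof.
move=> hf; pose I (q : rat) : set (measurableTypeR R) := `]-oo, ratr q]%classic.
have : forall q : rat, exists AN : set X * set X, [/\ measurable AN.1, measurable AN.2, mu AN.2 = 0%E &
    AN.1 `+` f @^-1` I q `<=` AN.2].
  by move=> q; have [|A [mA [N [mN N0 sN]] _]] := hf (I q); [exact: measurable_itv|exists (A, N)].
move=> /choice[AN hAN]; pose N := \bigcup_q (AN q).2.
have mN : measurable N by apply: bigcupT_measurable_rat => q; have [] := hAN q.
have N0 : mu.-negligible N.
  rewrite /N (_ : \bigcup_q _ = \bigcup_n (if unpickle n is Some q then (AN q).2 else set0)).
    apply: negligible_bigcup => n; case: unpickle => [q|]; last exact: negligible_set0.
    by have [_ mM M0 _] := hAN q; exists (AN q).2; split; [exact: mM|exact: M0|].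
  apply/seteqP; split=> x; first by move=> [q _ h]; exists (pickle q); rewrite ?pickleK.
  by move=> [n _]; case: unpickle => // q h; exists q.
exists (fun x => if x \in N then 0 else f x); last first.
  apply: negligibleS N0 => x /= ne; apply: contrapT => nN; apply: ne; rewrite memNset//.
set g := (fun x => _); have mg q : measurable (g @^-1` I q).
  have [mA _ _ sAN] := hAN q; rewrite (_ : _ @^-1` _ = ((AN q).1 `\` N) `|` (if 0 <= (ratr q : R) then N else set0)).
    by apply: measurableU; [exact: measurableD|case: ifP].
  have off x : ~ N x -> (AN q).1 x <-> f x <= ratr q.
    move=> nN; split=> h; apply: contrapT => h'; apply: nN; exists q => //; apply: sAN; [left|right] ; split=> //; rewrite /I /= in_itv.
  apply/seteqP; split=> x; rewrite /g /I /= ?in_itv /=.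
    case: ifPn => [/set_mem Nx|/negP nN] h; first by right; rewrite h.
    have {}nN : ~ N x by move=> /mem_set.
    by left; split=> //; exact/off.
  move=> [[Ax nN]|]; first by rewrite memNset//; exact/off.
  by case: ifPn => // h Nx; rewrite mem_set.
apply: (@measurability _ _ X (measurableTypeR R) setT g (@RGenInftyO.G R)).
  exact: RGenInftyO.measurableE.
move=> _ [_ [r ->] <-]; rewrite setTI.
rewrite (_ : _ @^-1` _ = \bigcup_(q : rat) (if (ratr q : R) < r then g @^-1` I q else set0)).
  by apply: bigcupT_measurable_rat => q; case: ifP.
apply/seteqP; split=> x /=.
  rewrite in_itv /= => /rat_in_itvoo[q]; rewrite in_itv /= => /andP[h1 h2].
  by exists q => //; rewrite h2 /I /= in_itv /= ltW.
by move=> [q _]; case: ifP => // h; rewrite /I /= !in_itv /= => h'; exact: le_lt_trans h.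
Qed.

End mod_null.

(** * Ergodicity modulo null sets and aperiodicity *)

Section ergodicity.
Context {R : realType}.
Local Notation X := (measurableTypeR R).

(* The set of the points visiting [A] infinitely often is invariant and differs
   from [A] by a null set. *)
Lemma ergodic_mod_null d (Y : measurableType d) (mu : probability Y R) (T : Y -> Y) (A : set Y) :
  measure_preserving mu T -> ergodic mu T -> measurable A ->
  mu.-negligible (T @^-1` A `+` A) -> mu A = 0%E \/ mu A = 1%E.
Proof.
move=> [mT muT] erg mA nA.
have mTB B : measurable B -> measurable (T @^-1` B) by move=> mB; rewrite -[X in measurable X]setTI; exact: mT.
pose U n := iter n T @^-1` A.
have US n : U n.+1 = T @^-1` U n by apply/seteqP; split=> x; rewrite /U /= -iterSr.
have mU n : measurable (U n) by elim: n => // n ih; rewrite US; exact: mTB.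
have nU n : mu.-negligible (U n `+` A).
  elim: n => [|n ih]; first by rewrite setYK; exact: negligible_set0.
  apply: negligibleS (@setY_sub _ _ (T @^-1` A) _) (negligibleU _ nA).
  rewrite US -[X in negligible _ X]/(T @^-1` (U n `+` A)).
  exact: negligible_preimage (preserving_measurable mT muT) ih.
pose L := \bigcap_m \bigcup_(n in [set n | (m <= n)%N]) U n.
have mL : measurable L.
  by apply: bigcap_measurable => [|m _]; [exists 0%N|apply: bigcup_measurable => n _].
have TL : T @^-1` L = L.
  apply/seteqP; split=> x Lx m _.
    have [n /= mn] := Lx m Logic.I; rewrite -[U n (T x)]/((T @^-1` U n) x) -US => h.
    by exists n.+1 => //=; exact: leqW.
  have [[//|n] /= mn] := Lx m.+1 Logic.I; rewrite US => h; by exists n.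
have <- : mu L = mu A; last exact: erg.
apply: eq_measure_negligible => //; apply: negligibleS (negligible_bigcup nU) => x hx.
apply: contrapT => nx.
have UA n : U n x <-> A x.
  split=> h; apply: contrapT => h'; apply: nx; exists n => //; [by left|by right].
case: hx => -[h1 h2]; apply: h2.
  by have [n _ /UA] := h1 0%N Logic.I.
by move=> m _; exists m => //=; exact/UA.
Qed.

Lemma measurable_periodic (S : R -> R) : (forall B : set X, measurable B -> measurable (S @^-1` B : set X)) ->
  measurable ([set x | S x = x] : set X).
Proof.
move=> mS; rewrite (_ : [set x | S x = x] = (fun x => S x - x) @^-1` [set 0]).
  rewrite -[X in measurable X]setTI; have : measurable_fun setT (fun x : X => S x - x).
    by apply: measurable_funB => // _ B mB; rewrite setTI; exact: mS.
  by apply; [exact: measurableT|exact: measurable_set1].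
by apply/seteqP; split=> x /=; [move=> ->; rewrite subrr|move/eqP; rewrite subr_eq0 => /eqP].
Qed.

(* If [S^j] fixes almost every point, the union of the first [j] preimages of
   a short interval is invariant modulo null sets. *)
Lemma ergodic_aperiodic (lam : {measure set X -> \bar R}) (S : R -> R) :
  lam setT = 1%E -> (forall t : R, 0 <= t <= 1 -> lam `[0, t]%classic = t%:E) ->
  (forall B : set X, measurable B -> measurable (S @^-1` B : set X)) ->
  (forall B : set X, measurable B -> lam (S @^-1` B) = lam B) ->
  (forall B : set X, measurable B -> lam.-negligible (S @^-1` B `+` B) -> lam B = 0%E \/ lam B = 1%E) ->
  forall k, lam.-negligible [set x : X | iter k.+1 S x = x].
Proof.
move=> lam1 lamI mS lamS erg k; set P := [set x | _].
have mP : measurable (P : set X) by apply: measurable_periodic => B; exact: iter_measurable.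
have PS : P `<=` S @^-1` P by move=> x; rewrite /P /= -iterS iterSr => ->.
(* The set of points of period [k + 1] is contained in its preimage, which has the same measure; so
   it is almost invariant, and of measure 0 or 1. *)
have nP : lam.-negligible (S @^-1` P `+` P).
  rewrite /setY (_ : P `\` _ = set0) ?setU0; last by apply/seteqP; split=> x // [/PS].
  exists (S @^-1` P `\` P); split=> //; first by apply: measurableD => //; exact: mS.
  have mSP := mS _ mP; have mD : measurable (S @^-1` P `\` P : set X) by exact: measurableD.
  rewrite -(prE lam1 mD); congr (_%:E).
  have : pr lam (P `|` (S @^-1` P `\` P)) = pr lam P + pr lam (S @^-1` P `\` P).
    by apply: (pr_disjU lam1) => //; rewrite setDIK.
  rewrite setDUK// {1}/pr lamS// -/(pr lam P).
  by move: (pr lam P) (pr lam _) => a b; lra.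
have [P0|P1] := erg P mP nP; first by exists P; split; [exact: mP|exact: P0|].
(* [k + 1] preimages of an interval of length [1 / (k+2)] cannot fill a set of measure 1, while the
   interval alone has positive measure. *)
exfalso; pose t : R := k.+2%:R^-1.
have t0 : 0 < t by rewrite invr_gt0 ltr0n.
have t1 : t <= 1 by rewrite invf_le1 ?ltr0n// ler1n.
pose J : set X := `[0, t]%classic; have mJ : measurable J by exact: measurable_itv.
have prJ : pr lam J = t by rewrite /pr lamI// (ltW t0).
pose B := \bigcup_(i in `I_k.+1) (iter i S @^-1` J : set X).
have mI i : measurable (iter i S @^-1` J : set X) by exact: iter_measurable.
have mB : measurable B by apply: bigcup_measurable.
have nB : lam.-negligible (S @^-1` B `+` B).
  exists (~` P); split; first exact: measurableC.
    have mC : measurable (~` P : set X) by exact: measurableC.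
    by rewrite -(prE lam1 mC) pr_setC// /pr P1 subrr.
  move=> x hx Px; case: hx => -[]; rewrite /B.
    move=> [i /= ik Ji]; apply; move: ik; rewrite ltnS leq_eqVlt => /orP[/eqP ik|ik].
      by exists 0%N => //=; move: Ji; rewrite ik -iterSr Px.
    by exists i.+1 => //=; rewrite -iterS iterSr.
  move=> [[|i] /= ik Ji]; apply; first by exists k => //=; rewrite -iterSr Px.
  by exists i => /=; [exact: ltnW|rewrite -iterSr].
have := erg B mB nB.
have : pr lam B <= k.+1%:R * t.
  apply: (pr_bigsetU lam1) => // i _.
  by rewrite /pr (iter_preserves mS lamS)// -/(pr lam J) prJ.
have : t <= pr lam B by rewrite -prJ; apply: (pr_le lam1) => // x Jx; exists 0%N.
have : k.+1%:R * t < 1 by rewrite ltr_pdivrMr ?ltr0n// mul1r ltr_nat.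
by move=> h1 h2 h3 [] e; move: h2 h3; rewrite /pr e /=; lra.
Qed.

End ergodicity.

(** * Transport from the interval *)

(** By separability, [g y] differs from [y] if and only if one ball of a countable family contains
    [y] and not [g y]. This makes the failure set of an almost everywhere identity on [V] Borel. *)
Lemma measurable_neq_self {R : realType} {V : normedModType R[i]} (g : borel V -> borel V) :
  separable V -> measurable_fun setT g -> measurable ([set y | g y <> y] : set (borel V)).
Proof.
move=> /ball_base[c [r [r0 base]]] mg.
pose K n : set (borel V) := [set y : V | nrm (y - c n) <= r n].
have mK n : measurable (K n).
  rewrite -[K n]setCK; apply: measurableC; apply: open_borel; rewrite openE => y /negP.
  rewrite -ltNge => hy; apply/nbhs_nrm; exists (nrm (y - c n) - r n); first by rewrite subr_gt0.
  move=> y' hy'; rewrite /K /=; have := nrm_tri y' y (c n); rewrite (nrm_sub y y'); lra.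
rewrite (_ : [set y | _] = \bigcup_n (K n `\` g @^-1` K n)).
  apply: bigcupT_measurable => n; apply: measurableD => //.
  by rewrite -[X in measurable X]setTI; exact: mg.
apply/seteqP; split=> y /=; last by move=> [n _ [Ky nKy]] gy; apply: nKy; rewrite /= gy.
move=> gy; have e0 : 0 < nrm (y - g y : V).
  by apply: nrm_gt0; rewrite subr_eq0; apply/eqP => e; exact: gy.
have e3 : 0 < nrm (y - g y : V) / 3 by rewrite divr_gt0.
have [n /andP[cn rn]] := base y _ e3; exists n => //; split.
  by rewrite /K /= nrm_sub.
by rewrite /K /= => h; have := nrm_tri (c n) y (g y); rewrite (nrm_sub y (c n)) (nrm_sub (c n) (g y)); lra.
Qed.

Section transport.
Context {R : realType} d (X : measurableType d) (mu : probability X R).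
Local Notation I := (measurableTypeR R).
Variable lam : {measure set I -> \bar R}.
Variables (phi : X -> R) (psi : R -> X).
Hypothesis mphi : measurable_fun setT (phi : X -> I).
Hypothesis phi_pres : preserving_mod_null mu lam (phi : X -> I).
Hypothesis psi_pres : preserving_mod_null lam mu (psi : I -> X).
Hypothesis psi_phi : mu.-negligible [set x | psi (phi x) <> x].
Hypothesis phi_psi : lam.-negligible [set y : I | phi (psi y) <> y].

(** [S] is a Borel version, preserving [lam] exactly, of the transported map [phi o T o psi], which
    itself is measurable only modulo null sets. *)
Definition conj_of (T : X -> X) (S : R -> R) :=
  [/\ forall B : set I, measurable B -> measurable (S @^-1` B : set I),
      forall B : set I, measurable B -> lam (S @^-1` B) = lam B &
      lam.-negligible [set y : I | phi (T (psi y)) <> S y]].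

Lemma exists_conj T : preserving_mod_null mu mu T -> exists S, conj_of T S.
Proof.
move=> hT; have hS0 := preserving_comp psi_pres (preserving_comp hT phi_pres).
have [S mS eS] := measurable_version hS0; exists S.
have hS := @eq_preserving R _ _ I I lam lam _ _ eS hS0; split=> // B mB.
  by rewrite -[X in measurable X]setTI; exact: mS.
exact: preserving_preimage hS mS mB.
Qed.

Lemma conj_semi T S : preserving_mod_null mu mu T -> conj_of T S ->
  mu.-negligible [set x | phi (T x) <> S (phi x)].
Proof.
move=> hT [_ _ eS].
apply: negligibleS (negligibleU psi_phi (negligible_preimage phi_pres eS)) => x ne.
apply: contrapT => no; apply: ne.
have e1 : psi (phi x) = x by apply: contrapT => h; apply: no; left.
have : phi (T (psi (phi x))) = S (phi x) by apply: contrapT => h; apply: no; right.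
by rewrite e1.
Qed.

(** Applied in both orders to [T] and its inverse modulo null sets, it makes their versions on the
    line inverse to each other almost everywhere. *)
Lemma conj_cancel T1 T2 S1 S2 : preserving_mod_null mu mu T2 -> conj_of T1 S1 -> conj_of T2 S2 ->
  mu.-negligible [set x | T1 (T2 x) <> x] -> lam.-negligible [set y : I | S1 (S2 y) <> y].
Proof.
move=> hT2 [mS1 _ e1] [mS2 lS2 e2] T12.
have pS2 : preserving_mod_null lam lam (S2 : I -> I).
  by apply: preserving_measurable => // _ B mB; rewrite setTI; exact: mS2.
have n1 := negligible_preimage pS2 e1.
have n2 := negligible_preimage (preserving_comp psi_pres hT2) psi_phi.
have n3 := negligible_preimage psi_pres T12.
apply: negligibleS (negligibleU (negligibleU e2 n1) (negligibleU n2 (negligibleU n3 phi_psi))) => y ne.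
apply: contrapT => no; apply: ne.
have h1 : phi (T2 (psi y)) = S2 y by apply: contrapT => h; apply: no; left; left.
have h2 : phi (T1 (psi (S2 y))) = S1 (S2 y) by apply: contrapT => h; apply: no; left; right.
have h3 : psi (phi (T2 (psi y))) = T2 (psi y) by apply: contrapT => h; apply: no; right; left.
have h4 : T1 (T2 (psi y)) = psi y by apply: contrapT => h; apply: no; right; right; left.
have h5 : phi (psi y) = y by apply: contrapT => h; apply: no; right; right; right.
by rewrite -h2 -h1 h3 h4 h5.
Qed.

Lemma conj_ergodic T S (B : set I) : measure_preserving mu T -> ergodic mu T -> conj_of T S ->
  measurable B -> lam.-negligible (S @^-1` B `+` B) -> lam B = 0%E \/ lam B = 1%E.
Proof.
move=> mpT erg cS mB nB; have hT := preserving_measurable mpT.1 mpT.2.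
rewrite -!(preserving_preimage phi_pres mphi mB); apply: (ergodic_mod_null mpT erg).
  by rewrite -[X in measurable X]setTI; exact: mphi.
have n1 := negligible_preimage phi_pres nB.
have n2 := negligible_eq_setY B (conj_semi hT cS).
exact: negligibleS (@setY_sub _ _ ((S \o phi) @^-1` B) _) (negligibleU n2 n1).
Qed.

Context {V : completeNormedModType R[i]}.
Hypothesis sepV : separable V.
Variables (A : V -> V) (z : int -> V) (xi : V -> R[i]) (p : {poly R[i]}).
Hypothesis orb : backward_orbit A z xi p.
Hypothesis Alin : forall a x y, A (a *: x + y) = a *: A x + A y.
Variable cA : R.
Hypothesis cA0 : 0 <= cA.
Hypothesis Abound : forall x, nrm (A x) <= cA * nrm x.
Hypothesis lam1 : lam setT = 1%E.
Hypothesis lam01 : lam (~` `[0, 1]%classic) = 0%E.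
Hypothesis lam_itv : forall t : R, 0 <= t <= 1 -> lam `[0, t]%classic = t%:E.
Variable T : X -> X.
Hypothesis mpT : measure_preserving mu T.
Hypothesis erg : ergodic mu T.

Lemma borel_operator : measurable_fun setT (A : borel V -> borel V).
Proof.
apply: (@measurability _ _ (borel V) (borel V) setT A (@open V)) => //.
move=> _ [U oU <-]; rewrite setTI; apply: open_borel; rewrite openE => y Uy.
have : nbhs (A y) U by apply: open_nbhs_nbhs.
move=> /nbhs_nrm[t t0 hU]; apply/nbhs_nrm; have c1 : 0 < cA + 1 by rewrite ltr_wpDl.
exists (t / (cA + 1)); first by rewrite divr_gt0.
move=> y'; rewrite ltr_pdivlMr// => hy'; apply: hU.
apply: le_lt_trans (A_sub Alin Abound y' y) _; apply: le_lt_trans hy'.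
by rewrite mulrDr mulr1 [leLHS]mulrC lerDl nrm_ge0.
Qed.

(** The invariant measure on [V] is the image of [mu] under [Phi o phi], and the inverse isomorphism
    is [psi o chi]. Invariance under [A] comes from the equivariance of [Phi], and full support from
    the positive measure of preimages of open sets. *)
Lemma modeled_of_orbit (tau : int -> R -> R) (good : int -> Prop) :
  conj_of T (tau 1) -> (forall (k : nat) x, tau k x = iter k (tau 1) x) ->
  (forall n (B : set I), measurable B -> measurable (tau n @^-1` B : set I)) ->
  (forall n (B : set I), measurable B -> lam (tau n @^-1` B) = lam B) ->
  (forall n, ~ good n -> z n = 0) -> (forall n, good n -> good (n + 1)) ->
  (forall n, good n -> lam.-negligible [set x : I | tau 1 (tau n x) <> tau (n + 1) x]) ->
  (forall n, good n -> lam.-negligible [set x : I | tau n (tau 1 x) <> tau (n + 1) x]) ->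
  modeled_by A mu T.
Proof.
move=> cS tau_pos mtau lam_tau z_good good_next S_tau tau_S.
have aper := ergodic_aperiodic lam1 lam_itv (mtau 1) (lam_tau 1)
  (fun B mB nB => conj_ergodic mpT erg cS mB nB).
have [Phi [chi [mPhi mchi chi_Phi PhiS supp]]] := model_on_interval sepV orb Alin cA0 Abound
  tau_pos lam1 lam01 mtau lam_tau aper z_good good_next S_tau tau_S.
have hT := preserving_measurable mpT.1 mpT.2.
have mF : measurable_fun setT (Phi \o phi : X -> borel V) by exact: measurableT_comp.
pose nu := distribution mu (mfun_Sub (mem_set mF)).
have mpre (B : set (borel V)) : measurable B -> measurable (Phi @^-1` B : set I).
  by move=> mB; rewrite -[X in measurable X]setTI; exact: mPhi.
have nuE (B : set (borel V)) : measurable B -> nu B = lam (Phi @^-1` B).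
  by move=> mB; rewrite -(preserving_preimage phi_pres mphi (mpre _ mB)).
have Phi_pres : preserving_mod_null lam nu (Phi : I -> borel V).
  by apply: preserving_measurable => // B mB; exact: esym (nuE B mB).
have F_pres : preserving_mod_null mu nu (Phi \o phi : X -> borel V) by exact: preserving_comp Phi_pres.
have chi_pres : preserving_mod_null nu lam (chi : borel V -> I).
  apply: preserving_measurable => // B mB; have mcB : measurable (chi @^-1` B : set (borel V)).
    by rewrite -[X in measurable X]setTI; exact: mchi.
  apply: etrans (nuE _ mcB) _; apply: eq_measure_negligible => //; first exact: mpre.
  exact: (negligible_eq_setY B chi_Phi).
(* The failure set is Borel, so its measure can be computed through [Phi]: its preimage consists of
   points where [chi o Phi] already fails to be the identity. *)
have Phi_chi : nu.-negligible [set y : borel V | Phi (chi y) <> y].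
  have mg : measurable_fun setT (Phi \o chi : borel V -> borel V) by exact: measurableT_comp.
  have mne := measurable_neq_self sepV mg.
  exists [set y : borel V | (Phi \o chi) y <> y]; split=> //; apply: etrans (nuE _ mne) _.
  have [N [mN N0 sN]] := chi_Phi; apply: (@subset_measure0 _ _ _ lam _ N) => //.
    exact: mpre.
  by move=> x hx; apply: sN => e; apply: hx; rewrite /= e.
have AF : mu.-negligible [set x | (Phi \o phi) (T x) <> A ((Phi \o phi) x)].
  apply: negligibleS (negligibleU (conj_semi hT cS) (negligible_preimage phi_pres PhiS)) => x ne.
  apply: contrapT => no; apply: ne.
  have e1 : phi (T x) = tau 1 (phi x) by apply: contrapT => h; apply: no; left.
  have e2 : Phi (tau 1 (phi x)) = A (Phi (phi x)) by apply: contrapT => h; apply: no; right.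
  by rewrite /= e1 e2.
exists nu; split.
- split=> [|B mB]; first exact: borel_operator.
  have mAB : measurable (A @^-1` B : set (borel V)).
    by rewrite -[X in measurable X]setTI; exact: borel_operator.
  apply: etrans (nuE _ mAB) (etrans _ (esym (nuE _ mB))).
  apply: etrans (lam_tau 1 _ (mpre _ mB)); apply: eq_measure_negligible.
  + exact: mpre.
  + exact: mtau (mpre _ mB).
  + by rewrite setYC; exact: (negligible_eq_setY B PhiS).
- move=> U oU U0; have mU : measurable (Phi @^-1` U : set I) by apply: mpre; exact: open_borel.
  by rewrite [X in (_ < X)%E](nuE _ (open_borel oU)) -(prE lam1 mU) lte_fin; exact: supp.
- exists (Phi \o phi) => //; split=> //; exists (psi \o chi); split.
  + exact: preserving_comp chi_pres psi_pres.
  + apply: negligibleS (negligibleU psi_phi (negligible_preimage phi_pres chi_Phi)) => x ne.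
    apply: contrapT => no; apply: ne => /=.
    have -> : chi (Phi (phi x)) = phi x by apply: contrapT => h; apply: no; right.
    by apply: contrapT => h; apply: no; left.
  + apply: negligibleS (negligibleU Phi_chi (negligible_preimage chi_pres phi_psi)) => y ne.
    apply: contrapT => no; apply: ne => /=.
    have -> : phi (psi (chi y)) = chi y by apply: contrapT => h; apply: no; right.
    by apply: contrapT => h; apply: no; left.
Qed.

End transport.

Section unit_interval.
Context {R : realType}.
Local Notation I := (measurableTypeR R).

Definition unit_lebesgue : {measure set I -> \bar R} :=
  mrestr (@lebesgue_measure R) (measurable_itv `[0, 1]).

Lemma unit_lebesgue_itv (t : R) : 0 <= t <= 1 -> unit_lebesgue `[0, t]%classic = t%:E.
Proof.
move=> /andP[t0 t1]; rewrite /unit_lebesgue /= /mrestr.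
have -> : (`[0, t] `&` `[0, 1] = `[0, t] :> set R)%classic.
  apply/setIidPl => x /=; rewrite !in_itv /= => /andP[-> h].
  exact: le_trans t1.
rewrite lebesgue_measure_itv /= lte_fin; case: ltP => [_|t0']; first by rewrite -EFinD subr0.
by congr (_%:E); apply/eqP; rewrite eq_le t0 t0'.
Qed.

Lemma unit_lebesgueT : unit_lebesgue setT = 1%E.
Proof.
have := @unit_lebesgue_itv 1; rewrite lexx ler01 => /(_ isT) <-.
by rewrite /unit_lebesgue /= /mrestr setTI setIid.
Qed.

Lemma unit_lebesgue_out : unit_lebesgue (~` `[0, 1]%classic) = 0%E.
Proof. by rewrite /unit_lebesgue /= /mrestr setICl measure0. Qed.

Lemma standard_lebesgue_version d (X : measurableType d) (mu : probability X R) :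
  standard_lebesgue mu -> exists (phi : X -> R) (psi : R -> X),
    [/\ measurable_fun setT (phi : X -> I), preserving_mod_null mu unit_lebesgue (phi : X -> I),
        preserving_mod_null unit_lebesgue mu (psi : I -> X),
        mu.-negligible [set x | psi (phi x) <> x] &
        unit_lebesgue.-negligible [set y : I | phi (psi y) <> y]].
Proof.
move=> [phi0 [phi0_pres [psi [psi_pres psi_phi phi_psi]]]].
have [phi mphi e] := measurable_version phi0_pres.
exists phi, psi; split=> //; first exact: (@eq_preserving R _ _ X I mu unit_lebesgue _ _ e phi0_pres).
  apply: negligibleS (negligibleU psi_phi e) => x ne; apply: contrapT => no; apply: ne.
  have <- : phi0 x = phi x by apply: contrapT => h; apply: no; right.
  by apply: contrapT => h; apply: no; left.
apply: negligibleS (negligibleU phi_psi (negligible_preimage psi_pres e)) => y ne.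
apply: contrapT => no; apply: ne.
have <- : phi0 (psi y) = phi (psi y) by apply: contrapT => h; apply: no; right.
by apply: contrapT => h; apply: no; left.
Qed.

End unit_interval.

(** * Universality from a backward orbit *)

Section universality.
Context {R : realType} {V : completeNormedModType R[i]}.
Hypothesis sepV : separable V.
Variables (A : V -> V) (z : int -> V) (xi : V -> R[i]) (p : {poly R[i]}).
Hypothesis orb : backward_orbit A z xi p.
Hypothesis Alin : forall a x y, A (a *: x + y) = a *: A x + A y.
Hypothesis Abd : bounded_operator A.
Local Notation I := (measurableTypeR R).
Local Notation lam := (@unit_lebesgue R).

(** [T] and its inverse modulo null sets are transported separately; negative powers are iterates of
    the version [S'] of the inverse, and all indices are good. *)
Lemma universal_invertible_of_orbit : universal_for_invertible_ergodic A.
Proof.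
have [cA cA0 Abound] := bounded_operator_nrm Abd.
move=> d X mu T std mpT [_ [T' [T'_pres T'T TT']]] erg.
have [phi [psi [mphi phi_pres psi_pres psi_phi phi_psi]]] := standard_lebesgue_version std.
have hT := preserving_measurable mpT.1 mpT.2.
have [S cS] := exists_conj phi_pres psi_pres hT.
have [S' cS'] := exists_conj phi_pres psi_pres T'_pres.
have SS' := conj_cancel psi_pres psi_phi phi_psi T'_pres cS cS' TT'.
have S'S := conj_cancel psi_pres psi_phi phi_psi hT cS' cS T'T.
have [[mS lS _] [mS' lS' _]] := (cS, cS').
have pred_neg k : Negz k.+1 + 1 = Negz k by rewrite !NegzE -addn1 PoszD opprD addrNK.
have itS' k : preserving_mod_null lam lam (iter k S' : I -> I).
  apply: preserving_measurable => [_ B mB|B mB]; first by rewrite setTI; exact: iter_measurable.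
  exact: iter_preserves.
pose tau (n : int) : R -> R := match n with Posz k => iter k S | Negz k => iter k.+1 S' end.
apply: (modeled_of_orbit mphi phi_pres psi_pres psi_phi phi_psi sepV orb Alin cA0 Abound
  unit_lebesgueT unit_lebesgue_out unit_lebesgue_itv mpT erg (tau := tau) (good := fun=> True)) => //.
- by move=> [k|k] B mB; exact: iter_measurable.
- by move=> [k|k] B mB; exact: iter_preserves.
- move=> [k|[|k]] _.
  + by apply: negligibleS (negligible_set0 _) => x; apply; rewrite /= addn1.
  + exact: SS'.
  + by rewrite pred_neg; exact: negligible_preimage (itS' k.+1) SS'.
- move=> [k|[|k]] _.
  + by apply: negligibleS (negligible_set0 _) => x; apply; rewrite /= addn1 -iterSr.
  + exact: S'S.
  + apply: negligibleS S'S => x ne h; apply: ne.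
    by rewrite pred_neg /tau iterSr /= h.
Qed.

(** [S] need not have an inverse: at negative times [tau] is the identity, a dummy multiplied by
    [z n = 0], and only the indices [n >= 0] are good. *)
Lemma universal_of_orbit : (forall k, z (Negz k) = 0) -> universal_for_ergodic A.
Proof.
move=> z0; have [cA cA0 Abound] := bounded_operator_nrm Abd.
move=> d X mu T std mpT erg.
have [phi [psi [mphi phi_pres psi_pres psi_phi phi_psi]]] := standard_lebesgue_version std.
have [S cS] := exists_conj phi_pres psi_pres (preserving_measurable mpT.1 mpT.2).
have [mS lS _] := cS.
pose tau (n : int) : R -> R := match n with Posz k => iter k S | Negz _ => id end.
apply: (modeled_of_orbit mphi phi_pres psi_pres psi_phi phi_psi sepV orb Alin cA0 Abound
  unit_lebesgueT unit_lebesgue_out unit_lebesgue_itv mpT erg (tau := tau) (good := fun n => 0 <= n)) => //.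
- by move=> [k|k] B mB //; exact: iter_measurable.
- by move=> [k|k] B mB //; exact: iter_preserves.
- by move=> [k|k] // /(_ isT).
- by move=> [k|k].
- by move=> [k|k] // _; apply: negligibleS (negligible_set0 _) => x; apply; rewrite /= addn1.
- by move=> [k|k] // _; apply: negligibleS (negligible_set0 _) => x; apply; rewrite /= addn1 -iterSr.
Qed.

End universality.

Theorem theorem1p8 (R : realType) (Z : completeNormedModType R[i])
    (A : {linear Z -> Z}) :
  separable Z -> infinite_dimensional Z -> bounded_operator A ->
  ((exists E : R[i] -> Z,
      spanning_analytic_eigenvectorfield unit_circle A E) ->
    universal_for_invertible_ergodic A) /\
  ((exists E : R[i] -> Z,
      spanning_analytic_eigenvectorfield closed_unit_disk A E) ->
    universal_for_ergodic A).
Proof.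
move=> sepZ infZ Abd; have Alin : forall a x y, A (a *: x + y) = a *: A x + A y by move=> *; exact: linearP.
split=> [[E hE]|[E hE]].
  have [z [xi [p orb]]] := orbit_circle infZ Abd hE.
  exact: universal_invertible_of_orbit orb Alin Abd.
have [z [xi [p [orb z0]]]] := orbit_disk infZ Abd hE.
exact: universal_of_orbit orb Alin Abd z0.
Qed.
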